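(* Let $n\ge 3$ be an integer and let $f:(0,\infty)\to(0,\infty)$ be a continuous function which satisfies $$\liminf_{s\to 0^+}\frac{f(s)}{s^{1+\frac{4}{n-2}}}>0\quad\text{and}\quad \lim_{s\to\infty}\frac{f(s)}{s^{-1}}=\infty.$$ Then the inequality $$-\Delta^2 v\ge f(v)$$ has no $C^4$ positive solution $v$ in any exterior domain of $\mathbb{R}^n$.
   Context: $\Delta^2=\Delta\circ\Delta$ is the biharmonic operator. An exterior domain of $\mathbb{R}^n$ is the complement $\mathbb{R}^n\setminus K$ of a compact set $K\subset\mathbb{R}^n$. A $C^4$ positive solution is a $C^4$ function $v>0$ satisfying the inequality pointwise. *)

(* Defs.v *)
From HB Require Import structures.
From mathcomp Require Import all_boot all_order all_algebra.
From mathcomp Require Import all_classical all_reals all_analysis.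
Import Order.TTheory GRing.Theory Num.Theory.
Import numFieldNormedType.Exports.

Set Implicit Arguments.
Unset Strict Implicit.
Unset Printing Implicit Defensive.

Local Open Scope classical_set_scope.
Local Open Scope ring_scope.

(* A function on an open set U is represented by a total function of which
   only the values on U matter: at a point of U, derivability, the value of a
   derivative and continuity are local, so they do not see the values outside
   of U. *)

Definition partial {R : realType} {n : nat} (i : 'I_n) (u : 'rV[R]_n -> R) :
    'rV[R]_n -> R :=
  fun x => 'D_(delta_mx 0 i) u x.

Definition laplacian {R : realType} {n : nat} (u : 'rV[R]_n -> R) :
    'rV[R]_n -> R :=
  fun x => \sum_(i < n) partial i (partial i u) x.

Definition biharmonic {R : realType} {n : nat} (u : 'rV[R]_n -> R) :
    'rV[R]_n -> R :=
  laplacian (laplacian u).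

(* For U open, class C^k on U: all iterated partial derivatives of order at
   most k exist and are continuous on U. *)
Fixpoint Ck {R : realType} {n : nat} (U : set 'rV[R]_n) (k : nat)
    (u : 'rV[R]_n -> R) : Prop :=
  {within U, continuous u} /\
  (if k is k'.+1 then
     forall i : 'I_n,
       (forall x, U x -> derivable u x (delta_mx 0 i)) /\ Ck U k' (partial i u)
   else True).

Definition exterior_domain {R : realType} {n : nat} (U : set 'rV[R]_n) : Prop :=
  exists2 K : set 'rV[R]_n, compact K & U = ~` K.

Definition C4_positive_solution {R : realType} {n : nat} (f : R -> R)
    (U : set 'rV[R]_n) (v : 'rV[R]_n -> R) : Prop :=
  [/\ Ck U 4 v,
      forall x, U x -> 0 < v x &
      forall x, U x -> - biharmonic v x >= f (v x)].

(* Main.v *)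
(* Put q = |z|^2 and let b be a C^3 bump supported in [1, 4].  The averages
   V(s) = s^-n I[v b(q/s^2)],  W(s) = s^-n I[(Lap v) (t b)(q/s^2)]  and
   F(s) = - s^-n I[(Lap^2 v) (t^2 b)(q/s^2)]  (t the argument of b) satisfy, by
   integration by parts,  V'' + (n-1)/s V' = W  and  W'' + (n-1)/s W' = -F.
   With p = 1 + 4/(n-2), the hypotheses on f give f(s) >= c s^p m^(-1-p) for
   s <= m and 1 <= m; since a nonnegative v with Lap^2 v <= 0 is bounded on a
   shell by its averages V at comparable radii, Jensen's inequality yields
   F >= c V^p m^(-1-p) whenever m >= 1 bounds V near s.  This system has no
   positive solution.  Indeed s^(n-1) W' is nonincreasing.  Either W becomes
   positive: then W >= c s^(2-n), V grows at most quadratically, F >= c/s^2 and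
   W would tend to -oo like - ln s.  Or W <= 0 throughout: then
   phi = s^(n-2) V is nondecreasing with phi' >= c phi^p / s, so that phi blows
   up at a finite radius. *)

Require Import Defs.
From mathcomp Require Import all_boot all_order all_algebra.
From mathcomp Require Import all_classical all_reals all_analysis.
From mathcomp Require Import ring lra.
Import Order.TTheory GRing.Theory Num.Theory.
Import numFieldNormedType.Exports.
Local Open Scope classical_set_scope.
Local Open Scope ring_scope.

Set Implicit Arguments.
Unset Strict Implicit.
Unset Printing Implicit Defensive.

(** Averages against a smooth bump in q / s^2 stand in for spherical means, so no surface measure is
    needed. The factor t in the weights comes from scaling: formally V(s) is the integral of v(s y)
    b(|y|^2), and the radial operator in s turns v(s y) into |y|^2 (Lap v)(s y).

    The obstacle is that f is bounded below only by s^p near 0 and by 1/s near infinity, while v has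
    no a priori upper bound. For s <= m and 1 <= m the function s^p m^(-1-p) is at most s^p and at
    most 1/s, and it is convex in s. Convexity lets it pass to averages, but only if m bounds v on
    the whole shell; this is why a pointwise bound by averages is required.

    The exponent satisfies p (n - 2) = n + 2. When W <= 0, integrating the source V^p with V =
    s^(2-n) phi yields the power 1/s exactly, the borderline at which the logarithm still diverges.
    When W becomes positive, p cancels: V is doubling, m can be a multiple of V(s), and the minorant
    is of order 1/V(s). *)

Ltac feed H := match type of H with ?A -> _ =>
  let h := fresh "h" in assert (h : A); [|specialize (H h); clear h] end.

(** * Derivatives and increments of functions of one variable *)

Section OneVariable.
Variable R : realType.
Implicit Types (f g h : R -> R) (a b c s x : R).

Lemma is_derive1D f g x df dg : is_derive x 1 f df -> is_derive x 1 g dg ->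
  is_derive x 1 (fun y => f y + g y) (df + dg).
Proof. by move=> f_df g_dg; exact: (is_deriveD f_df g_dg). Qed.

Lemma is_derive1M f g x df dg : is_derive x 1 f df -> is_derive x 1 g dg ->
  is_derive x 1 (fun y => f y * g y) (df * g x + f x * dg).
Proof.
move=> f_df g_dg; apply: is_derive_eq (is_deriveM f_df g_dg) _.
by rewrite addrC -![_ *: _]/(_ * _) [g x * _]mulrC.
Qed.

Lemma is_derive1Z c f x df : is_derive x 1 f df ->
  is_derive x 1 (fun y => c * f y) (c * df).
Proof. by move=> f_df; exact: (is_deriveZ c f_df). Qed.

Lemma is_derive1_expr f x df m : is_derive x 1 f df ->
  is_derive x 1 (fun y => f y ^+ m) (m%:R * f x ^+ m.-1 * df).
Proof.
move=> f_df; have := is_deriveX m f_df.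
by rewrite (_ : f ^+ m = fun y => f y ^+ m) //; apply/funext => y; rewrite fctE.
Qed.

Lemma is_derive1_chain f g x df dg : is_derive (g x) 1 f df ->
  is_derive x 1 g dg -> is_derive x 1 (fun y => f (g y)) (df * dg).
Proof. by move=> f_df g_dg; exact: (is_derive1_comp f_df g_dg). Qed.

Lemma is_derive1_id x : is_derive x 1 (fun y : R => y) 1.
Proof. exact: is_derive_id. Qed.

Lemma is_derive1_exprn x m : is_derive x 1 (fun y : R => y ^+ m) (m%:R * x ^+ m.-1).
Proof.
by have := is_derive1_expr m (is_derive1_id x); rewrite mulr1.
Qed.

Lemma is_derive1_exprVn x m : 0 < x ->
  is_derive x 1 (fun y : R => y^-1 ^+ m) (- m%:R * x^-1 ^+ m.+1).
Proof.
move=> x_gt0; have x_neq0 : x != 0 by rewrite gt_eqF.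
have dV : is_derive x 1 (fun y : R => y^-1) (- x^-1 ^+ 2).
  apply: is_derive_eq (is_deriveV _ (is_derive1_id x)) _ => //.
  by rewrite -[_ *: _]/(_ * _) mulr1 exprVn.
apply: is_derive_eq (is_derive1_expr m dV) _.
move: (x^-1) => i; case: m => [|m] /=; first by rewrite !mul0r oppr0 mul0r.
by rewrite !exprS; ring.
Qed.

Lemma mvt_is_derive f f' a b : a <= b ->
  (forall x, a <= x <= b -> is_derive x 1 f (f' x)) ->
  exists2 c, a <= c <= b & f b - f a = f' c * (b - a).
Proof.
move=> le_ab f_f'; have [||c c_in fE] := @MVT_segment R f f' a b le_ab.
- by move=> x; rewrite in_itv /= => /andP[/ltW ax /ltW xb]; apply: f_f'; rewrite ax.
- apply: derivable_within_continuous => x; rewrite in_itv /= => x_in.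
  by have [] := f_f' x x_in.
by exists c => //; move: c_in; rewrite in_itv.
Qed.

Lemma derive_le_increment f f' g g' a b : a <= b ->
  (forall x, a <= x <= b -> is_derive x 1 f (f' x)) ->
  (forall x, a <= x <= b -> is_derive x 1 g (g' x)) ->
  (forall x, a <= x <= b -> f' x <= g' x) -> f b - f a <= g b - g a.
Proof.
move=> le_ab f_f' g_g' le_fg.
have [x x_in|c c_in cE] := @mvt_is_derive (fun y => g y + (-1) * f y)
    (fun y => g' y + (-1) * f' y) a b le_ab.
  by apply: is_derive1D; [exact: g_g'|apply: is_derive1Z; exact: f_f'].
have : 0 <= (g' c + -1 * f' c) * (b - a).
  by apply: mulr_ge0; rewrite ?subr_ge0 // mulN1r subr_ge0 le_fg.
by rewrite -cE; lra.
Qed.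

Lemma increment_ge f f' l a b : a <= b ->
  (forall x, a <= x <= b -> is_derive x 1 f (f' x)) ->
  (forall x, a <= x <= b -> l <= f' x) -> l * (b - a) <= f b - f a.
Proof.
move=> le_ab f_f' le_f; rewrite mulrBr.
apply: (@derive_le_increment (fun x => l * x) (fun=> l) f f') => // x _.
by apply: is_derive_eq (is_derive1Z l (is_derive1_id x)) _; rewrite mulr1.
Qed.

Lemma increment_le f f' l a b : a <= b ->
  (forall x, a <= x <= b -> is_derive x 1 f (f' x)) ->
  (forall x, a <= x <= b -> f' x <= l) -> f b - f a <= l * (b - a).
Proof.
move=> le_ab f_f' le_f; rewrite mulrBr.
apply: (@derive_le_increment f f' (fun x => l * x) (fun=> l)) => // x _.
by apply: is_derive_eq (is_derive1Z l (is_derive1_id x)) _; rewrite mulr1.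
Qed.

Lemma derive_ge0_le f f' a b : a <= b ->
  (forall x, a <= x <= b -> is_derive x 1 f (f' x)) ->
  (forall x, a <= x <= b -> 0 <= f' x) -> f a <= f b.
Proof. by move=> le_ab f_f' f'_ge0; have := increment_ge le_ab f_f' f'_ge0; rewrite mul0r subr_ge0. Qed.

Lemma derive_le0_le f f' a b : a <= b ->
  (forall x, a <= x <= b -> is_derive x 1 f (f' x)) ->
  (forall x, a <= x <= b -> f' x <= 0) -> f b <= f a.
Proof. by move=> le_ab f_f' f'_le0; have := increment_le le_ab f_f' f'_le0; rewrite mul0r subr_le0. Qed.

End OneVariable.

(** * The sup norm on row vectors and derivatives along lines *)

Section RowVectorNorm.
Variables (R : realType) (n : nat).
Implicit Types (x y z : 'rV[R]_n) (a : R).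

Lemma le_rV_norm x a : 0 <= a -> (`|x| <= a) = [forall i, `|x 0 i| <= a].
Proof.
move=> a_ge0; have -> : `|x| = mx_norm x by []. rewrite mx_normrE; apply/idP/forallP => [le_xa i|le_xa].
  by apply: le_trans le_xa; apply/bigmax_geP; right; exists (0, i).
by apply/bigmax_leP; split=> // -[i j] _ /=; rewrite ord1.
Qed.

Lemma coord_le_rV_norm x i : `|x 0 i| <= `|x|.
Proof. by have := le_rV_norm x (normr_ge0 x); rewrite lexx => /esym/forallP. Qed.

Lemma norm_delta_mx_le i : `|delta_mx 0 i : 'rV[R]_n| <= 1.
Proof.
rewrite le_rV_norm //; apply/forallP => j; rewrite mxE eqxx /=.
by case: eqP => _; rewrite ?normr1 ?normr0.
Qed.

Lemma is_derive_line (G : 'rV[R]_n -> R) z v t l : is_derive (z + t *: v) v G l ->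
  is_derive t 1 (fun s => G (z + s *: v)) l.
Proof.
have E : (fun h : R => h^-1 *: ((G \o shift (z + t *: v)) (h *: v) - G (z + t *: v))) =
    (fun h : R => h^-1 *: (((fun s => G (z + s *: v)) \o shift t) (h *: (1 : R)) - G (z + t *: v))).
  apply/funext => h /=; congr (_ *: (G _ - _)).
  by rewrite scalerDl [h *: 1]mulr1 addrCA addrA.
move=> [dG lE]; split; last first.
  by rewrite -lE /derive E.
by move: dG; rewrite /derivable E.
Qed.

Lemma derive_along_le (G H : 'rV[R]_n -> R) v z t e : 0 <= t ->
  (forall y, is_derive y v G (H y)) ->
  (forall s, 0 <= s <= t -> `|H (z + s *: v) - H z| <= e) ->
  `|G (z + t *: v) - G z - t * H z| <= t * e.
Proof.
move=> t_ge0 dG H_close.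
have [s s_in sE] := @mvt_is_derive _ (fun s => G (z + s *: v)) (fun s => H (z + s *: v))
  0 t t_ge0 (fun s _ => is_derive_line (dG _)).
rewrite scale0r addr0 subr0 in sE; rewrite sE mulrC -mulrBr normrM ger0_norm //.
by rewrite ler_wpM2l // H_close.
Qed.

Lemma uniform_continuity_bounded (H : 'rV[R]_n -> R) a e : continuous H -> 0 < e ->
  exists2 d, 0 < d & forall z y, `|z| <= a -> `|y| <= d -> `|H (z + y) - H z| <= e.
Proof.
move=> cH e_gt0.
have cK : compact [set z : 'rV[R]_n | `|z| <= a].
  apply: bounded_closed_compact.
    exists a; split; first exact: num_real.
    by move=> M aM z /= /le_trans; apply; exact: ltW.
  apply: (@closed_comp _ _ (fun z : 'rV[R]_n => `|z|) [set r : R | r <= a]).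
    by move=> z _; exact: norm_continuous.
  exact: closed_le.
(* The radius [d] is the parameter tending to 0 from the right in the near-covering form of
   compactness. *)
have [] := (proj1 (compact_near_coveringP _) cK) R 0^'+
  (fun d z => forall y, `|y| <= d -> `|H (z + y) - H z| <= e).
  move=> x _.
  have /cvgrPdist_lt/(_ (e / 2)) := cH x; rewrite divr_gt0 // => /(_ isT).
  move=> /nbhs_normP[r /= r_gt0 Hr].
  exists (ball x (r / 2), [set d | 0 < d < r / 2]) => /=.
    split; first by apply: nbhsx_ballx; rewrite divr_gt0.
    near=> d; apply/andP; split=> //.
    by near: d; apply: nbhs_right_lt; rewrite divr_gt0.
  move=> [z d] /= [xz /andP[d_gt0 dr]] y yd.
  move: xz; rewrite mx_norm_ball /ball_ /= => xz.
  have h1 : `|H x - H z| < e / 2 by apply: Hr => /=; lra.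
  have h2 : `|H x - H (z + y)| < e / 2.
    apply: Hr => /=; rewrite opprD addrA.
    by apply: le_lt_trans (ler_normB _ _) _; lra.
  have -> : H (z + y) - H z = (H x - H z) - (H x - H (z + y)) by ring.
  by apply: le_trans (ler_normB _ _) _; lra.
move=> d d_gt0 Hd; exists (d / 2); first by rewrite divr_gt0.
move=> z y za yd; apply: (Hd (d / 2)) => //=; last by rewrite divr_gt0.
by rewrite sub0r normrN gtr0_norm ?divr_gt0 // ltr_pdivrMr // ltr_pMr // ltr1n.
Unshelve. all: by end_near.
Qed.

End RowVectorNorm.

(** * A positive functional on bounded functions of bounded support *)

Section LatticeSum.
Variables (R : realType) (n : nat).
Implicit Types (x y z : 'rV[R]_n) (a b t : R) (m : nat).

Definition cube_indicator x a z : R := (`|z - x| <= a)%R%:R.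

(** Each axis carries [(m + 1)^2] nodes on either side of the origin, at distance [1 / (m + 1)]:
    they fill [[-(m + 1), m + 1[], so that the mesh tends to 0 while the cube exhausts the space. *)
Definition mesh m : R := m.+1%:R^-1.
Definition half_count m := (m.+1 * m.+1)%N.
Definition node m (i : nat) : R := (i%:R - (half_count m)%:R) * mesh m.
Definition lattice_point m (k : {ffun 'I_n -> 'I_(half_count m).*2}) : 'rV[R]_n :=
  \row_i node m (k i).
Definition lattice_sum m (G : 'rV[R]_n -> R) : R :=
  mesh m ^+ n * \sum_(k : {ffun 'I_n -> 'I_(half_count m).*2}) G (lattice_point k).

Lemma mesh_gt0 m : 0 < mesh m. Proof. by rewrite invr_gt0 ltr0n. Qed.

Lemma nodeS m i : node m i.+1 = node m i + mesh m.
Proof. by rewrite /node -natr1; ring. Qed.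

Lemma node0 m : node m 0 = - m.+1%:R.
Proof. by rewrite /node /half_count /mesh sub0r natrM; field; rewrite nat1r pnatr_eq0. Qed.

Lemma node_last m : node m (half_count m).*2 = m.+1%:R.
Proof. by rewrite /node /half_count /mesh -addnn natrD natrM; field; rewrite nat1r pnatr_eq0. Qed.

(** Nodes in an interval are counted by telescoping: an increment of [clamp] over one mesh step is
    the full mesh inside [[a, b]] and 0 outside. *)
Definition clamp a b t : R := Num.max a (Num.min b t).

Lemma clamp_step_ge a b t e : 0 <= e -> a <= t -> t + e <= b ->
  clamp a b (t + e) - clamp a b t = e.
Proof.
move=> e_ge0 at_ tb; rewrite /clamp (min_idPr tb) (min_idPr (_ : t <= b)); last by lra.
by rewrite (max_idPr (_ : a <= t + e)) ?(max_idPr at_); lra.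
Qed.

Lemma clamp_step_bounds a b t e : 0 <= e ->
  0 <= clamp a b (t + e) - clamp a b t <= e.
Proof.
move=> e_ge0; rewrite /clamp; case: (leP b (t + e)) => h1; case: (leP b t) => h2;
by case: (leP a b) => h3; case: (leP a t) => h4; case: (leP a (t + e)) => h5; lra.
Qed.

Lemma clamp_low a b t : a <= b -> t <= a -> clamp a b t = a.
Proof.
by move=> ab ta; rewrite /clamp; case: (leP b t) => h1; [case: (leP a b) => h2|case: (leP a t) => h2]; lra.
Qed.

Lemma clamp_high a b t : a <= b -> b <= t -> clamp a b t = b.
Proof.
by move=> ab ta; rewrite /clamp; case: (leP b t) => h1; [case: (leP a b) => h2|case: (leP a t) => h2]; lra.
Qed.

Lemma clamp_in a b t : a <= b -> a <= clamp a b t <= b.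
Proof.
by move=> ab; rewrite /clamp; case: (leP b t) => h1; [case: (leP a b) => h2|case: (leP a t) => h2]; lra.
Qed.

Definition window_sum m (c a : R) : R :=
  \sum_(i < (half_count m).*2) mesh m * (`|node m i - c| <= a)%R%:R.

Lemma window_sum_le m c a : 0 <= a -> window_sum m c a <= 2 * a + mesh m.
Proof.
move=> a_ge0; have h_gt0 := mesh_gt0 m.
pose L t := clamp (c - a) (c + a + mesh m) t.
have ab : c - a <= c + a + mesh m by lra.
apply: le_trans (_ : \sum_(i < (half_count m).*2) (L (node m i.+1) - L (node m i)) <= _).
  apply: ler_sum => i _; rewrite nodeS /L; case: ler_normlP => [[h1 h2]|_].
    by rewrite clamp_step_ge ?mulr1 //; lra.
  rewrite mulr0; by have /andP[] := clamp_step_bounds (c - a) (c + a + mesh m) (node m i) (ltW h_gt0).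
rewrite -(big_mkord xpredT (fun i => L (node m i.+1) - L (node m i))).
rewrite (telescope_sumr (fun i => L (node m i))) //.
have := clamp_in (node m (half_count m).*2) ab; have := clamp_in (node m 0) ab.
by rewrite /L; move: (clamp _ _ _) (clamp _ _ _) => u v; lra.
Qed.

(** The left end is moved in by one mesh, so that a node to the left of the window has its successor
    at or below that end and contributes no increment; in the upper bound the right end is moved out
    instead. *)
Lemma window_sum_ge m c a : mesh m <= 2 * a -> - m.+1%:R <= c - a -> c + a <= m.+1%:R ->
  2 * a - mesh m <= window_sum m c a.
Proof.
move=> ha lo hi; have h_gt0 := mesh_gt0 m.
pose L t := clamp (c - a + mesh m) (c + a) t.
have ab : c - a + mesh m <= c + a by lra.
apply: le_trans (_ : \sum_(i < (half_count m).*2) (L (node m i.+1) - L (node m i)) <= _).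
  rewrite -(big_mkord xpredT (fun i => L (node m i.+1) - L (node m i))).
  rewrite (telescope_sumr (fun i => L (node m i))) // node0 node_last /L.
  have lo' : - m.+1%:R <= c - a + mesh m by lra.
  by rewrite (clamp_low ab lo') (clamp_high ab hi); lra.
apply: ler_sum => i _; rewrite nodeS /L; have [in_|out] := leP `|node m i - c| a.
  by rewrite mulr1; have /andP[] := clamp_step_bounds (c - a + mesh m) (c + a) (node m i) (ltW h_gt0).
rewrite mulr0; move: out; rewrite lter_normr => /orP[out|out].
  by rewrite !(clamp_high ab) ?subrr //; lra.
by rewrite !(clamp_low ab) ?subrr //; lra.
Qed.

(** The norm is the sup norm, so the indicator of a cube is a product over the coordinates and the
    sum factors by distributivity. *)
Lemma lattice_sum_cube m x a : 0 <= a ->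
  lattice_sum m (cube_indicator x a) = \prod_(i < n) window_sum m (x 0 i) a.
Proof.
move=> a_ge0; rewrite /window_sum bigA_distr_bigA /= /lattice_sum mulr_sumr.
apply: eq_bigr => k _; rewrite big_split /= prodr_const card_ord; congr (_ * _).
rewrite /cube_indicator le_rV_norm //; case: forallP => [h|h] /=.
  by rewrite big1 // => i _; have := h i; rewrite !mxE => ->.
have [i ni] : exists i : 'I_n, ~~ (`|node m (k i) - x 0 i| <= a).
  by apply/existsP; rewrite -negb_forall; apply/negP => /forallP h'; apply: h => i; rewrite !mxE.
by rewrite (bigD1 i) //= (negbTE ni) mul0r.
Qed.

Lemma lattice_sum_cube_le m x a : 0 <= a ->
  lattice_sum m (cube_indicator x a) <= (2 * a + mesh m) ^+ n.
Proof.
move=> a_ge0; rewrite lattice_sum_cube //.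
have -> : (2 * a + mesh m) ^+ n = \prod_(i < n) (2 * a + mesh m) by rewrite prodr_const card_ord.
apply: ler_prod => i _; rewrite window_sum_le // andbT; apply: sumr_ge0 => j _.
by rewrite mulr_ge0 // ltW // mesh_gt0.
Qed.

Lemma lattice_sum_cube_ge m x a : mesh m <= 2 * a ->
  `|x| + a <= m.+1%:R -> (2 * a - mesh m) ^+ n <= lattice_sum m (cube_indicator x a).
Proof.
move=> ha xa; have h_gt0 := mesh_gt0 m; rewrite lattice_sum_cube; last by lra.
have -> : (2 * a - mesh m) ^+ n = \prod_(i < n) (2 * a - mesh m) by rewrite prodr_const card_ord.
apply: ler_prod => i _; have := coord_le_rV_norm x i; rewrite ler_norml => /andP[h1 h2].
by rewrite subr_ge0 ha window_sum_ge //; lra.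
Qed.

Lemma lattice_sumD m c G H :
  lattice_sum m (fun z => c * G z + H z) = c * lattice_sum m G + lattice_sum m H.
Proof. by rewrite /lattice_sum big_split -mulr_sumr /=; ring. Qed.

Lemma lattice_sum_le m G H : (forall z, G z <= H z) -> lattice_sum m G <= lattice_sum m H.
Proof.
move=> GH; rewrite ler_wpM2l ?exprn_ge0 ?(ltW (mesh_gt0 m)) //.
by apply: ler_sum => k _.
Qed.

Definition shift_coord m (i : 'I_n) (k : {ffun 'I_n -> 'I_(half_count m).*2}) :
  {ffun 'I_n -> 'I_(half_count m).*2} := [ffun l => if l == i then ordS (k l) else k l].

Lemma shift_coord_bij m i : bijective (@shift_coord m i).
Proof.
exists (fun k : {ffun 'I_n -> 'I_(half_count m).*2} => [ffun l => if l == i then ord_pred (k l) else k l]) => k;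
  apply/ffunP => l; rewrite !ffunE; case: eqP => // _; [exact: ordSK|exact: ord_predK].
Qed.

(** The cyclic shift of one coordinate is a bijection of the lattice. It differs from the
    translation only at the last node, where both points compared lie on faces of the big cube,
    outside the support of [G]. *)
Lemma lattice_sum_difference m i (G : 'rV[R]_n -> R) a : a < m.+1%:R ->
  (forall z, a < `|z| -> G z = 0) ->
  lattice_sum m (fun z => G (z + mesh m *: delta_mx 0 i) - G z) = 0.
Proof.
move=> am G0; rewrite /lattice_sum sumrB; apply/eqP; rewrite mulf_eq0 subr_eq0; apply/orP; right.
rewrite [X in _ == X](reindex (@shift_coord m i)) /=; last exact/onW_bij/shift_coord_bij.
apply/eqP/eq_bigr => k _.
have out z : m.+1%:R <= `|z 0 i| -> G z = 0.
  by move=> mz; apply: G0; apply: lt_le_trans am (le_trans mz (coord_le_rV_norm _ _)).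
have [ki|ki] := ltnP (k i).+1 (half_count m).*2.
  congr G; apply/rowP => l; rewrite !mxE ffunE eqxx /=; case: eqP => [->|_].
    by rewrite mulr1 /= modn_small // nodeS.
  by rewrite mulr0 addr0.
have {}ki : (k i).+1 = (half_count m).*2.
  by apply/eqP; rewrite eqn_leq ki andbT ltn_ord.
rewrite !out // !mxE ?ffunE ?eqxx /=.
  by rewrite ki modnn node0 normrN ger0_norm.
by rewrite mulr1 -nodeS ki node_last ger0_norm.
Qed.

(** The difference quotient of [G] has lattice sum exactly 0 and is uniformly close to [H]. One unit
    of margin around the support absorbs the translation by a mesh. *)
Lemma lattice_sum_derivative_le m i (G H : 'rV[R]_n -> R) a e :
  0 <= a -> a + 1 < m.+1%:R -> 0 <= e ->
  (forall z, is_derive z (delta_mx 0 i) G (H z)) ->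
  (forall z, a < `|z| -> G z = 0) -> (forall z, a < `|z| -> H z = 0) ->
  (forall z y, `|z| <= a + 1 -> `|y| <= mesh m -> `|H (z + y) - H z| <= e) ->
  `|lattice_sum m H| <= e * (2 * (a + 1) + 1) ^+ n.
Proof.
move=> a_ge0 am e_ge0 dG G0 H0 H_close; have h_gt0 := mesh_gt0 m.
have h_le1 : mesh m <= 1 by rewrite invf_le1 ?ltr0n // ler1n.
pose D z := G (z + mesh m *: delta_mx 0 i) - G z.
have D0 : lattice_sum m D = 0 by apply: (@lattice_sum_difference m i G a) => //; lra.
have close z : `|H z - (mesh m)^-1 * D z| <= e * cube_indicator 0 (a + 1) z.
  have [za|za] := leP `|z| (a + 1); rewrite /cube_indicator subr0.
    rewrite za mulr1 -(@ler_pM2l _ (mesh m)) //.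
    rewrite -{1}(gtr0_norm h_gt0) -normrM mulrBr mulVKf ?gt_eqF // distrC.
    apply: derive_along_le => //; first exact: ltW.
    move=> s /andP[s_ge0 sh]; apply: H_close => //.
    rewrite normrZ ger0_norm //; apply: le_trans sh.
    by rewrite ler_piMr // norm_delta_mx_le.
  have z1 : a < `|z| by lra.
  have z2 : a < `|z + mesh m *: delta_mx 0 i|.
    have : `|mesh m *: delta_mx 0 i : 'rV[R]_n| <= 1.
      rewrite normrZ gtr0_norm //; apply: le_trans h_le1.
      by rewrite ler_piMr ?(ltW h_gt0) // norm_delta_mx_le.
    by have := lerB_normD z (mesh m *: delta_mx 0 i); lra.
  by rewrite (lt_geF za) mulr0 /D H0 // !G0 // subr0 mulr0 subr0 normr0.
have -> : lattice_sum m H = lattice_sum m (fun z => H z - (mesh m)^-1 * D z).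
  have -> : (fun z => H z - (mesh m)^-1 * D z) = (fun z => - (mesh m)^-1 * D z + H z).
    by apply/funext => z; ring.
  by rewrite lattice_sumD D0 mulr0 add0r.
have cube_le : lattice_sum m (fun z => e * cube_indicator 0 (a + 1) z + 0) <=
    e * (2 * (a + 1) + 1) ^+ n.
  rewrite lattice_sumD {2}/lattice_sum big1 // mulr0 addr0 ler_wpM2l //.
  apply: le_trans (lattice_sum_cube_le m 0 _) _; first by lra.
  by rewrite lerXn2r ?nnegrE; lra.
rewrite ler_norml; apply/andP; split; last first.
  apply: le_trans cube_le; apply: lattice_sum_le => z; rewrite addr0.
  by apply: le_trans (close z); exact: ler_norm.
rewrite lerNl; apply: le_trans cube_le.
have -> : - lattice_sum m (fun z => H z - (mesh m)^-1 * D z) =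
    lattice_sum m (fun z => - 1 * (H z - (mesh m)^-1 * D z) + 0).
  by rewrite lattice_sumD {3}/lattice_sum big1 // mulr0 addr0 mulN1r.
apply: lattice_sum_le => z; rewrite !addr0 mulN1r.
by apply: le_trans (close z); rewrite -normrN; exact: ler_norm.
Qed.

End LatticeSum.

(** * Existence of the positive functional *)

Section IntegralFunctional.
Variables (R : realType) (n : nat).
Implicit Types (x y z : 'rV[R]_n) (a b c e : R) (m : nat) (G H : 'rV[R]_n -> R).

Definition bounded_support G :=
  exists a, exists B, 0 <= a /\ forall z, `|G z| <= B * cube_indicator 0 a z.

(* The only properties of the integral on R^n that the argument needs; a limit
   of lattice sums along an ultrafilter has them. *)
Record integral_functional (I : ('rV[R]_n -> R) -> R) : Prop := IntegralFunctional {
  integral_linear : forall c G H, bounded_support G -> bounded_support H ->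
    I (fun z => c * G z + H z) = c * I G + I H;
  integral_le : forall G H, bounded_support G -> bounded_support H ->
    (forall z, G z <= H z) -> I G <= I H;
  integral_derivative : forall (i : 'I_n) G H,
    (forall z, is_derive z (delta_mx 0 i) G (H z)) -> continuous H ->
    bounded_support G -> bounded_support H -> I H = 0;
  integral_cube_le : forall x a, 0 < a -> I (cube_indicator x a) <= (3 * a) ^+ n;
  integral_cube_ge : forall x a, 0 < a -> a ^+ n <= I (cube_indicator x a)
}.

Lemma cube_indicator_ge0 x a z : 0 <= cube_indicator x a z.
Proof. by rewrite ler0n. Qed.

Lemma cube_indicator_le a b z : a <= b -> cube_indicator 0 a z <= cube_indicator 0 b z.
Proof.
move=> ab; rewrite ler_nat subr0; have [za|//] := leP `|z| a.
by rewrite (le_trans za).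
Qed.

Lemma bounded_support_cube x a : bounded_support (cube_indicator x a).
Proof.
exists (`|x| + `|a|), 1; split; first exact: addr_ge0.
move=> z; rewrite mul1r ger0_norm ?cube_indicator_ge0 // ler_nat subr0.
have [za|//] := leP `|z - x| a; rewrite (_ : `|z| <= _) //.
have := ler_norm a; have := ler_normD (z - x) x; rewrite subrK; lra.
Qed.

Lemma bounded_support_lin c G H : bounded_support G -> bounded_support H ->
  bounded_support (fun z => c * G z + H z).
Proof.
move=> [a [A [a_ge0 GA]]] [b [B [b_ge0 HB]]].
exists (a + b), (`|c| * `|A| + `|B|); split; first exact: addr_ge0.
move=> z; apply: le_trans (ler_normD _ _) _; rewrite normrM mulrDl.
have h1 : `|G z| <= `|A| * cube_indicator 0 (a + b) z.
  apply: le_trans (GA z) _; apply: le_trans (_ : `|A| * cube_indicator 0 a z <= _).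
    by rewrite ler_wpM2r ?cube_indicator_ge0 ?ler_norm.
  by rewrite ler_wpM2l // cube_indicator_le // lerDl.
have h2 : `|H z| <= `|B| * cube_indicator 0 (a + b) z.
  apply: le_trans (HB z) _; apply: le_trans (_ : `|B| * cube_indicator 0 b z <= _).
    by rewrite ler_wpM2r ?cube_indicator_ge0 ?ler_norm.
  by rewrite ler_wpM2l // cube_indicator_le // lerDr.
by apply: lerD => //; rewrite -mulrA ler_wpM2l.
Qed.

Lemma bounded_support0 G : bounded_support G ->
  exists2 a, 0 <= a & forall z, a < `|z| -> G z = 0.
Proof.
move=> [a [B [a_ge0 GB]]]; exists a => // z az; apply/eqP; rewrite -normr_le0.
by apply: le_trans (GB z) _; rewrite /cube_indicator subr0 (lt_geF az) mulr0.
Qed.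

Lemma lattice_sum_bounded G : bounded_support G ->
  exists C, forall m, `|lattice_sum m G| <= C.
Proof.
move=> [a [B [a_ge0 GB]]]; exists (`|B| * (2 * a + 1) ^+ n) => m.
have h_le1 : mesh R m <= 1 by rewrite invf_le1 ?ltr0n // ler1n.
have GB' z : `|G z| <= `|B| * cube_indicator 0 a z + 0.
  rewrite addr0; apply: le_trans (GB z) _.
  by rewrite ler_wpM2r ?cube_indicator_ge0 // ler_norm.
have zero : lattice_sum m (fun _ : 'rV[R]_n => 0) = 0 by rewrite /lattice_sum big1 ?mulr0.
have le_B : lattice_sum m (fun z => `|B| * cube_indicator 0 a z + 0) <= `|B| * (2 * a + 1) ^+ n.
  rewrite lattice_sumD zero addr0 ler_wpM2l //.
  apply: le_trans (lattice_sum_cube_le m 0 a_ge0) _.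
  by rewrite lerXn2r ?nnegrE; have := mesh_gt0 R m; lra.
rewrite ler_norml; apply/andP; split; last first.
  apply: le_trans le_B; apply: lattice_sum_le => z.
  by apply: le_trans (GB' z); exact: ler_norm.
rewrite lerNl; apply: le_trans le_B.
have -> : - lattice_sum m G = lattice_sum m (fun z => - 1 * G z + 0).
  by rewrite lattice_sumD zero addr0 mulN1r.
apply: lattice_sum_le => z; rewrite addr0 mulN1r.
by apply: le_trans (GB' z); rewrite -normrN; exact: ler_norm.
Qed.

Lemma ultrafilter_bounded_cvg (U : set_system nat) (u : nat -> R) C :
  UltraFilter U -> (forall m, `|u m| <= C) -> exists l : R, u m @[m --> U] --> l.
Proof.
move=> UU uC.
have FU : ProperFilter (u m @[m --> U]) by exact: fmap_proper_filter.
have [|p [_ clp]] := @segment_compact R (- C) C (u m @[m --> U]) FU.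
  by apply: (@filterE _ U) => m /=; rewrite in_itv /= -ler_norml.
exists p => A Ap; rewrite /nbhs /=.
have [//|UnA] := in_ultra_setVsetC (u @^-1` A) UU.
have := clp (~` A) A; rewrite setICl => /(_ UnA Ap) -[? []].
Qed.

(** Along an ultrafilter every bounded sequence converges, so the limit exists for all bounded
    functions of bounded support, integrable or not, and linearity carries no side condition beyond
    these. The ultrafilter refines [\oo], so the mesh may be taken below [a]; this turns
    [2 a + mesh] and [2 a - mesh] into [3 a] and [a]. *)
Lemma integral_functional_exists : exists I, integral_functional I.
Proof.
have [U [UU leU]] := ultraFilterLemma (@eventually_filter).
have PU : ProperFilter U by exact: ultra_proper.
pose I G := lim (lattice_sum m G @[m --> U]).
have cI G : bounded_support G -> lattice_sum m G @[m --> U] --> I G.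
  move=> /lattice_sum_bounded[C GC].
  by have [l lE] := @ultrafilter_bounded_cvg U (fun m => lattice_sum m G) C UU GC; rewrite /I (cvg_lim _ lE).
have large a : \forall m \near U, a < m.+1%:R :> R.
  apply: leU; exists (Num.bound `|a|) => // m /= am.
  apply: lt_le_trans (_ : (Num.bound `|a|)%:R <= _).
    by apply: le_lt_trans (ler_norm _) _; apply: archi_boundP.
  by rewrite ler_nat ltnW.
have small e : 0 < e -> \forall m \near U, mesh R m < e.
  move=> e_gt0; near=> m; rewrite /mesh invf_plt ?posrE ?ltr0n //.
  by near: m; exact: large.
exists I; split.
- move=> c G H bG bH; apply: cvg_lim => //.
  have -> : (fun m => lattice_sum m (fun z => c * G z + H z)) =
      (fun m => c * lattice_sum m G + lattice_sum m H).
    by apply/funext => m; rewrite lattice_sumD.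
  by apply: cvgD; [apply: cvgM; [exact: cvg_cst|exact: cI]|exact: cI].
- move=> G H bG bH GH; apply: ler_cvg_to (cI _ bG) (cI _ bH) _.
  by near=> m; exact: lattice_sum_le.
- move=> i G H dG cH bG bH.
  have [a1 a1_ge0 G0] := bounded_support0 bG; have [a2 a2_ge0 H0] := bounded_support0 bH.
  pose a := a1 + a2.
  have bound e : 0 < e -> `|I H| <= e * (2 * (a + 1) + 1) ^+ n.
    move=> e_gt0.
    have [d d_gt0 Hd] := uniform_continuity_bounded (a + 1) cH e_gt0.
    apply: (ler_cvg_to (cvg_norm (cI _ bH)) (cvg_cst _)).
    near=> m.
    apply: (@lattice_sum_derivative_le _ _ m i G H a e) => //.
    - exact: addr_ge0.
    - by near: m; exact: large.
    - exact: ltW.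
    - by move=> z az; apply: G0; apply: le_lt_trans az; rewrite lerDl.
    - by move=> z az; apply: H0; apply: le_lt_trans az; rewrite lerDr.
    - move=> z y za ym; apply: Hd => //; apply: le_trans ym _; apply: ltW.
      by near: m; exact: small.
  have C_gt0 : 0 < (2 * (a + 1) + 1) ^+ n by rewrite exprn_gt0 // /a; lra.
  apply/eqP; rewrite -normr_le0 leNgt; apply/negP => IH_gt0.
  have := bound (`|I H| / 2 / (2 * (a + 1) + 1) ^+ n).
  rewrite !divr_gt0 // => /(_ isT); rewrite mulfVK ?gt_eqF //.
  by lra.
- move=> x a a_gt0; apply: (ler_cvg_to (cI _ (bounded_support_cube x a)) (cvg_cst _)).
  near=> m; apply: le_trans (lattice_sum_cube_le m x (ltW a_gt0)) _.
  have h : mesh R m < a by near: m; exact: small.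
  have := mesh_gt0 R m; move: (mesh R m) h => h h1 h2.
  by rewrite lerXn2r ?nnegrE //; lra.
- move=> x a a_gt0; apply: (ler_cvg_to (cvg_cst _) (cI _ (bounded_support_cube x a))).
  near=> m.
  have h : mesh R m < a by near: m; exact: small.
  have h' : `|x| + a < m.+1%:R by near: m; exact: large.
  apply: le_trans (lattice_sum_cube_ge _ (ltW h')); last by lra.
  by rewrite lerXn2r ?nnegrE //; lra.
Unshelve. all: by end_near.
Qed.

End IntegralFunctional.

(** * Shell averages *)

Section Profiles.
Variable R : realType.
Implicit Types (s t : R) (g : nat -> R -> R).

(** A quadratic remainder serves where the rules of differentiation do not apply: at the corner of
    the positive part, and under the functional, where it replaces dominated convergence. *)
Lemma is_derive_quadratic (f : R -> R) (x l C r : R) : 0 < r ->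
  (forall h, `|h| < r -> `|f (x + h) - f x - h * l| <= C * h ^+ 2) -> is_derive x 1 f l.
Proof.
move=> r_gt0 f_le.
have C1_gt0 : 0 < `|C| + 1 by rewrite ltr_wpDl.
have lim : h^-1 *: ((f \o shift x) (h *: (1 : R)) - f x) @[h --> 0^'] --> l.
  apply/cvgrPdist_le => e e_gt0; near=> h.
  have h_neq0 : h != 0 by near: h; exact: nbhs_dnbhs_neq.
  have hr : `|h| < r by near: h; apply: dnbhs0_lt.
  have he : `|h| <= e / (`|C| + 1) by near: h; apply: dnbhs0_le; rewrite divr_gt0.
  rewrite /= [h *: 1]mulr1 [h + x]addrC.
  have -> : l - h^-1 *: (f (x + h) - f x) = - (h^-1 * (f (x + h) - f x - h * l)).
    by rewrite -[_ *: _]/(_ * _); field.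
  rewrite normrN normrM normfV ler_pdivrMl ?normr_gt0 //.
  apply: le_trans (f_le h hr) _; rewrite -real_normK ?num_real //.
  apply: le_trans (_ : (`|C| + 1) * `|h| ^+ 2 <= _).
    rewrite ler_wpM2r ?exprn_ge0 //.
    by apply: le_trans (ler_norm _) _; rewrite lerDl.
  by rewrite expr2 mulrCA ler_wpM2l // mulrC -ler_pdivlMr.
split; first by apply/cvg_ex; exists l.
exact: cvg_lim lim.
Unshelve. all: by end_near.
Qed.

Definition pos_part t : R := Num.max 0 t.

Lemma pos_part_ge0 t : 0 <= pos_part t.
Proof. by rewrite le_max lexx. Qed.

Lemma pos_partE t : t * pos_part t = pos_part t ^+ 2.
Proof. by rewrite /pos_part; case: (leP 0 t) => _; rewrite ?mulr0 ?expr2 ?mulr0. Qed.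

Lemma mul_pos_part_expr t m : t * pos_part t ^+ m.+1 = pos_part t ^+ m.+2.
Proof. by rewrite exprS mulrA pos_partE -exprD add2n. Qed.

Lemma is_derive_pos_part t m :
  is_derive t 1 (fun s => pos_part s ^+ m.+2) (m.+2%:R * pos_part t ^+ m.+1).
Proof.
elim: m => [|m IH].
  apply: (@is_derive_quadratic _ _ _ 1 1) => // h _; rewrite expr1 mul1r /pos_part.
  by rewrite ler_norml; case: (leP 0 (t + h)) => h1; case: (leP 0 t) => h2; apply/andP; split; nra.
have -> : (fun s => pos_part s ^+ m.+3) = (fun s => s * pos_part s ^+ m.+2).
  by apply/funext => s; rewrite mul_pos_part_expr.
apply: is_derive_eq (is_derive1M (is_derive1_id t) IH) _.
rewrite mul1r mulrCA mul_pos_part_expr.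
by rewrite -[m.+3%:R]natr1; ring.
Qed.

(* [g i] is the [i]-th derivative of the profile [g 0]. *)
Record profile (N : nat) g : Prop := Profile {
  profile_derive : forall i t, (i < N)%N -> is_derive t 1 (g i) (g i.+1 t);
  profile_low : forall i t, (i <= N)%N -> t <= 1 -> g i t = 0;
  profile_high : forall i t, (i <= N)%N -> 4 <= t -> g i t = 0;
  profile_bounded : exists2 C, 0 <= C & forall i t, (i <= N)%N -> `|g i t| <= C
}.

(* Leibniz's rule for the [i]-th derivative of [t * g 0 t]. *)
Definition mul_id_profile g (i : nat) t : R := t * g i t + i%:R * g i.-1 t.

(* For [i = 0], [s^(a+1)] times the [s]-derivative of [s^-a * g 0 (q / s^2)] at
   [t = q / s^2]. *)
Definition dilation_profile (a : R) g (i : nat) t : R :=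
  - (a + 2 * i%:R) * g i t + (- 2) * (t * g i.+1 t).

Lemma profile_widen N N' g : (N <= N')%N -> profile N' g -> profile N g.
Proof.
move=> NN' [dg lo hi [C C_ge0 bd]]; split.
- by move=> i t iN; apply: dg; exact: leq_trans NN'.
- by move=> i t iN; apply: lo; exact: leq_trans NN'.
- by move=> i t iN; apply: hi; exact: leq_trans NN'.
by exists C => // i t iN; apply: bd; exact: leq_trans NN'.
Qed.

Lemma profile_mul_id N g : profile N g -> profile N (mul_id_profile g).
Proof.
case=> dg lo hi [C C_ge0 bd]; split.
- move=> i t iN; rewrite /mul_id_profile.
  case: i iN => [|i] iN.
    have := is_derive1M (is_derive1_id t) (dg 0%N t iN).
    rewrite (_ : (fun t => t * g 0%N t + 0%:R * g 0.-1 t) = (fun y => y * g 0%N y)).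
      by move=> h; apply: is_derive_eq h _ => /=; ring.
    by apply/funext => s; rewrite mul0r addr0.
  have h := is_derive1D (is_derive1M (is_derive1_id t) (dg i.+1 t iN))
    (is_derive1Z i.+1%:R (dg i t (ltnW iN))).
  by apply: is_derive_eq h _ => /=; rewrite -[i.+2%:R]natr1; ring.
- by move=> i t iN t1; rewrite /mul_id_profile !lo ?mulr0 ?addr0 // (leq_trans (leq_pred _)).
- by move=> i t iN t1; rewrite /mul_id_profile !hi ?mulr0 ?addr0 // (leq_trans (leq_pred _)).
have C'_ge0 : 0 <= 4 * C + N%:R * C by rewrite addr_ge0 ?mulr_ge0.
exists (4 * C + N%:R * C) => // i t iN.
have iN' : (i.-1 <= N)%N by rewrite (leq_trans (leq_pred _)).
have [t1|t1] := leP t 1; first by rewrite /mul_id_profile !lo ?mulr0 ?addr0 ?normr0.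
have [t4|t4] := leP 4 t; first by rewrite /mul_id_profile !hi ?mulr0 ?addr0 ?normr0.
apply: le_trans (ler_normD _ _) _; rewrite !normrM.
have iNR : i%:R <= N%:R :> R by rewrite ler_nat.
by apply: lerD; apply: ler_pM; rewrite ?bd // ger0_norm //; lra.
Qed.

Lemma profile_dilation N a g : profile N.+1 g -> profile N (dilation_profile a g).
Proof.
case=> dg lo hi [C C_ge0 bd]; split.
- move=> i t iN; rewrite /dilation_profile.
  have iN' : (i < N.+1)%N by rewrite ltnW.
  have h := is_derive1D (is_derive1Z (- (a + 2 * i%:R)) (dg i t iN'))
    (is_derive1Z (- 2) (is_derive1M (is_derive1_id t) (dg i.+1 t iN))).
  by apply: is_derive_eq h _ => /=; rewrite -[i.+1%:R]natr1; ring.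
- by move=> i t iN t1; rewrite /dilation_profile !lo ?mulr0 ?addr0 // ltnW.
- by move=> i t iN t1; rewrite /dilation_profile !hi ?mulr0 ?addr0 // ltnW.
have C'_ge0 : 0 <= (`|a| + 2 * N%:R) * C + 2 * (4 * C).
  by rewrite addr_ge0 ?mulr_ge0 ?addr_ge0 ?mulr_ge0.
exists ((`|a| + 2 * N%:R) * C + 2 * (4 * C)) => // i t iN.
have iN' : (i <= N.+1)%N by rewrite ltnW.
have [t1|t1] := leP t 1; first by rewrite /dilation_profile !lo ?mulr0 ?addr0 ?normr0.
have [t4|t4] := leP 4 t; first by rewrite /dilation_profile !hi ?mulr0 ?addr0 ?normr0.
apply: le_trans (ler_normD _ _) _; rewrite !normrM !normrN.
have iNR : i%:R <= N%:R :> R by rewrite ler_nat.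
have h2 : `|2 : R| <= 2 by rewrite ger0_norm.
apply: lerD; apply: ler_pM => //; rewrite ?mulr_ge0 ?bd //.
  apply: le_trans (ler_normD _ _) _; rewrite lerD2l normrM.
  by rewrite [`|i%:R|]ger0_norm //; apply: ler_pM.
by apply: ler_pM; rewrite ?bd // ger0_norm; lra.
Qed.

(** Positive exactly on []1, 4[]: at t = q / s^2 this is the shell between the radii s and 2 s. *)
Definition bump_base t : R := (t - 1) * (4 - t).

(** The fourth power is what makes the profile of class C^3 across the corners of the positive part.
    Three derivatives are consumed later: two by the integration by parts, and a third for the
    continuity of the second and for the quadratic remainder after one differentiation in s. The
    cases 1 to 3 are these derivatives, with [d] the derivative of [bump_base]. *)
Definition bump (i : nat) t : R :=
  let y := pos_part (bump_base t) in let d := 5 - 2 * t in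
  match i with
  | 0 => y ^+ 4
  | 1 => 4 * y ^+ 3 * d
  | 2 => 12 * y ^+ 2 * d ^+ 2 - 8 * y ^+ 3
  | _ => 24 * y * d ^+ 3 - 72 * y ^+ 2 * d
  end.

Lemma bump_base_le t : bump_base t <= 9 / 4.
Proof.
rewrite -subr_ge0 /bump_base; have -> : 9 / 4 - (t - 1) * (4 - t) = (t - 5 / 2) ^+ 2 by field.
exact: sqr_ge0.
Qed.

Lemma profile_bump : profile 3 bump.
Proof.
have dB t : is_derive t 1 bump_base (5 - 2 * t).
  have h1 : is_derive t 1 (fun t => t - 1) 1.
    by apply: is_derive_eq (is_derive1D (is_derive1_id t) (is_derive_cst (- 1 : R) t 1)) _; rewrite addr0.
  have h2 : is_derive t 1 (fun t => 4 - t) (- 1).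
    have := is_derive1D (is_derive_cst (4 : R) t 1) (is_derive1Z (- 1) (is_derive1_id t)).
    rewrite (_ : (fun y => cst 4 y + -1 * y) = (fun t => 4 - t)).
      by move=> h; apply: is_derive_eq h _; ring.
    by apply/funext => y /=; rewrite mulN1r.
  by apply: is_derive_eq (is_derive1M h1 h2) _; ring.
have dd t : is_derive t 1 (fun t => 5 - 2 * t) (- 2).
  have := is_derive1D (is_derive_cst (5 : R) t 1) (is_derive1Z (- 2) (is_derive1_id t)).
  rewrite (_ : (fun y => cst 5 y + -2 * y) = (fun t => 5 - 2 * t)).
    by move=> h; apply: is_derive_eq h _; ring.
  by apply/funext => y /=; rewrite mulNr.
have dP t m : is_derive t 1 (fun t => pos_part (bump_base t) ^+ m.+2)
    (m.+2%:R * pos_part (bump_base t) ^+ m.+1 * (5 - 2 * t)).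
  exact: is_derive1_chain (is_derive_pos_part _ m) (dB t).
have low t : t <= 1 -> pos_part (bump_base t) = 0.
  by move=> t1; apply/max_idPl; rewrite /bump_base; nra.
have high t : 4 <= t -> pos_part (bump_base t) = 0.
  by move=> t1; apply/max_idPl; rewrite /bump_base; nra.
split.
- move=> [|[|[|//]]] t _ /=.
  + exact: dP t 2.
  + apply: is_derive_eq (is_derive1M (is_derive1Z 4 (dP t 1%N)) (dd t)) _ => /=; ring.
  + have d3 : is_derive t 1 (fun t => pos_part (bump_base t) ^+ 2 * (5 - 2 * t) ^+ 2)
      (2%:R * pos_part (bump_base t) ^+ 1 * (5 - 2 * t) * (5 - 2 * t) ^+ 2 +
       pos_part (bump_base t) ^+ 2 * (2%:R * (5 - 2 * t) ^+ 1 * (- 2))).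
      exact: is_derive1M (dP t 0%N) (is_derive1_expr 2 (dd t)).
    have := is_derive1D (is_derive1Z 12 d3) (is_derive1Z (- 8) (dP t 1%N)).
    rewrite (_ : (fun y => 12 * _ + -8 * _) = (fun t => 12 * pos_part (bump_base t) ^+ 2 * (5 - 2 * t) ^+ 2 -
      8 * pos_part (bump_base t) ^+ 3)); last by apply/funext => y; ring.
    by move=> h; apply: is_derive_eq h _; ring.
- by move=> [|[|[|[|//]]]] t _ t1 /=; rewrite low //; ring.
- by move=> [|[|[|[|//]]]] t _ t1 /=; rewrite high //; ring.
(* A crude bound: on [[1, 4]] both [y] and [|d|] are at most 3, and the worst case, i = 3, gives
   3888. *)
exists (3 ^+ 9) => [|i t i3]; first exact: exprn_ge0.
have [t1|t1] := leP t 1.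
  have -> : bump i t = 0 by case: i i3 => [|[|[|[|//]]]] _ /=; rewrite low //; ring.
  by rewrite normr0 exprn_ge0.
have [t4|t4] := leP 4 t.
  have -> : bump i t = 0 by case: i i3 => [|[|[|[|//]]]] _ /=; rewrite high //; ring.
  by rewrite normr0 exprn_ge0.
have y_ge0 := pos_part_ge0 (bump_base t).
have y_le : pos_part (bump_base t) <= 3.
  by rewrite ge_max; have := bump_base_le t; lra.
have d_le : `|5 - 2 * t| <= 3 by rewrite ler_norml; lra.
rewrite /bump; move: (pos_part _) (5 - 2 * t) y_ge0 y_le d_le => y d y_ge0 y_le d_le.
have yn : `|y| <= 3 by rewrite ger0_norm.
have pw m (z : R) : `|z| <= 3 -> `|z ^+ m| <= 3 ^+ m.
  by move=> z3; rewrite normrX lerXn2r ?nnegrE.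
have pr a b (z w : R) : `|z| <= a -> `|w| <= b -> `|z * w| <= a * b.
  by move=> za wb; rewrite normrM ler_pM.
have c4 : `|4 : R| <= 4 by rewrite ger0_norm.
have c8 : `|8 : R| <= 8 by rewrite ger0_norm.
have c12 : `|12 : R| <= 12 by rewrite ger0_norm.
have c24 : `|24 : R| <= 24 by rewrite ger0_norm.
have c72 : `|72 : R| <= 72 by rewrite ger0_norm.
case: i i3 => [|[|[|[|//]]]] _.
- by apply: le_trans (pw 4%N _ yn) _; lra.
- by apply: le_trans (pr _ _ _ _ (pr _ _ _ _ c4 (pw 3%N _ yn)) d_le) _; lra.
- apply: le_trans (ler_normB _ _) _.
  have := pr _ _ _ _ (pr _ _ _ _ c12 (pw 2%N _ yn)) (pw 2%N _ d_le).
  by have := pr _ _ _ _ c8 (pw 3%N _ yn); lra.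
- apply: le_trans (ler_normB _ _) _.
  have := pr _ _ _ _ (pr _ _ _ _ c24 yn) (pw 3%N _ d_le).
  by have := pr _ _ _ _ (pr _ _ _ _ c72 (pw 2%N _ yn)) d_le; lra.
Qed.

Lemma bump_ge0 t : 0 <= bump 0 t.
Proof. by rewrite exprn_ge0 ?pos_part_ge0. Qed.

Lemma bump_le t : bump 0 t <= 3 ^+ 4.
Proof.
rewrite /= lerXn2r ?nnegrE ?pos_part_ge0 // ge_max; have := bump_base_le t; lra.
Qed.

(** The window is chosen wide enough to contain the small cubes and balls on which averages are
    later bounded from below. *)
Lemma bump_ge t : 5 / 4 <= t -> t <= 18 / 5 -> 1 / 16 <= bump 0 t.
Proof.
move=> t1 t2; have h : 1 / 2 <= bump_base t.
  rewrite /bump_base -subr_ge0.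
  have -> : (t - 1) * (4 - t) - 1 / 2 = (t - 5 / 4) * (18 / 5 - t) + (3 / 20 * t) by field.
  by apply: addr_ge0; apply: mulr_ge0; lra.
have -> : 1 / 16 = (1 / 2) ^+ 4 :> R by field.
rewrite /= lerXn2r ?nnegrE ?pos_part_ge0 //.
by rewrite le_max h orbT.
Qed.

End Profiles.

(** * Shell averages as functions of the radius *)

Section Averages.
Variables (R : realType) (n : nat) (I : ('rV[R]_n -> R) -> R).
Hypothesis I_int : integral_functional I.
Implicit Types (x y z : 'rV[R]_n) (s t : R) (u F : 'rV[R]_n -> R) (g : nat -> R -> R).

(** The norm of row vectors is the sup norm; the Euclidean distance enters only through its square,
    a polynomial, which keeps radial weights differentiable at the centre. *)
Definition sqdist x z : R := \sum_(i < n) (z 0 i - x 0 i) ^+ 2.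

Lemma sqdist_ge0 x z : 0 <= sqdist x z.
Proof. by apply: sumr_ge0 => i _; exact: sqr_ge0. Qed.

Lemma coord_sqdist_le x z i : (z 0 i - x 0 i) ^+ 2 <= sqdist x z.
Proof.
rewrite /sqdist (bigD1 i) //= lerDl; apply: sumr_ge0 => l _; exact: sqr_ge0.
Qed.

Lemma norm_le_sqdist x z (r : R) : 0 <= r -> sqdist x z <= r ^+ 2 -> `|z - x| <= r.
Proof.
move=> r_ge0 zr; rewrite le_rV_norm //; apply/forallP => i; rewrite !mxE.
rewrite -(@ler_pXn2r _ 2) ?nnegrE // real_normK ?num_real //.
exact: le_trans (coord_sqdist_le x z i) zr.
Qed.

Lemma cube_indicator_le_origin x (a : R) z : cube_indicator x a z <= cube_indicator 0 (`|x| + `|a|) z.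
Proof.
rewrite ler_nat subr0; have [za|//] := leP `|z - x| a; rewrite (_ : `|z| <= _) //.
have := ler_norm a; have := ler_normD (z - x) x; rewrite subrK; lra.
Qed.

Lemma bounded_support_of_cube F x (a c : R) :
  (forall z, `|F z| <= c * cube_indicator x a z) -> bounded_support F.
Proof.
move=> Fc; exists (`|x| + `|a|), `|c|; split; first exact: addr_ge0.
move=> z; apply: le_trans (Fc z) _; apply: le_trans (_ : `|c| * cube_indicator x a z <= _).
  by rewrite ler_wpM2r ?cube_indicator_ge0 ?ler_norm.
by rewrite ler_wpM2l // cube_indicator_le_origin.
Qed.

Lemma bounded_support_zero : bounded_support (fun _ : 'rV[R]_n => 0).
Proof. by exists 0, 0; split=> // z; rewrite normr0 mul0r. Qed.

Lemma integral0 : I (fun=> 0) = 0.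
Proof.
have := integral_linear I_int 1 bounded_support_zero bounded_support_zero.
rewrite (_ : (fun=> 1 * 0 + 0) = fun=> 0); last by apply/funext => z; rewrite mulr0 addr0.
by rewrite mul1r => /eqP; rewrite -subr_eq0 opprD addNKr oppr_eq0 => /eqP.
Qed.

Lemma integralZ (c : R) F : bounded_support F -> I (fun z => c * F z) = c * I F.
Proof.
move=> bF; have := integral_linear I_int c bF bounded_support_zero.
rewrite integral0 addr0 => <-; congr I; apply/funext => z; by rewrite addr0.
Qed.

Lemma bounded_supportZ (c : R) F : bounded_support F -> bounded_support (fun z => c * F z).
Proof.
move=> bF; have := bounded_support_lin c bF bounded_support_zero.
by rewrite (_ : (fun z => c * F z + 0) = fun z => c * F z) //; apply/funext => z; rewrite addr0.
Qed.

Lemma bounded_supportD F G : bounded_support F -> bounded_support G ->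
  bounded_support (fun z => F z + G z).
Proof.
move=> bF bG; have := bounded_support_lin 1 bF bG.
by rewrite (_ : (fun z => 1 * F z + G z) = fun z => F z + G z) //; apply/funext => z; rewrite mul1r.
Qed.

Lemma integralD F G : bounded_support F -> bounded_support G ->
  I (fun z => F z + G z) = I F + I G.
Proof.
move=> bF bG; have := integral_linear I_int 1 bF bG.
rewrite mul1r => <-; congr I; apply/funext => z; by rewrite mul1r.
Qed.

Lemma bounded_support_sum (J : Type) (r : seq J) (F : J -> 'rV[R]_n -> R) :
  (forall i, bounded_support (F i)) -> bounded_support (fun z => \sum_(i <- r) F i z).
Proof.
move=> bF; elim: r => [|i r IH].
  by rewrite (_ : (fun z => _) = fun=> 0); [exact: bounded_support_zero|apply/funext => z; rewrite big_nil].
rewrite (_ : (fun z => _) = fun z => F i z + \sum_(i <- r) F i z); first exact: bounded_supportD.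
by apply/funext => z; rewrite big_cons.
Qed.

Lemma integral_sum (J : Type) (r : seq J) (F : J -> 'rV[R]_n -> R) :
  (forall i, bounded_support (F i)) ->
  I (fun z => \sum_(i <- r) F i z) = \sum_(i <- r) I (F i).
Proof.
move=> bF; elim: r => [|i r IH].
  rewrite big_nil -[RHS]integral0; congr I; apply/funext => z; by rewrite big_nil.
rewrite big_cons -IH -integralD //; last exact: bounded_support_sum.
by congr I; apply/funext => z; rewrite big_cons.
Qed.

Lemma integral_abs_le F x (a c : R) : 0 <= c -> 0 < a ->
  (forall z, `|F z| <= c * cube_indicator x a z) -> `|I F| <= c * (3 * a) ^+ n.
Proof.
move=> c_ge0 a_gt0 Fc.
have bF := bounded_support_of_cube Fc.
have bC := bounded_support_cube x a.
have IC : I (fun z => c * cube_indicator x a z) <= c * (3 * a) ^+ n.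
  by rewrite integralZ // ler_wpM2l // (integral_cube_le I_int).
rewrite ler_norml; apply/andP; split; last first.
  apply: le_trans IC; apply: (integral_le I_int) => // [|z]; first exact: bounded_supportZ.
  by apply: le_trans (Fc z); exact: ler_norm.
rewrite lerNl; apply: le_trans IC; rewrite -mulN1r -integralZ //.
apply: (integral_le I_int) => [||z]; [exact: bounded_supportZ|exact: bounded_supportZ|].
by rewrite mulN1r; apply: le_trans (Fc z); rewrite -normrN; exact: ler_norm.
Qed.

(** The closed region swept by the supports of the weights when the radius runs over [[s1, s2]].
    With [s1 = 0] it is the ball of radius [2 * s2]. *)
Definition bounded_on_shell u x (s1 s2 B : R) :=
  forall z, s1 ^+ 2 <= sqdist x z -> sqdist x z <= (2 * s2) ^+ 2 -> `|u z| <= B.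

Lemma shell_integrand_le u x s1 s2 B (h : R -> R) C s z : 0 < s1 -> s1 <= s -> s <= s2 ->
  bounded_on_shell u x s1 s2 B -> 0 <= B -> 0 <= C ->
  (forall t, t <= 1 -> h t = 0) -> (forall t, 4 <= t -> h t = 0) ->
  (forall t, `|h t| <= C) ->
  `|u z * h (sqdist x z * s^-1 ^+ 2)| <= (B * C) * cube_indicator x (2 * s2) z.
Proof.
move=> s1_gt0 s1s ss2 uB B_ge0 C_ge0 lo hi hC.
have s_gt0 : 0 < s by lra.
have s2_gt0 : 0 < s ^+ 2 by rewrite exprn_gt0.
have rhs_ge0 : 0 <= (B * C) * cube_indicator x (2 * s2) z.
  by rewrite !mulr_ge0 ?cube_indicator_ge0.
have [t1|t1] := leP (sqdist x z * s^-1 ^+ 2) 1; first by rewrite lo // mulr0 normr0.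
have [t4|t4] := leP 4 (sqdist x z * s^-1 ^+ 2); first by rewrite hi // mulr0 normr0.
move: t1 t4; rewrite exprVn ltr_pdivlMr // ltr_pdivrMr // mul1r => t1 t4.
have q1 : s1 ^+ 2 <= sqdist x z.
  by apply: le_trans (ltW t1); rewrite lerXn2r ?nnegrE //; lra.
have q2 : sqdist x z <= (2 * s2) ^+ 2.
  apply: le_trans (ltW t4) _; rewrite exprMn (_ : 2 ^+ 2 = 4); last by ring.
  by rewrite ler_wpM2l // lerXn2r ?nnegrE //; lra.
have -> : cube_indicator x (2 * s2) z = 1.
  by rewrite /cube_indicator norm_le_sqdist //; lra.
by rewrite mulr1 normrM; apply: ler_pM => //; exact: uB.
Qed.

Lemma taylor2 (f f1 f2 : R -> R) (a b C x y : R) :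
  (forall t, a <= t <= b -> is_derive t 1 f (f1 t)) ->
  (forall t, a <= t <= b -> is_derive t 1 f1 (f2 t)) ->
  (forall t, a <= t <= b -> `|f2 t| <= C) ->
  a <= x <= b -> a <= y <= b -> `|f y - f x - (y - x) * f1 x| <= C * (y - x) ^+ 2.
Proof.
move=> df df1 f2C /andP[ax xb] /andP[ay yb].
have [xy|yx] := leP x y.
  have sub t : x <= t <= y -> a <= t <= b.
    by move=> /andP[xt ty]; rewrite (le_trans ax xt) (le_trans ty yb).
  have [c /andP[xc cy] cE] := mvt_is_derive xy (fun t tin => df t (sub t tin)).
  have sub' t : x <= t <= c -> a <= t <= b.
    by move=> /andP[xt tc]; apply: sub; rewrite xt (le_trans tc cy).
  have [d /andP[xd dc] dE] := mvt_is_derive xc (fun t tin => df1 t (sub' t tin)).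
  have -> : f y - f x - (y - x) * f1 x = f2 d * ((c - x) * (y - x)).
    by rewrite cE mulrA -dE; ring.
  rewrite normrM; apply: ler_pM => //; first by apply: f2C; apply: sub'; rewrite xd.
  rewrite ger0_norm ?mulr_ge0 ?subr_ge0 // expr2 ler_wpM2r ?subr_ge0 //.
  by rewrite lerB.
have {}yx := ltW yx.
have sub t : y <= t <= x -> a <= t <= b.
  by move=> /andP[xt ty]; rewrite (le_trans ay xt) (le_trans ty xb).
have [c /andP[yc cx] cE] := mvt_is_derive yx (fun t tin => df t (sub t tin)).
have sub' t : c <= t <= x -> a <= t <= b.
  by move=> /andP[ct tx]; apply: sub; rewrite tx (le_trans yc ct).
have [d /andP[cd dx] dE] := mvt_is_derive cx (fun t tin => df1 t (sub' t tin)).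
have -> : f y - f x - (y - x) * f1 x = f2 d * ((x - c) * (x - y)).
  rewrite mulrA -dE (_ : f y - f x = - (f x - f y)); last by ring.
  by rewrite cE; ring.
rewrite normrM; apply: ler_pM => //; first by apply: f2C; apply: sub'; rewrite cd.
rewrite ger0_norm ?mulr_ge0 ?subr_ge0 // -sqrrN opprB expr2 ler_wpM2r ?subr_ge0 //.
by rewrite lerB.
Qed.

(** With t = q / s^2, the second derivative in s of [g 0 t] is (4 t^2 g''(t) + 6 t g'(t)) / s^2. The
    profile lives in t <= 4, which bounds the bracket by (4 * 16 + 6 * 4) C = 88 C, uniformly in
    q. *)
Lemma scaled_profile_taylor g (C q s1 s2 s s' : R) : profile 2 g -> 0 <= C ->
  (forall i t, (i <= 2)%N -> `|g i t| <= C) -> 0 <= q ->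
  0 < s1 -> s1 <= s <= s2 -> s1 <= s' <= s2 ->
  `|g 0%N (q * s'^-1 ^+ 2) - g 0%N (q * s^-1 ^+ 2) -
     (s' - s) * (- 2 * s^-1 * (q * s^-1 ^+ 2 * g 1%N (q * s^-1 ^+ 2)))|
    <= (88 * C * s1^-1 ^+ 2) * (s' - s) ^+ 2.
Proof.
move=> pg C_ge0 gC q_ge0 s1_gt0 s_in s'_in.
have [dg lo hi _] := pg.
have dt s0 : 0 < s0 -> is_derive s0 1 (fun s => q * s^-1 ^+ 2) (- 2 * q * s0^-1 ^+ 3).
  move=> s0_gt0; apply: is_derive_eq (is_derive1Z q (is_derive1_exprVn 2 s0_gt0)) _.
  by rewrite /=; ring.
pose f1 s := g 1%N (q * s^-1 ^+ 2) * (- 2 * q * s^-1 ^+ 3).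
pose f2 s := g 2%N (q * s^-1 ^+ 2) * (- 2 * q * s^-1 ^+ 3) * (- 2 * q * s^-1 ^+ 3) +
   g 1%N (q * s^-1 ^+ 2) * (- 2 * q * (- 3 * s^-1 ^+ 4)).
have -> : - 2 * s^-1 * (q * s^-1 ^+ 2 * g 1%N (q * s^-1 ^+ 2)) = f1 s.
  by rewrite /f1; ring.
apply: (@taylor2 (fun s => g 0%N (q * s^-1 ^+ 2)) f1 f2 s1 s2) => // s0 /andP[s10 s02].
- have s0_gt0 : 0 < s0 by lra.
  by apply: (is_derive1_chain (f := g 0%N)); [exact: dg|exact: dt].
- have s0_gt0 : 0 < s0 by lra.
  apply: is_derive1M; first by apply: (is_derive1_chain (f := g 1%N)); [exact: dg|exact: dt].
  by apply: is_derive1Z; exact: is_derive1_exprVn.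
have s0_gt0 : 0 < s0 by lra.
rewrite /f2; set t := q * s0^-1 ^+ 2.
have -> : g 2%N t * (-2 * q * s0^-1 ^+ 3) * (-2 * q * s0^-1 ^+ 3) +
  g 1%N t * (-2 * q * (-3 * s0^-1 ^+ 4)) =
  (4 * t ^+ 2 * g 2%N t + 6 * t * g 1%N t) * s0^-1 ^+ 2 by rewrite /t; ring.
have i_ge0 : 0 <= s0^-1 by rewrite invr_ge0 ltW.
have i_le : s0^-1 <= s1^-1 by rewrite lef_pV2 ?posrE.
rewrite normrM [`|s0^-1 ^+ 2|]ger0_norm ?exprn_ge0 //.
apply: ler_pM => //; first exact: exprn_ge0.
  have [t1|t1] := leP t 1; first by rewrite !lo // !mulr0 addr0 normr0 mulr_ge0.
  have [t4|t4] := leP 4 t; first by rewrite !hi // !mulr0 addr0 normr0 mulr_ge0.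
  apply: le_trans (ler_normD _ _) _; rewrite (_ : 88 * C = 64 * C + 24 * C); last by ring.
  have t_ge0 : 0 <= t by lra.
  have t2 : t ^+ 2 <= 4 ^+ 2 by rewrite lerXn2r ?nnegrE // ltW.
  have t2_ge0 : 0 <= t ^+ 2 by exact: exprn_ge0.
  have w1 : `|4 * t ^+ 2| <= 64.
    by rewrite ger0_norm ?mulr_ge0 //; move: (t ^+ 2) t2 => w; lra.
  have w2 : `|6 * t| <= 24 by rewrite ger0_norm ?mulr_ge0 //; lra.
  rewrite normrM [`|6 * t * _|]normrM.
  by apply: lerD; apply: ler_pM; rewrite ?gC ?normr_ge0.
by rewrite lerXn2r ?nnegrE //; lra.
Qed.

(** The power [a] is free because each derivative in s raises it by one: n gives the averages, n + 1
    their first derivatives. The mass of the weight is not normalised to 1. *)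
Definition shell_average (a : nat) g u x s : R :=
  s^-1 ^+ a * I (fun z => u z * g 0%N (sqdist x z * s^-1 ^+ 2)).

Lemma shell_integrand_bounded_support u x s1 s2 B (h : R -> R) C s : 0 < s1 -> s1 <= s -> s <= s2 ->
  bounded_on_shell u x s1 s2 B -> 0 <= B -> 0 <= C ->
  (forall t, t <= 1 -> h t = 0) -> (forall t, 4 <= t -> h t = 0) ->
  (forall t, `|h t| <= C) -> bounded_support (fun z => u z * h (sqdist x z * s^-1 ^+ 2)).
Proof.
move=> s1_gt0 s1s ss2 uB B_ge0 C_ge0 lo hi hC.
apply: (@bounded_support_of_cube _ x (2 * s2) (B * C)) => z.
exact: (shell_integrand_le (s1 := s1)).
Qed.

(** The Taylor remainder of the weight is bounded uniformly in z by a multiple of h^2 on a fixed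
    cube, so it remains quadratic after applying [I]. Outside the swept shell all the terms vanish,
    whatever the values of [u] there. *)
Lemma shell_average_derive a g u x s1 s2 B s : profile 2 g -> 0 < s1 -> s1 < s -> s < s2 ->
  bounded_on_shell u x s1 s2 B -> 0 <= B ->
  is_derive s 1 (shell_average a g u x)
    (shell_average a.+1 (dilation_profile a%:R g) u x s).
Proof.
move=> pg s1_gt0 s1s ss2 uB B_ge0.
have s_gt0 : 0 < s by lra.
have [dg lo hi [C C_ge0 gC]] := pg.
pose J s := I (fun z => u z * g 0%N (sqdist x z * s^-1 ^+ 2)).
pose J1 := I (fun z => u z * ((fun t => t * g 1%N t) (sqdist x z * s^-1 ^+ 2))).
have g1C t : `|t * g 1%N t| <= 4 * C.
  have [t1|t1] := leP t 1; first by rewrite lo // mulr0 normr0 mulr_ge0.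
  have [t4|t4] := leP 4 t; first by rewrite hi // mulr0 normr0 mulr_ge0.
  by rewrite normrM; apply: ler_pM; rewrite ?gC // ger0_norm; lra.
have bs0 s0 : s1 <= s0 -> s0 <= s2 -> bounded_support (fun z => u z * g 0%N (sqdist x z * s0^-1 ^+ 2)).
  move=> h1 h2; apply: (@shell_integrand_bounded_support u x s1 s2 B (g 0%N) C s0) => // t.
  - by move=> t1; exact: lo.
  - by move=> t1; exact: hi.
  - exact: gC.
have bs1 : bounded_support (fun z => u z * ((fun t => t * g 1%N t) (sqdist x z * s^-1 ^+ 2))).
  apply: (@shell_integrand_bounded_support u x s1 s2 B (fun t => t * g 1%N t) (4 * C) s) => //.
  - exact: ltW.
  - exact: ltW.
  - by rewrite mulr_ge0.
  - by move=> t t1; rewrite lo // mulr0.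
  - by move=> t t1; rewrite hi // mulr0.
have dJ : is_derive s 1 J (- 2 * s^-1 * J1).
  pose r := Num.min (s - s1) (s2 - s).
  have r_gt0 : 0 < r by rewrite lt_min !subr_gt0 s1s.
  apply: (@is_derive_quadratic _ _ _ _ (B * (88 * C * s1^-1 ^+ 2) * (3 * (2 * s2)) ^+ n) r) => // h hr.
  have s'_in : s1 <= s + h <= s2.
    move: hr; rewrite /r lt_min !ltr_norml => /andP[/andP[h1 h2] /andP[h3 h4]]; lra.
  have /andP[s'1 s'2] := s'_in.
  have s_in : s1 <= s <= s2 by rewrite !ltW.
  have -> : J (s + h) - J s - h * (- 2 * s^-1 * J1) =
     I (fun z => (- (h * (- 2 * s^-1))) * (u z * ((fun t => t * g 1%N t) (sqdist x z * s^-1 ^+ 2))) +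
        (- 1 * (u z * g 0%N (sqdist x z * s^-1 ^+ 2)) + u z * g 0%N (sqdist x z * (s + h)^-1 ^+ 2))).
    have b_s := bs0 s (ltW s1s) (ltW ss2); have b_sh := bs0 (s + h) s'1 s'2.
    rewrite (integral_linear I_int _ bs1 (bounded_support_lin (-1) b_s b_sh)).
    rewrite (integral_linear I_int _ b_s b_sh).
    by rewrite /J /J1 /=; ring.
  have -> : B * (88 * C * s1^-1 ^+ 2) * (3 * (2 * s2)) ^+ n * h ^+ 2 =
     (B * (88 * C * s1^-1 ^+ 2) * h ^+ 2) * (3 * (2 * s2)) ^+ n by ring.
  have c_ge0 : 0 <= 88 * C * s1^-1 ^+ 2.
    by apply: mulr_ge0; [exact: mulr_ge0|rewrite exprn_ge0 // invr_ge0 ltW].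
  apply: (@integral_abs_le _ x) => [||z].
    by apply: mulr_ge0; [exact: mulr_ge0|exact: sqr_ge0].
    by lra.
  rewrite /=; set q := sqdist x z.
  have -> : - (h * (-2 / s)) * (u z * (q * s^-1 ^+ 2 * g 1%N (q * s^-1 ^+ 2))) +
     (-1 * (u z * g 0%N (q * s^-1 ^+ 2)) + u z * g 0%N (q * (s + h)^-1 ^+ 2)) =
     u z * (g 0%N (q * (s + h)^-1 ^+ 2) - g 0%N (q * s^-1 ^+ 2) -
     (s + h - s) * (- 2 * s^-1 * (q * s^-1 ^+ 2 * g 1%N (q * s^-1 ^+ 2)))) by ring.
  have rhs_ge0 : 0 <= B * (88 * C * s1^-1 ^+ 2) * h ^+ 2 * cube_indicator x (2 * s2) z.
    apply: mulr_ge0; last exact: cube_indicator_ge0.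
    by apply: mulr_ge0; [exact: mulr_ge0|exact: sqr_ge0].
  have ratio s0 : s1 <= s0 -> s0 <= s2 ->
     (q < s1 ^+ 2 -> q * s0^-1 ^+ 2 <= 1) /\ ((2 * s2) ^+ 2 < q -> 4 <= q * s0^-1 ^+ 2).
    move=> h1 h2; have s0_gt0 : 0 < s0 ^+ 2 by rewrite exprn_gt0; lra.
    rewrite exprVn ler_pdivrMr // ler_pdivlMr // mul1r; split => [q1|q2].
      by apply: le_trans (ltW q1) _; rewrite lerXn2r ?nnegrE; lra.
    apply: le_trans (ltW q2); rewrite exprMn (_ : 2 ^+ 2 = 4); last by ring.
    by rewrite ler_wpM2l // lerXn2r ?nnegrE //; lra.
  have [r1 r1'] := ratio s (ltW s1s) (ltW ss2).
  have [r2 r2'] := ratio (s + h) s'1 s'2.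
  have [q1|q1] := ltP q (s1 ^+ 2).
    by rewrite !lo ?r1 ?r2 // !mulr0 !subr0 mulr0 normr0.
  have [q2|q2] := ltP ((2 * s2) ^+ 2) q.
    by rewrite !hi ?r1' ?r2' // !mulr0 !subr0 mulr0 normr0.
  have -> : cube_indicator x (2 * s2) z = 1.
    by rewrite /cube_indicator norm_le_sqdist //; lra.
  have T := scaled_profile_taylor pg C_ge0 gC (sqdist_ge0 x z) s1_gt0 s_in s'_in.
  have hE : s + h - s = h by ring.
  rewrite mulr1 normrM -[leRHS]mulrA; move: T; rewrite -/q hE => T.
  by apply: ler_pM => //; exact: uB.
apply: is_derive_eq (is_derive1M (is_derive1_exprVn a s_gt0) dJ) _.
rewrite /shell_average.
have -> : (fun z => u z * dilation_profile a%:R g 0%N (sqdist x z * s^-1 ^+ 2)) =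
  (fun z => (- 2) * (u z * ((fun t => t * g 1%N t) (sqdist x z * s^-1 ^+ 2))) +
     (- a%:R) * (u z * g 0%N (sqdist x z * s^-1 ^+ 2))).
  by apply/funext => z; rewrite /dilation_profile mulr0 addr0 /=; ring.
have b_s := bs0 s (ltW s1s) (ltW ss2).
rewrite (integral_linear I_int _ bs1 (bounded_supportZ (- a%:R) b_s)) integralZ //.
by rewrite -/(J s) -/J1 [s^-1 ^+ a.+1]exprS; ring.
Qed.

End Averages.

(** * The radial system *)

Section RadialOperator.
Variables (R : realType) (j : nat).
Local Notation k := (j.+1).
Implicit Types (u V W F : R -> R) (a b c s t : R).

(* [L = u'' + (n - 1) / s * u'] in dimension [n = k + 2]. *)
Definition radial_laplacian_at (u u1 L : R -> R) s :=
  is_derive s 1 u (u1 s) /\ is_derive s 1 u1 (L s - k.+1%:R * s^-1 * u1 s).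

(** The divergence form of the operator, with k + 1 = n - 1: a sign of L becomes monotonicity of the
    flux. *)
Lemma radial_flux u u1 L s : 0 < s -> radial_laplacian_at u u1 L s ->
  is_derive s 1 (fun t => t ^+ k.+1 * u1 t) (s ^+ k.+1 * L s).
Proof.
move=> s_gt0 [_ du1]; have s_neq0 : s != 0 by rewrite gt_eqF.
apply: is_derive_eq (is_derive1M (is_derive1_exprn s k.+1) du1) _.
by rewrite /= [s ^+ j.+2]exprS; field.
Qed.

(** Integrates [u1 <= c / s^(k+1)]. Since k = n - 2 is positive, the primitive stays bounded at
    infinity. *)
Lemma flux_increment_le u u1 a b c : 0 < a -> a <= b ->
  (forall s, a <= s <= b -> is_derive s 1 u (u1 s)) ->
  (forall s, a <= s <= b -> s ^+ k.+1 * u1 s <= c) ->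
  u b - u a <= c / k%:R * (a^-1 ^+ k - b^-1 ^+ k).
Proof.
move=> a_gt0 le_ab du flux_le.
have -> : c / k%:R * (a^-1 ^+ k - b^-1 ^+ k) =
    - (c / k%:R) * b^-1 ^+ k - - (c / k%:R) * a^-1 ^+ k by ring.
have s_gt0 s : a <= s <= b -> 0 < s by case/andP=> [/(lt_le_trans a_gt0)].
apply: (@derive_le_increment _ u u1 (fun s => - (c / k%:R) * s^-1 ^+ k)
   (fun s => - (c / k%:R) * (- k%:R * s^-1 ^+ k.+1)) a b le_ab).
  by move=> s s_in; apply: is_derive1Z; apply: is_derive1_exprVn; exact: s_gt0 s_in.
move=> s s_in.
have -> : - (c / k%:R) * (- k%:R * s^-1 ^+ k.+1) = c * s^-1 ^+ k.+1.
  by field; rewrite nat1r pnatr_eq0.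
by rewrite exprVn ler_pdivlMr ?exprn_gt0 ?(s_gt0 s) // mulrC flux_le.
Qed.

Lemma negative_slope u u1 a c : 0 < c ->
  (forall s, a <= s -> is_derive s 1 u (u1 s)) ->
  (forall s, a <= s -> u1 s <= - c) -> exists2 s, a <= s & u s < 0.
Proof.
move=> c_gt0 du u1_le; pose s := a + (`|u a| + 1) / c.
have le_as : a <= s by rewrite lerDl divr_ge0 ?addr_ge0 // ltW.
exists s => //.
have := @increment_le _ u u1 (- c) a s le_as.
move=> /(_ (fun x x_in => du x (proj1 (andP x_in)))).
move=> /(_ (fun x x_in => u1_le x (proj1 (andP x_in)))).
have -> : - c * (s - a) = - (`|u a| + 1) by rewrite /s; field; rewrite gt_eqF.
by have := ler_norm (u a); lra.
Qed.

Lemma ln_unbounded a c M : 0 < a -> 0 < c ->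
  (forall s, a <= s -> c * (ln s - ln a) <= M) -> False.
Proof.
move=> a_gt0 c_gt0 ln_le; pose N := (`|M| + 1) / c.
have N_ge0 : 0 <= N by rewrite divr_ge0 ?addr_ge0 // ltW.
have expN : 1 <= expR N by apply: le_trans (expR_ge1Dx N); rewrite lerDl.
have := ln_le (a * expR N); rewrite ler_peMr ?(ltW a_gt0) // => /(_ isT).
rewrite lnM ?posrE ?expR_gt0 // expRK addrC addKr.
have -> : c * N = `|M| + 1 by rewrite /N; field; rewrite gt_eqF.
by have := ler_norm M; lra.
Qed.

(** The flux of V falls below a negative multiple of s^(k+2), hence eventually below -s^(k+1); then
    the slope of V is at most -1 and V cannot stay positive. *)
Lemma radial_laplacian_not_negative V V1 W a c : 1 <= a -> 0 < c ->
  (forall s, a <= s -> radial_laplacian_at V V1 W s) ->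
  (forall s, a <= s -> 0 < V s) ->
  ~ (forall s, a <= s -> W s <= - c).
Proof.
move=> a_ge1 c_gt0 dV V_gt0 W_le.
pose Y s := s ^+ k.+1 * V1 s; pose C := `|Y a| + c / k.+2%:R * a ^+ k.+2.
(* For s >= b one has [c / (k + 2) * s >= C + 1], so the flux is at most C - (C + 1) s^(k+1), which
   is at most -s^(k+1). *)
pose b := a + (C + 1) * k.+2%:R / c.
have ltk : 0 < k.+2%:R :> R by rewrite ltr0n.
have a_gt0 : 0 < a by lra.
have C_ge0 : 0 <= C.
  by rewrite addr_ge0 // mulr_ge0 ?exprn_ge0 ?divr_ge0 // ltW.
have le_ab : a <= b.
  by rewrite lerDl; apply: divr_ge0; [apply: mulr_ge0; [lra|exact: ltW]|exact: ltW].
have [s|s|s le_bs Vs_lt0] := @negative_slope V V1 b 1 ltr01.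
- by move=> le_bs; have [] := dV s (le_trans le_ab le_bs).
- move=> le_bs; have le_as := le_trans le_ab le_bs.
  have s_gt0 : 0 < s by lra.
  have : Y s - Y a <= - (c / k.+2%:R) * s ^+ k.+2 - - (c / k.+2%:R) * a ^+ k.+2.
    apply: (@derive_le_increment _ Y (fun t => t ^+ k.+1 * W t)
     (fun t => - (c / k.+2%:R) * t ^+ k.+2)
     (fun t => - (c / k.+2%:R) * (k.+2%:R * t ^+ k.+1)) a s le_as) => t /andP[ta _].
    - by apply: radial_flux; [lra|exact: dV].
    - by apply: is_derive1Z; exact: is_derive1_exprn.
    have -> : - (c / k.+2%:R) * (k.+2%:R * t ^+ k.+1) = t ^+ k.+1 * (- c).
      by field; rewrite gt_eqF.
    by rewrite ler_pM2l ?W_le // exprn_gt0 //; lra.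
  have Ya := ler_norm (Y a).
  move=> Ys_le; have {Ys_le Ya} Ys_le : Y s <= C - c / k.+2%:R * s ^+ k.+2.
    by rewrite /C; move: (c / _) (Y s) (Y a) (s ^+ _) (a ^+ _) Ys_le Ya => d ys ya ? ?; lra.
  have sk_ge1 : 1 <= s ^+ k.+1 by rewrite exprn_ege1 //; lra.
  have hb : C + 1 <= c / k.+2%:R * s.
    have {1}-> : C + 1 = c / k.+2%:R * ((C + 1) * k.+2%:R / c).
      by field; rewrite !gt_eqF.
    by rewrite ler_pM2l ?divr_gt0 //; apply: le_trans le_bs; rewrite lerDr ltW.
  have : (C + 1) * s ^+ k.+1 <= c / k.+2%:R * s ^+ k.+2.
    by rewrite [s ^+ k.+2]exprS mulrA ler_pM2r // (lt_le_trans _ sk_ge1).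
  have : C <= C * s ^+ k.+1 by rewrite ler_peMr.
  move=> C_le C1_le; have : Y s <= s ^+ k.+1 * (- 1).
    by move: (c / _ * _) (s ^+ k.+1) Ys_le C_le C1_le => ? ?; lra.
  by rewrite /Y ler_pM2l // (lt_le_trans _ sk_ge1).
by have := V_gt0 s (le_trans le_ab le_bs); lra.
Qed.

End RadialOperator.

(** * The radial system with [W] positive *)

Section SubharmonicCase.
Variables (R : realType) (j : nat).
Local Notation k := (j.+1).
Implicit Types (u V W F : R -> R) (a b c s t : R).

(** The window [[s / 2, 2 s]] appears because v at a point z of the shell is bounded by the average
    at radius 2 |z| / 3, which lies between 2 s / 3 and 4 s / 3. The level [m] is left free: it will
    be a constant in one case and a multiple of [V s] in the other. *)
Definition source_lower_bound V F a c (p : R) :=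
  forall s m, a <= s -> 1 <= m ->
    (forall t, s / 2 <= t -> t <= 2 * s -> V t <= m) ->
    c * (V s `^ p * m `^ (- 1 - p)) <= F s.

Lemma radial_flux_increment_ge u u1 L c a b m : 0 < a -> a <= b ->
  (forall s, a <= s <= b -> radial_laplacian_at j u u1 L s) ->
  (forall s, a <= s <= b -> c * s ^+ m <= s ^+ k.+1 * L s) ->
  c / m.+1%:R * (b ^+ m.+1 - a ^+ m.+1) <= b ^+ k.+1 * u1 b - a ^+ k.+1 * u1 a.
Proof.
move=> a_gt0 le_ab du L_ge; rewrite mulrBr.
apply: (@derive_le_increment _ (fun t => c / m.+1%:R * t ^+ m.+1)
  (fun t => c / m.+1%:R * (m.+1%:R * t ^+ m))
  (fun t => t ^+ k.+1 * u1 t) (fun t => t ^+ k.+1 * L t) a b le_ab) => s s_in.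
- by apply: is_derive1Z; exact: is_derive1_exprn.
- apply: radial_flux; last exact: du.
  by case/andP: s_in => /(lt_le_trans a_gt0).
- apply: le_trans (L_ge _ s_in); by rewrite mulrA mulfVK // pnatr_eq0.
Qed.

Lemma radial_flux_increment_le u u1 L c a b m : 0 < a -> a <= b ->
  (forall s, a <= s <= b -> radial_laplacian_at j u u1 L s) ->
  (forall s, a <= s <= b -> s ^+ k.+1 * L s <= c * s ^+ m) ->
  b ^+ k.+1 * u1 b - a ^+ k.+1 * u1 a <= c / m.+1%:R * (b ^+ m.+1 - a ^+ m.+1).
Proof.
move=> a_gt0 le_ab du L_ge; rewrite mulrBr.
apply: (@derive_le_increment _ 
  (fun t => t ^+ k.+1 * u1 t) (fun t => t ^+ k.+1 * L t) (fun t => c / m.+1%:R * t ^+ m.+1)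
  (fun t => c / m.+1%:R * (m.+1%:R * t ^+ m)) a b le_ab) => s s_in.
- apply: radial_flux; last exact: du.
  by case/andP: s_in => /(lt_le_trans a_gt0).
- by apply: is_derive1Z; exact: is_derive1_exprn.
- apply: le_trans (L_ge _ s_in) _; by rewrite mulrA mulfVK // pnatr_eq0.
Qed.

(** Doubling is inherited upwards from W to the flux of V, then to V', then to V: in the
    integrations [K Y(t) - Y(2 t)] has nonnegative derivative and a nonnegative value at b. *)
Lemma subharmonic_doubling V V1 W b C : 0 < b -> 0 < C ->
  (forall s, b <= s -> radial_laplacian_at j V V1 W s) ->
  (forall s, b <= s -> 0 < V s) -> (forall s, b <= s -> 0 < W s) ->
  (forall s, b <= s -> W (2 * s) <= C * W s) ->
  (forall s, b <= s -> 1 <= s ^+ k.+1 * V1 s) ->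
  exists2 K, 0 < K & forall s, b <= s -> V (2 * s) <= K * V s.
Proof.
move=> b_gt0 C_gt0 dV V_gt0 W_gt0 W_dbl.
pose Y s := s ^+ k.+1 * V1 s.
move=> Y_ge1; have {}Y_ge1 : forall s, b <= s -> 1 <= Y s by [].
have dY s : b <= s -> is_derive s 1 Y (s ^+ k.+1 * W s).
  by move=> le_bs; apply: radial_flux; [lra|exact: dV].
have dV' s : b <= s -> is_derive s 1 V (V1 s) by move=> le_bs; have [] := dV s le_bs.
have V1_gt0 s : b <= s -> 0 < V1 s.
  move=> le_bs; have s_gt0 : 0 < s by lra.
  have := lt_le_trans ltr01 (Y_ge1 s le_bs).
  by rewrite /Y pmulr_rgt0 // exprn_gt0.
(* The first term makes the derivative nonnegative, 2^(k+2) coming from the weight t^(k+1) and the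
   chain rule; the second handles the value at [b], since [Y b >= 1]. *)
pose K := 2 ^+ k.+2 * C + Y (2 * b).
have Y2b : 1 <= Y (2 * b) by apply: Y_ge1; lra.
have K_gt0 : 0 < K by apply: addr_gt0; [rewrite mulr_gt0 ?exprn_gt0|exact: lt_le_trans ltr01 Y2b].
have d2 (f f' : R -> R) s : is_derive (2 * s) 1 f (f' (2 * s)) ->
    is_derive s 1 (fun t => f (2 * t)) (f' (2 * s) * (2 * 1)).
  by move=> df; apply: is_derive1_chain df _; apply: is_derive1Z; exact: is_derive1_id.
have flux2 s : b <= s -> Y (2 * s) <= K * Y s.
  move=> le_bs; have : K * Y b - Y (2 * b) <= K * Y s - Y (2 * s).
    have := @derive_ge0_le _ (fun t => K * Y t + (- 1) * Y (2 * t))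
      (fun t => K * (t ^+ k.+1 * W t) +
         (- 1) * ((2 * t) ^+ k.+1 * W (2 * t) * (2 * 1))) b s le_bs.
    rewrite !mulN1r; apply.
      move=> t /andP[le_bt _]; apply: is_derive1D; first exact/is_derive1Z/dY.
      apply: is_derive1Z; apply: (d2 Y (fun x => x ^+ k.+1 * W x)); apply: dY; lra.
    move=> t /andP[le_bt _];     have t_gt0 : 0 < t by lra.
    have Wt_gt0 := W_gt0 t le_bt.
    have -> : K * (t ^+ k.+1 * W t) + -1 * ((2 * t) ^+ k.+1 * W (2 * t) * (2 * 1)) =
       t ^+ k.+1 * (Y (2 * b) * W t + 2 ^+ k.+2 * (C * W t - W (2 * t))).
      by rewrite /K exprMn [2 ^+ k.+2]exprS; ring.
    apply: mulr_ge0; first by rewrite exprn_ge0 // ltW.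
    apply: addr_ge0; first by apply: mulr_ge0; lra.
    by rewrite mulr_ge0 ?exprn_ge0 // subr_ge0 W_dbl.
  have Yb := Y_ge1 b (lexx b).
  have : Y (2 * b) <= K * Y b.
    apply: le_trans (_ : K <= _); first by rewrite lerDr mulr_ge0 ?exprn_ge0 // ltW.
    by rewrite ler_peMr // ltW.
  by move: (K * Y b) (K * Y s) => *; lra.
have V12 s : b <= s -> V1 (2 * s) <= K * V1 s.
  move=> le_bs; have s_gt0 : 0 < s by lra.
  rewrite -(@ler_pM2l _ (s ^+ k.+1)) ?exprn_gt0 // mulrCA.
  apply: le_trans (flux2 _ le_bs); rewrite /Y exprMn.
  rewrite -[leRHS](mulrA (2 ^+ k.+1)); apply: ler_peMl; last first.
    by rewrite exprn_ege1 ?ler1n.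
  by rewrite mulr_ge0 ?exprn_ge0 ?(ltW s_gt0) //; apply/ltW/V1_gt0; lra.
have Vb : 0 < V b by exact: V_gt0.
have V2b : 0 < V (2 * b) by apply: V_gt0; lra.
(* Again a term for the derivative, with the factor 2 of the chain rule, and one for the value at
   [b]. *)
pose K' := 2 * K + V (2 * b) / V b.
have K'_gt0 : 0 < K' by apply: addr_gt0; [exact: mulr_gt0|exact: divr_gt0].
exists K' => // s le_bs.
have : K' * V b - V (2 * b) <= K' * V s - V (2 * s).
  have := @derive_ge0_le _ (fun t => K' * V t + (- 1) * V (2 * t))
    (fun t => K' * V1 t + (- 1) * (V1 (2 * t) * (2 * 1))) b s le_bs.
  rewrite !mulN1r; apply => t /andP[le_bt _].
    apply: is_derive1D; first exact/is_derive1Z/dV'.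
    by apply: is_derive1Z; apply: (d2 V V1); apply: dV'; lra.
  have := V12 t le_bt; have := V1_gt0 t le_bt.
  rewrite /K' => V1t V12t.
  have : 0 <= V (2 * b) / V b * V1 t by rewrite mulr_ge0 ?divr_ge0 // ltW.
  have -> : (2 * K + V (2 * b) / V b) * V1 t + -1 * (V1 (2 * t) * (2 * 1)) =
    2 * (K * V1 t - V1 (2 * t)) + V (2 * b) / V b * V1 t by ring.
  by apply: addr_ge0; rewrite mulr_ge0 // subr_ge0.
have -> : K' * V b - V (2 * b) = 2 * (K * V b) by rewrite /K'; field; rewrite gt_eqF.
have : 0 < K * V b by rewrite mulr_gt0.
by move: (K * V b) (K' * V s) => *; lra.
Qed.

Lemma quadratic_growth V V1 W b C : 1 <= b -> 0 < C ->
  (forall s, b <= s -> radial_laplacian_at j V V1 W s) -> 0 < V b ->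
  (forall s, b <= s -> W s <= C) -> 0 <= b ^+ k.+1 * V1 b ->
  exists2 C2, 0 < C2 & forall s, b <= s -> V s <= C2 * s ^+ 2.
Proof.
move=> b_ge1 C_gt0 dV Vb_gt0 W_le.
pose Y s := s ^+ k.+1 * V1 s.
move=> Yb; have {}Yb : 0 <= Y b by [].
have b_gt0 : 0 < b by lra.
have dV' s : b <= s -> is_derive s 1 V (V1 s) by move=> le_bs; have [] := dV s le_bs.
pose C3 := Y b + C.
have C3_gt0 : 0 < C3 by rewrite /C3; lra.
exists (V b + C3) => [|s le_bs]; first by rewrite addr_gt0.
have V1_le t : b <= t -> V1 t <= C3 * t.
  move=> le_bt; have t_gt0 : 0 < t by lra.
  rewrite -(@ler_pM2l _ (t ^+ k.+1)) ?exprn_gt0 //.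
  have -> : t ^+ k.+1 * (C3 * t) = C3 * t ^+ k.+2 by rewrite [t ^+ k.+2]exprS; ring.
  have Yt := @radial_flux_increment_le V V1 W C b t k.+1 b_gt0 le_bt.
  feed Yt; first by move=> x /andP[le_bx _]; exact: dV.
  feed Yt.
    move=> x /andP[le_bx _]; rewrite mulrC ler_pM2r ?W_le ?exprn_gt0 //; lra.
  rewrite -/(Y b) -/(Y t) in Yt.
  have tk : 1 <= t ^+ k.+2 by rewrite exprn_ege1; lra.
  have h1 : C / k.+2%:R * (t ^+ k.+2 - b ^+ k.+2) <= C * t ^+ k.+2.
    apply: ler_pM; rewrite ?divr_ge0 ?(ltW C_gt0) //.
    - by rewrite subr_ge0 lerXn2r ?nnegrE //; lra.
    - by rewrite ler_pdivrMr ?ltr0n // ler_peMr ?ler1n // ltW.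
    - by rewrite gerBl exprn_ge0 // ltW.
  have h2 : Y b <= Y b * t ^+ k.+2 by rewrite ler_peMr //; lra.
  rewrite -/(Y t) /C3 mulrDl; move: (Y b) (Y t) (t ^+ k.+2) (C * _) (Y b * _) Yt h1 h2 => *; lra.
have Vs_le := @derive_le_increment _ V V1 (fun t => C3 / 2 * t ^+ 2)
  (fun t => C3 / 2 * (2%:R * t ^+ 1)) b s le_bs.
feed Vs_le; first by move=> x /andP[le_bx _]; exact: dV'.
feed Vs_le; first by move=> x _; apply: is_derive1Z; exact: is_derive1_exprn.
feed Vs_le.
  by move=> x /andP[le_bx _]; rewrite expr1 mulrA mulfVK ?pnatr_eq0 //; exact: V1_le.
have s2 : 1 <= s ^+ 2 by rewrite exprn_ege1; lra.
have b2 : 0 <= b ^+ 2 by rewrite exprn_ge0 // ltW.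
have Vb : V b <= V b * s ^+ 2 by rewrite ler_peMr // ltW.
have h3 : 0 <= C3 / 2 * b ^+ 2 by rewrite mulr_ge0 // divr_ge0 // ltW.
have h4 : 0 <= C3 / 2 * s ^+ 2 by rewrite mulr_ge0 ?divr_ge0 ?(ltW C3_gt0) //; lra.
rewrite mulrDl.
have -> : C3 * s ^+ 2 = C3 / 2 * s ^+ 2 + C3 / 2 * s ^+ 2 by field.
by move: (C3 / 2 * s ^+ 2) (C3 / 2 * b ^+ 2) (V b * _) Vs_le h3 h4 Vb => *; lra.
Qed.

(** The flux of W is at most C6 - (c / k) s^k, so W' is at most -(c / k) / s plus an integrable
    term, and W falls below a negative multiple of ln s. *)
Lemma inverse_square_source_false W W1 F d c : 0 < d -> 0 < c ->
  (forall s, d <= s -> radial_laplacian_at j W W1 (fun t => - F t) s) ->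
  (forall s, d <= s -> 0 <= W s) -> (forall s, d <= s -> c <= s ^+ 2 * F s) -> False.
Proof.
move=> d_gt0 c_gt0 dW W_ge0 F_ge.
pose X s := s ^+ k.+1 * W1 s.
pose C6 := `|X d| + c / k%:R * d ^+ k.
have X_le s : d <= s -> X s <= C6 - c / k%:R * s ^+ k.
  move=> le_ds.
  have Xs := @radial_flux_increment_le W W1 (fun t => - F t) (- c) d s j d_gt0 le_ds.
  feed Xs; first by move=> x /andP[le_dx _]; exact: dW.
  feed Xs.
    move=> x /andP[le_dx _]; have x_gt0 : 0 < x by lra.
    rewrite mulrN mulNr lerN2 -addn2 exprD -mulrA mulrC.
    by rewrite ler_pM2l ?exprn_gt0 // F_ge.
  rewrite -/(X s) -/(X d) in Xs; have := ler_norm (X d).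
  rewrite /C6; move: Xs; rewrite mulNr.
  by move: (c / _) (X s) (X d) `|X d| (s ^+ k) (d ^+ k) => *; lra.
pose G s := C6 / k%:R * s^-1 ^+ k.
have C6_ge0 : 0 <= C6.
  by rewrite addr_ge0 // mulr_ge0 ?exprn_ge0 ?divr_ge0 // ltW.
have k_gt0 : 0 < k%:R :> R by rewrite ltr0n.
apply: (@ln_unbounded R d (c / k%:R) (W d + G d)) => //; first exact: divr_gt0.
move=> s le_ds; have s_gt0 : 0 < s by lra.
have Ws_le := @derive_le_increment _ W W1
  (fun t => - (C6 / k%:R) * t^-1 ^+ k + - (c / k%:R) * ln t)
  (fun t => - (C6 / k%:R) * (- k%:R * t^-1 ^+ k.+1) + - (c / k%:R) * t^-1) d s le_ds.
feed Ws_le.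
  by move=> x /andP[le_dx _]; have [] := dW x le_dx.
feed Ws_le.
  move=> x /andP[le_dx _]; have x_gt0 : 0 < x by lra.
  apply: is_derive1D; apply: is_derive1Z; first exact: is_derive1_exprVn.
  exact: is_derive1_ln.
feed Ws_le.
  move=> x /andP[le_dx _]; have x_gt0 : 0 < x by lra.
  have -> : - (C6 / k%:R) * (- k%:R * x^-1 ^+ k.+1) = C6 * x^-1 ^+ k.+1.
    by field; rewrite nat1r pnatr_eq0.
  have -> : C6 * x^-1 ^+ k.+1 + - (c / k%:R) / x = (C6 - c / k%:R * x ^+ k) * x^-1 ^+ k.+1.
    rewrite [x^-1 ^+ k.+1]exprS [x^-1 ^+ k]exprVn.
    have : x ^+ k != 0 by rewrite expf_neq0 ?gt_eqF.
    have : x != 0 by rewrite gt_eqF.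
    by move: (x ^+ k) (C6) (c / _) => ? ? ? ? ?; field; apply/andP.
  by rewrite exprVn ler_pdivlMr ?exprn_gt0 // mulrC X_le.
have Ws := W_ge0 s le_ds.
have Gs : 0 <= G s by rewrite mulr_ge0 ?divr_ge0 ?exprn_ge0 ?invr_ge0 // ltW.
move: Gs Ws_le; rewrite /G !mulNr; move: (C6 / _ * s^-1 ^+ k) (C6 / _ * d^-1 ^+ k).
move: (c / _) (W s) (W d) Ws (ln s) (ln d) => *; lra.
Qed.

(* [V] is increasing and at most quadratic, hence [F >= c / s^2], which forces
   [W] below a negative multiple of [ln s]. *)
Lemma no_solution_subharmonic V V1 W W1 F a c c0 C p : 1 <= a -> 0 < c -> 0 < p ->
  (forall s, a <= s -> radial_laplacian_at j V V1 W s) ->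
  (forall s, a <= s -> radial_laplacian_at j W W1 (fun t => - F t) s) ->
  (forall s, a <= s -> 0 < V s) ->
  0 < c0 -> 0 < C ->
  (forall s, a <= s -> c0 * s^-1 ^+ k <= W s) ->
  (forall s, a <= s -> W s <= C) ->
  (forall s, a <= s -> W (2 * s) <= C * W s) ->
  source_lower_bound V F a c p -> False.
Proof.
move=> a_ge1 c_gt0 p_gt0 dV dW V_gt0 c0_gt0 C_gt0 W_ge W_le W_dbl F_ge.
have a_gt0 : 0 < a by lra.
pose Y s := s ^+ k.+1 * V1 s.
have dY s : a <= s -> is_derive s 1 Y (s ^+ k.+1 * W s).
  by move=> le_as; apply: radial_flux; [lra|exact: dV].
(* As W >= c0 / s^k, the flux of V has derivative at least c0 s and grows at least like c0 s^2 / 2,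
   up to a constant. *)
have [b le_ab Y_ge1] : exists2 b, a <= b & forall s, b <= s -> 1 <= Y s.
  exists (a + 2 * (`|Y a| + c0 / 2 * a ^+ 2 + 1) / c0).
    rewrite lerDl divr_ge0 ?(ltW c0_gt0) // mulr_ge0 // addr_ge0 // addr_ge0 //.
    by rewrite mulr_ge0 ?exprn_ge0 ?divr_ge0 ?(ltW c0_gt0) //; lra.
  move=> s; rewrite addrC; move=> le_bs.
  have X_ge0 : 0 <= `|Y a| + c0 / 2 * a ^+ 2 + 1.
    by rewrite addr_ge0 // addr_ge0 // mulr_ge0 ?exprn_ge0 ?divr_ge0 ?(ltW c0_gt0) //; lra.
  have le_as : a <= s.
    by apply: le_trans le_bs; rewrite lerDr divr_ge0 ?mulr_ge0 // ltW.
  have Ys_ge := @radial_flux_increment_ge V V1 W c0 a s 1 a_gt0 le_as.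
  feed Ys_ge; first by move=> t /andP[le_at _]; exact: dV.
  feed Ys_ge.
    move=> t /andP[le_at _]; have t_gt0 : 0 < t by lra.
    apply: le_trans (ler_wpM2l (exprn_ge0 k.+1 (ltW t_gt0)) (W_ge _ le_at)).
    rewrite expr1 [t ^+ k.+1]exprS exprVn.
    have : t ^+ k != 0 by rewrite expf_neq0 ?gt_eqF.
    move: (t ^+ k) => z z_neq0; have -> // : c0 * t = t * z * (c0 * z^-1) by field.
  rewrite -/(Y s) -/(Y a) in Ys_ge.
  have s_ge : (`|Y a| + c0 / 2 * a ^+ 2 + 1) <= c0 / 2 * s ^+ 2.
    have -> : `|Y a| + c0 / 2 * a ^+ 2 + 1 =
       c0 / 2 * (2 * (`|Y a| + c0 / 2 * a ^+ 2 + 1) / c0) by field; rewrite gt_eqF.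
    rewrite ler_pM2l ?divr_gt0 //; apply: le_trans (_ : s <= _); first by lra.
    by rewrite expr2 ler_peMr; lra.
  have := ler_norm (- Y a); rewrite normrN.
  by move: (c0 / 2) (Y a) (Y s) (s ^+ 2) (a ^+ 2) `|Y a| Ys_ge s_ge => *; lra.
have b_gt0 : 0 < b by lra.
have dV' s : b <= s -> is_derive s 1 V (V1 s).
  by move=> le_bs; have [] := dV s (le_trans le_ab le_bs).
have V1_gt0 s : b <= s -> 0 < V1 s.
  move=> le_bs; have s_gt0 : 0 < s by lra.
  have := lt_le_trans ltr01 (Y_ge1 s le_bs).
  by rewrite /Y pmulr_rgt0 // exprn_gt0.
have V_nd s t : b <= s -> s <= t -> V s <= V t.
  move=> le_bs le_st; apply: (derive_ge0_le le_st) => x /andP[le_sx _].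
    by apply: dV'; lra.
  by apply/ltW/V1_gt0; lra.
have W_gt0 s : b <= s -> 0 < W s.
  move=> le_bs; have s_gt0 : 0 < s by lra.
  apply: lt_le_trans (W_ge s (le_trans le_ab le_bs)).
  by rewrite mulr_gt0 // exprn_gt0 // invr_gt0.
have dVb s : b <= s -> radial_laplacian_at j V V1 W s by move=> /(le_trans le_ab); exact: dV.
have V_gt0b s : b <= s -> 0 < V s by move=> /(le_trans le_ab); exact: V_gt0.
have W_dblb s : b <= s -> W (2 * s) <= C * W s by move=> /(le_trans le_ab); exact: W_dbl.
have W_leb s : b <= s -> W s <= C by move=> /(le_trans le_ab); exact: W_le.
have [K K_gt0 V2_le] := subharmonic_doubling b_gt0 C_gt0 dVb V_gt0b W_gt0 W_dblb Y_ge1.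
have Yb_ge0 := le_trans ler01 (Y_ge1 b (lexx b)).
have [C2 C2_gt0 V_le] := quadratic_growth (le_trans a_ge1 le_ab) C_gt0 dVb (V_gt0b b (lexx b)) W_leb Yb_ge0.
clear dV dVb dV' dY V1_gt0 Y_ge1 Yb_ge0 Y W_le W_leb W_dbl W_dblb W_ge.
have [c5 c5_gt0 F_ge5] : exists2 c5, 0 < c5 & forall s, 2 * b <= s -> c5 <= s ^+ 2 * F s.
  have Vb : 0 < V b by exact: V_gt0.
  pose K2 := K + (V b)^-1.
  have K2_gt0 : 0 < K2 by rewrite addr_gt0 // invr_gt0.
  exists (c * K2 `^ (- 1 - p) / C2).
    by rewrite divr_gt0 // mulr_gt0 // powR_gt0.
  move=> s le_2bs; have s_gt0 : 0 < s by lra.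
  have Vs : 0 < V s by apply: V_gt0; lra.
  have le_as : a <= s by lra.
  (* Monotonicity and doubling bound V by [K2 * V s] on the window, and the summand 1 / V(b) of [K2]
     makes this level at least 1. The powers of [V s] then combine to 1 / V(s), which is at least a
     multiple of 1 / s^2. Starting at [2 * b] keeps s / 2 above b. *)
  have Fs := F_ge s (K2 * V s) le_as.
  feed Fs.
    apply: le_trans (_ : (V b)^-1 * V b <= _); first by rewrite mulVf // gt_eqF.
    apply: ler_pM; rewrite ?invr_ge0 ?(ltW Vb) //; first by rewrite lerDr ltW.
    by apply: V_nd => //; lra.
  feed Fs.
    move=> t le_st le_ts; apply: le_trans (_ : V (2 * s) <= _).
      by apply: V_nd => //; lra.
    apply: le_trans (V2_le s _) _; first by lra.
    by rewrite ler_pM2r // lerDl ltW // invr_gt0.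
  move: Fs; rewrite powRM ?(ltW K2_gt0) ?(ltW Vs) // [V s `^ p * _]mulrCA -powRD; last first.
    by rewrite [V s == 0]gt_eqF // implybT.
  have -> : p + (- 1 - p) = - 1 by ring.
  rewrite powR_inv1 ?(ltW Vs) // mulrA => Fs.
  rewrite -(@ler_pM2l _ (s ^+ 2)) ?exprn_gt0 // in Fs.
  apply: le_trans Fs; rewrite mulrCA ler_pM2l ?mulr_gt0 ?powR_gt0 //.
  by rewrite ler_pdivlMr // ler_pdivrMl // V_le; lra.
apply: (@inverse_square_source_false W W1 F (2 * b) c5) => // [|s le_ds|s le_ds].
- by rewrite mulr_gt0.
- by apply: dW; lra.
by apply/ltW/W_gt0; lra.
Qed.

End SubharmonicCase.

(** * The radial system with [W] nonpositive *)

Section SuperharmonicCase.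
Variables (R : realType) (j : nat).
Local Notation k := (j.+1).
Implicit Types (u V W F q Y : R -> R) (a b c s t : R).

(* Integrating over [s, 2 s] gains one power of [s]. *)
Lemma power_decay_lower_bound q Y Y1 b e i : 0 < b -> 0 < e ->
  (forall s, b <= s -> 0 <= q s) -> (forall s t, b <= s -> s <= t -> q s <= q t) ->
  (forall t, b <= t -> is_derive t 1 Y (Y1 t)) -> (forall t, b <= t -> 0 <= Y t) ->
  (forall t, b <= t -> e * (t^-1 ^+ i.+1 * q t) <= - Y1 t) ->
  forall s, b <= s -> e * 2^-1 ^+ i.+1 * (s^-1 ^+ i * q s) <= Y s.
Proof.
move=> b_gt0 e_gt0 q_ge0 q_nd dY Y_ge0 Y1_le s bs.
have s_gt0 : 0 < s by lra.
have le_s2 : s <= 2 * s by lra.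
have Ys := @increment_le _ Y Y1 (- (e * ((2 * s)^-1 ^+ i.+1 * q s))) s (2 * s) le_s2.
feed Ys; first by move=> t /andP[le_st _]; apply: dY; lra.
feed Ys.
  move=> t /andP[le_st le_ts]; have t_gt0 : 0 < t by lra.
  have le_bt : b <= t by lra.
  rewrite lerNr; apply: le_trans (Y1_le t le_bt); rewrite ler_pM2l //.
  have sV : 0 <= (2 * s)^-1 by rewrite invr_ge0; lra.
  apply: ler_pM; [exact: exprn_ge0|exact: q_ge0| |exact: q_nd].
  rewrite lerXn2r ?nnegrE //; first by rewrite invr_ge0 ltW.
  by rewrite lef_pV2 ?posrE //; lra.
have Y2 : 0 <= Y (2 * s) by apply: Y_ge0; lra.
have -> : e * 2^-1 ^+ i.+1 * (s^-1 ^+ i * q s) = e * ((2 * s)^-1 ^+ i.+1 * q s) * (2 * s - s).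
  rewrite invfM exprMn (exprS s^-1).
  by move: (s^-1 ^+ i) (2^-1 ^+ _) => ? ?; field; rewrite gt_eqF.
by clear -Ys Y2; move: Ys; rewrite mulNr; move: (_ * (2 * s - s)) => *; lra.
Qed.

(* [phi = s^k * V] satisfies [phi' >= c * phi^p / s]. *)
Lemma no_solution_superharmonic V V1 W W1 F a c p : 1 <= a -> 0 < c ->
  1 < p -> p * k%:R = k%:R + 4 ->
  (forall s, a <= s -> radial_laplacian_at j V V1 W s) ->
  (forall s, a <= s -> radial_laplacian_at j W W1 (fun t => - F t) s) ->
  (forall s, a <= s -> 0 < V s) ->
  (forall s, a <= s -> W s <= 0) ->
  (forall s, a <= s -> 0 <= W1 s) ->
  source_lower_bound V F a c p -> False.
Proof.
move=> a_ge1 c_gt0 p_gt1 pk dV dW V_gt0 W_le0 W1_ge0 F_ge.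
have k_gt0 : 0 < k%:R :> R by rewrite ltr0n.
have p_gt0 : 0 < p by lra.
have powp x : 0 < x -> (x ^+ k) `^ p = x ^+ (k + 4).
  move=> x_gt0; rewrite -!powR_mulrn ?(ltW x_gt0) // -powRrM; congr powR.
  by rewrite natrD -pk mulrC.
have p1_gt0 : 0 < p - 1 by lra.
clear pk p_gt1.
have a_gt0 : 0 < a by lra.
have [C C_ge0 C_ge] : exists2 C : R, 0 <= C & a ^+ k.+1 * V1 a <= C.
  by exists `|a ^+ k.+1 * V1 a|; rewrite ?ler_norm.
(* W <= 0 makes the flux of V nonincreasing, hence at most [C]; integrating it bounds V on the whole
   half-line, so one level [m] serves for all radii. *)
pose m : R := 1 + V a + C / k%:R * a^-1 ^+ k.
have Cf_ge0 s : 0 < s -> 0 <= C / k%:R * s^-1 ^+ k.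
  by move=> s_gt0; apply: mulr_ge0; rewrite ?exprn_ge0 ?divr_ge0 ?invr_ge0 // ltW.
have V_le s : a <= s -> V s <= m.
  move=> le_as; have s_gt0 : 0 < s by lra.
  have := @flux_increment_le R j V V1 a s C a_gt0 le_as.
  move=> Vs_le; feed Vs_le; first by move=> x /andP[le_ax _]; have [] := dV x le_ax.
  feed Vs_le.
    move=> x /andP[le_ax _]; apply: le_trans C_ge.
    have := @derive_le0_le _ (fun t => t ^+ k.+1 * V1 t) (fun t => t ^+ k.+1 * W t) a x le_ax.
    apply=> y /andP[le_ay _]; first by apply: radial_flux; [lra|exact: dV].
    by rewrite mulr_ge0_le0 ?W_le0 // exprn_ge0 //; lra.
  have := Cf_ge0 s s_gt0; move: Vs_le; rewrite mulrBr /m.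
  move: (C / k%:R * a^-1 ^+ k : R) (C / k%:R * s^-1 ^+ k : R) => x y Vs_le y_ge0.
  by lra.
have m_ge1 : 1 <= m.
  have h1 := Cf_ge0 a a_gt0; have h2 := V_gt0 a (lexx a).
  rewrite /m; move: (C / k%:R * _) h1 => x h1.
  by lra.
pose c1 : R := c * m `^ (- 1 - p).
have c1_gt0 : 0 < c1 by rewrite mulr_gt0 // powR_gt0 //; lra.
(* Twice [a], so that the window around s starts above a. *)
pose b : R := 2 * a; have b_gt0 : 0 < b by rewrite /b; lra.
have le_ab : a <= b by rewrite /b; lra.
have F_ge1 s : b <= s -> c1 * V s `^ p <= F s.
  move=> le_bs; have := F_ge s m (le_trans le_ab le_bs) m_ge1.
  have -> : c * (V s `^ p * m `^ (- 1 - p)) = c1 * V s `^ p by rewrite /c1; ring.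
  by apply=> t le_st _; apply: V_le; move: le_bs; rewrite /b; lra.
clearbody m; clearbody c1; clearbody b; clear C C_ge0 C_ge Cf_ge0 V_le F_ge m m_ge1 c c_gt0.
(* Chosen so that [phi' = s^(k-1) * Psi] and [Psi' = s * W], which is nonpositive. Were [Psi]
   negative somewhere, it would stay so and drive phi below 0. *)
pose Psi s := s * V1 s + k%:R * V s.
pose phi s := s ^+ k * V s.
have dPsi s : a <= s -> is_derive s 1 Psi (s * W s).
  move=> le_as; have [dVs dV1s] := dV s le_as; have s_gt0 : 0 < s by lra.
  apply: is_derive_eq (is_derive1D (is_derive1M (is_derive1_id s) dV1s)
    (is_derive1Z k%:R dVs)) _.
  by rewrite -[k.+1%:R]natr1; field; rewrite gt_eqF.
have dphi s : a <= s -> is_derive s 1 phi (s ^+ j * Psi s).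
  move=> le_as; have [dVs _] := dV s le_as.
  apply: is_derive_eq (is_derive1M (is_derive1_exprn s k) dVs) _.
  by rewrite /Psi exprS /=; ring.
have phi_gt0 s : a <= s -> 0 < phi s.
  by move=> le_as; apply: mulr_gt0; [rewrite exprn_gt0 //; lra|exact: V_gt0].
have Psi_ge0 s : a <= s -> 0 <= Psi s.
  move=> le_as; rewrite leNgt; apply/negP => Psi_lt0.
  have [|t le_st||t le_st phit] := @negative_slope R phi (fun t => t ^+ j * Psi t) s (- Psi s).
  - by rewrite oppr_gt0.
  - by apply: dphi; lra.
  - move=> t le_st; rewrite opprK.
    have Psit : Psi t <= Psi s.
      apply: (@derive_le0_le _ Psi (fun t => t * W t) s t le_st) => x /andP[le_sx _].
        by apply: dPsi; lra.
      by rewrite mulr_ge0_le0 ?W_le0; lra.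
    have t_ge1 : 1 <= t by lra.
    have := ler_neMl (ltW (le_lt_trans Psit Psi_lt0)) (exprn_ege1 j t_ge1).
    by move=> /le_trans; apply.
  - by have := phi_gt0 t (le_trans le_as le_st); lra.
have phi_nd s t : a <= s -> s <= t -> phi s <= phi t.
  move=> le_as le_st; apply: (derive_ge0_le le_st) => x /andP[le_sx _].
    by apply: dphi; lra.
  by apply: mulr_ge0; [rewrite exprn_ge0 //; lra|apply: Psi_ge0; lra].
clear dV; clearbody Psi.
pose q s := phi s `^ p.
have q_nd s t : a <= s -> s <= t -> q s <= q t.
  move=> le_as le_st; apply: ge0_ler_powR; rewrite ?nnegrE ?phi_nd ?(ltW p_gt0) //.
    by apply/ltW/phi_gt0.
  by apply/ltW/phi_gt0; lra.
have q_ge0 s : a <= s -> 0 <= q s by move=> _; exact: powR_ge0.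
have q_gt0 s : a <= s -> 0 < q s by move=> le_as; rewrite powR_gt0 // phi_gt0.
have Vq s : a <= s -> V s `^ p = s^-1 ^+ (k + 4) * q s.
  move=> le_as; have s_gt0 : 0 < s by lra.
  have -> : V s = s^-1 ^+ k * phi s by rewrite /phi mulrA -exprMn mulVf ?gt_eqF // expr1n mul1r.
  rewrite powRM ?exprn_ge0 ?invr_ge0 ?(ltW s_gt0) //; last exact/ltW/phi_gt0.
  by rewrite powp ?invr_gt0.
clear powp; clearbody phi.
have q_geb s : b <= s -> 0 <= q s by move=> _; exact: powR_ge0.
have q_ndb s t : b <= s -> s <= t -> q s <= q t by move=> bs; apply: q_nd; exact: le_trans bs.
have half_gt0 i : 0 < 2^-1 ^+ i :> R by rewrite exprn_gt0 // invr_gt0.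
(* The source is at least c1 q / s^(k+4), with q = phi^p nondecreasing. Up to constants, successive
   integrations give X >= q / s^2, then -W >= q / s^(k+2), then Psi >= q / s^k, hence phi' >= q /
   s. *)
pose X s := s ^+ k.+1 * W1 s.
have [c2 c2_gt0 X_ge] : exists2 c2, 0 < c2 & forall s, b <= s -> c2 * (s^-1 ^+ 2 * q s) <= X s.
  exists (c1 * 2^-1 ^+ 3); first exact: mulr_gt0.
  apply: (@power_decay_lower_bound q X (fun t => t ^+ k.+1 * - F t)) => // t bt.
  - by apply: (@radial_flux R j W W1 (fun t => - F t)); [lra|apply: dW; lra].
  - by apply: mulr_ge0; [rewrite exprn_ge0 //; lra|apply: W1_ge0; lra].
  have t_gt0 : 0 < t by lra.
  have -> : - (t ^+ k.+1 * - F t) = t ^+ k.+1 * F t by ring.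
  have -> : c1 * (t^-1 ^+ 3 * q t) = t ^+ k.+1 * (c1 * V t `^ p).
    rewrite Vq; last by lra.
    rewrite -(addSnnS k 3) exprD [t^-1 ^+ k.+1]exprVn.
    have : t ^+ k.+1 != 0 by rewrite expf_neq0 ?gt_eqF.
    by move: (t ^+ k.+1) (t^-1 ^+ 3) => y z y_neq0; field.
  by rewrite ler_pM2l ?exprn_gt0 // F_ge1.
have [c3 c3_gt0 W_le] : exists2 c3, 0 < c3 &
    forall s, b <= s -> c3 * (s^-1 ^+ (k + 2) * q s) <= - W s.
  exists (c2 * 2^-1 ^+ (k + 2).+1); first exact: mulr_gt0.
  apply: (@power_decay_lower_bound q (fun t => - W t) (fun t => - W1 t)) => // t bt.
  - by apply: is_deriveN; have [|//] := dW t; lra.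
  - by rewrite oppr_ge0 W_le0 //; lra.
  have t_gt0 : 0 < t by lra.
  have -> : - - W1 t = t^-1 ^+ k.+1 * X t.
    by rewrite opprK /X mulrA -exprMn mulVf ?gt_eqF // expr1n mul1r.
  have -> : c2 * (t^-1 ^+ (k + 2).+1 * q t) = t^-1 ^+ k.+1 * (c2 * (t^-1 ^+ 2 * q t)).
    by rewrite -addSn exprD; ring.
  by rewrite ler_pM2l ?exprn_gt0 ?invr_gt0 // X_ge.
have [c4 c4_gt0 Psi_ge] : exists2 c4, 0 < c4 &
    forall s, b <= s -> c4 * (s^-1 ^+ k * q s) <= Psi s.
  exists (c3 * 2^-1 ^+ k.+1); first exact: mulr_gt0.
  apply: (@power_decay_lower_bound q Psi (fun t => t * W t)) => // t bt.
  - by apply: dPsi; lra.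
  - by apply: Psi_ge0; lra.
  have t_gt0 : 0 < t by lra.
  have -> : - (t * W t) = t * - W t by ring.
  have -> : c3 * (t^-1 ^+ k.+1 * q t) = t * (c3 * (t^-1 ^+ (k + 2) * q t)).
    rewrite addn2 (exprS t^-1 k.+1).
    by move: (t^-1 ^+ k.+1) => y; field; rewrite gt_eqF.
  by rewrite ler_pM2l // W_le.
(* Separation of variables: the nonnegative quantity phi^(1-p) decreases at least as fast as (p - 1)
   c4 ln s. *)
apply: (@ln_unbounded R b ((p - 1) * c4) (phi b `^ (1 - p))) => //.
  by rewrite mulr_gt0.
move=> s le_bs.
have := @derive_le_increment _ (fun t => phi t `^ (1 - p))
  (fun t => (1 - p) * phi t `^ (1 - p - 1) * (t ^+ j * Psi t))
  (fun t => - ((p - 1) * c4) * ln t) (fun t => - ((p - 1) * c4) * t^-1) b s le_bs.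
move=> Hs; feed Hs.
  move=> t /andP[le_bt _]; have le_at : a <= t by lra.
  apply: (@is_derive1_chain _ (fun x => x `^ (1 - p)) phi); last exact: dphi.
  exact/is_derive1_powR/phi_gt0.
feed Hs.
  by move=> t /andP[le_bt _]; apply/is_derive1Z/is_derive1_ln; lra.
feed Hs.
  move=> t /andP[le_bt _]; have le_at : a <= t by lra.
  have t_gt0 : 0 < t by lra.
  have -> : 1 - p - 1 = - p by ring.
  have -> : (1 - p) * phi t `^ (- p) * (t ^+ j * Psi t) =
     - ((p - 1) * (phi t `^ (- p) * (t ^+ j * Psi t))) by ring.
  rewrite mulNr lerN2 -mulrA ler_pM2l // powRN -/(q t).
  rewrite ler_pdivlMl ?q_gt0 //.
  have -> : q t * (c4 / t) = t ^+ j * (c4 * (t^-1 ^+ k * q t)).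
    rewrite [t^-1 ^+ k]exprS exprVn.
    have : t ^+ j != 0 by rewrite expf_neq0 ?gt_eqF.
    have : t != 0 by rewrite gt_eqF.
    by move: (t ^+ j) => ? ? ?; field; apply/andP.
  by rewrite ler_pM2l ?exprn_gt0 // Psi_ge.
have := powR_ge0 (phi s) (1 - p).
rewrite mulrBr; move: Hs; rewrite !mulNr.
by move: (_ * c4 * ln s) (_ * c4 * ln b) (phi s `^ _) (phi b `^ _); intros; lra.
Qed.

End SuperharmonicCase.

(** * Nonexistence for the radial system *)

Section RadialSystem.
Variables (R : realType) (j : nat).
Local Notation k := (j.+1).
Implicit Types (u V W F : R -> R) (a b c s t : R).

(** The flux of W is nonincreasing, so once W' is negative it stays nonpositive and W decreases; W
    is then nonnegative, since a negative value would keep it away from 0 and V could not stay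
    positive. If W' is never negative, W increases and its sign decides between the two cases. *)
Lemma radial_system_no_solution V V1 W W1 F a c p : 1 <= a -> 0 < c ->
  1 < p -> p * k%:R = k%:R + 4 ->
  (forall s, a <= s -> radial_laplacian_at j V V1 W s) ->
  (forall s, a <= s -> radial_laplacian_at j W W1 (fun t => - F t) s) ->
  (forall s, a <= s -> 0 < V s) ->
  (forall s, a <= s -> 0 <= F s) ->
  ~ source_lower_bound V F a c p.
Proof.
move=> a_ge1 c_gt0 p_gt1 pk dV dW V_gt0 F_ge0 F_ge.
have k_gt0 : 0 < k%:R :> R by rewrite ltr0n.
have sub b : a <= b -> forall s, b <= s -> a <= s by move=> ab s; exact: le_trans.
have F_geb b : a <= b -> source_lower_bound V F b c p.
  by move=> ab s m bs; apply: F_ge; exact: sub bs.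
have p_gt0 : 0 < p by lra.
pose X s := s ^+ k.+1 * W1 s.
have X_nincr s t : a <= s -> s <= t -> X t <= X s.
  move=> le_as le_st.
  apply: (@derive_le0_le _ X (fun x => x ^+ k.+1 * - F x) s t le_st) => x /andP[sx _].
    by apply: (@radial_flux R j W W1 (fun t => - F t)); [lra|apply: dW; lra].
  by rewrite mulrN oppr_le0 mulr_ge0 ?exprn_ge0 ?F_ge0; lra.
have [[s2 as2 W1_lt0]|W1_ge0] := pselect (exists2 s, a <= s & W1 s < 0).
  have X_lt0 : X s2 < 0 by rewrite nmulr_llt0 // exprn_gt0; lra.
  have W1_lt s : s2 <= s -> W1 s <= 0.
    move=> s2s; have s_gt0 : 0 < s by lra.
    have := le_lt_trans (X_nincr _ _ as2 s2s) X_lt0.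
    by rewrite pmulr_rlt0 ?exprn_gt0 // => /ltW.
  have W_nincr s t : s2 <= s -> s <= t -> W t <= W s.
    move=> le_as le_st; apply: (@derive_le0_le _ W W1 s t le_st) => x /andP[le_sx _].
      by have [|//] := dW x; lra.
    by apply: W1_lt; lra.
  have W_ge0 s : s2 <= s -> 0 <= W s.
    move=> s2s; rewrite leNgt; apply/negP => Ws.
    have as_ : a <= s := le_trans as2 s2s.
    have s_ge1 : 1 <= s by lra.
    apply: (@radial_laplacian_not_negative R j V V1 W s (- W s)) => //.
    - by rewrite oppr_gt0.
    - by move=> t st; apply: dV; lra.
    - by move=> t st; apply: V_gt0; lra.
    - by move=> t st; rewrite opprK W_nincr.
  have x_gt0 : 0 < - X s2 / k%:R by rewrite divr_gt0 // oppr_gt0.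
  have s2_ge1 : 1 <= s2 by lra.
  have W2 := W_ge0 s2 (lexx _).
  apply: (@no_solution_subharmonic R j V V1 W W1 F s2 c (- X s2 / k%:R / 2) (1 + W s2) p) => //.
  - by move=> s s2s; apply: dV; lra.
  - by move=> s s2s; apply: dW; lra.
  - by move=> s s2s; apply: V_gt0; lra.
  - by rewrite divr_gt0.
  - by lra.
  (* Integrating the negative flux over [[s, 2 s]] and dropping [W (2 * s) >= 0] gives the lower
     bound; the final division by 2 in the constant pays for (2 s)^(-k) <= s^(-k) / 2. *)
  - move=> s s2s; have s_gt0 : 0 < s by lra.
    have le_s2 : s <= 2 * s by lra.
    have Ws := @flux_increment_le R j W W1 s (2 * s) (X s2) s_gt0 le_s2.
    feed Ws; first by move=> t /andP[st _]; have [|//] := dW t; lra.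
    feed Ws; first by move=> t /andP[st _]; apply: X_nincr => //; lra.
    have W2s : 0 <= W (2 * s) by apply: W_ge0; lra.
    have h : (2 * s)^-1 ^+ k <= s^-1 ^+ k / 2.
      rewrite invfM exprMn mulrC ler_wpM2l ?exprn_ge0 ?invr_ge0 ?(ltW s_gt0) //.
      by rewrite exprS ler_piMr ?invr_ge0 // exprn_ile1 // ?invr_ge0 // invf_le1 // ler1n.
    have := ler_wpM2l (ltW x_gt0) h.
    move: Ws; rewrite !mulrBr !mulNr mulrA.
    move: (X s2 / k%:R) (s^-1 ^+ k) ((2 * s)^-1 ^+ k) => x y z.
    by lra.
  - by move=> s s2s; have := W_nincr s2 s (lexx _) s2s; lra.
  - move=> s s2s; apply: le_trans (W_nincr s (2 * s) _ _) _ => //; first by lra.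
    by rewrite mulrDl mul1r lerDl mulr_ge0 // W_ge0.
  - exact: F_geb.
have {}W1_ge0 s : a <= s -> 0 <= W1 s.
  by move=> as_; rewrite leNgt; apply/negP => Ws; apply: W1_ge0; exists s.
have W_nd s t : a <= s -> s <= t -> W s <= W t.
  move=> le_as le_st; apply: (@derive_ge0_le _ W W1 s t le_st) => x /andP[le_sx _].
    by have [|//] := dW x; lra.
  by apply: W1_ge0; lra.
have [[b ab Wb_gt0]|W_le0] := pselect (exists2 s, a <= s & 0 < W s); last first.
  apply: (@no_solution_superharmonic R j V V1 W W1 F a c p) => //.
  by move=> s as_; rewrite leNgt; apply/negP => Ws; apply: W_le0; exists s.
have b_gt0 : 0 < b by lra.
have [M M_gt0 W_le] : exists2 M, 0 < M & forall s, b <= s -> W s <= M.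
  exists (W b + X b / k%:R * b^-1 ^+ k).
    apply: ltr_wpDr => //; apply: mulr_ge0; last by rewrite exprn_ge0 // invr_ge0 ltW.
    by rewrite divr_ge0 // mulr_ge0 ?W1_ge0 // exprn_ge0 // ltW.
  move=> s bs; have Ws := @flux_increment_le R j W W1 b s (X b) b_gt0 bs.
  feed Ws; first by move=> t /andP[st _]; have [|//] := dW t; lra.
  feed Ws; first by move=> t /andP[st _]; apply: X_nincr => //; lra.
  have : 0 <= X b / k%:R * s^-1 ^+ k.
    apply: mulr_ge0; last by rewrite exprn_ge0 // invr_ge0; lra.
    by rewrite divr_ge0 // mulr_ge0 ?W1_ge0 // exprn_ge0 // ltW.
  move: Ws; rewrite mulrBr.
  move: (X b / k%:R * s^-1 ^+ k) (X b / k%:R * b^-1 ^+ k) => x y.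
  by lra.
(* Here W lies between [W b] and [M]: the first summand bounds W, the second is its doubling
   constant. *)
have C_gt0 : 0 < M + M / W b by rewrite addr_gt0 ?divr_gt0.
have b_ge1 : 1 <= b by lra.
apply: (@no_solution_subharmonic R j V V1 W W1 F b c (W b) (M + M / W b) p) => //.
- by move=> s s2s; apply: dV; lra.
- by move=> s s2s; apply: dW; lra.
- by move=> s s2s; apply: V_gt0; lra.
- move=> s bs; apply: le_trans (W_nd b s ab bs).
  rewrite ler_piMr ?(ltW Wb_gt0) // exprn_ile1 // ?invr_ge0 ?invf_le1; lra.
- by move=> s bs; apply: le_trans (W_le _ bs) _; rewrite lerDl divr_ge0 // ltW.
- move=> s bs; apply: le_trans (W_le (2 * s) _) _; first by lra.
  have Ws := W_nd b s ab bs.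
  apply: le_trans (_ : M / W b * W b <= _); first by rewrite mulfVK ?gt_eqF.
  by apply: ler_pM; rewrite ?divr_ge0 ?(ltW Wb_gt0) ?(ltW M_gt0) // lerDr ltW.
- exact: F_geb.
Qed.

End RadialSystem.

(** * Bounding means near the centre by their values on an annulus *)

Section CenterEstimate.
Variables (R : realType) (j : nat).
Local Notation k := (j.+1).
Implicit Types (u V W F : R -> R) (a b c s t l : R).

Lemma flux_limit_le0 (u1 : R -> R) (B b l : R) : 0 < b ->
  (forall t, 0 < t -> t <= b -> `|t * u1 t| <= B) ->
  (forall t, 0 < t -> t <= b -> l <= t ^+ k.+1 * u1 t) -> l <= 0.
Proof.
move=> b_gt0 u1_le l_le; rewrite leNgt; apply/negP => l_gt0.
have B_ge0 : 0 <= B by apply: le_trans (normr_ge0 _) (u1_le b b_gt0 (lexx b)).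
have B1_gt0 : 0 < 2 * (B + 1) by lra.
have [x [x_gt0 xb x_le1 xl]] : exists x : R, [/\ 0 < x, x <= b, x <= 1 & x <= l / (2 * (B + 1))].
  exists (Num.min (Num.min b 1) (l / (2 * (B + 1)))).
  by split; rewrite ?lt_min ?b_gt0 ?ltr01 ?divr_gt0 // !ge_min lexx ?orbT.
have := l_le x x_gt0 xb; rewrite exprSr -mulrA.
have xu : x ^+ k * (x * u1 x) <= x * B.
  apply: le_trans (_ : x ^+ k * B <= _).
    by rewrite ler_wpM2l ?exprn_ge0 ?(ltW x_gt0) // (le_trans (ler_norm _)) ?u1_le.
  rewrite ler_wpM2r // exprS ler_piMr ?(ltW x_gt0) // exprn_ile1 // ltW //.
have : x * (2 * (B + 1)) <= l by rewrite -ler_pdivlMr.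
have : 0 < x * B + 2 * x by apply: ltr_wpDl; [rewrite mulr_ge0 // ltW|lra].
by move: (x ^+ k * (x * u1 x)) xu => y xu h1 h2 h3; lra.
Qed.

(** Since M stays in [0, m], its slope is at most 4 m / a at some point of the first quarter of
    [a, 2 a] and at least -4 m / a at some point of the last. These points are a / 2 apart or more,
    and between them the flux drops by at least K a^(k+2) / 2. *)
Lemma mean_negative_laplacian_le (M M1 N : R -> R) (a m K : R) : 0 < a -> 0 <= m -> 0 < K ->
  (forall t, 0 < t -> t <= 2 * a -> radial_laplacian_at j M M1 N t) ->
  (forall t, a <= t -> t <= 2 * a -> 0 <= M t) ->
  (forall t, a <= t -> t <= 2 * a -> M t <= m) ->
  (forall t, a <= t -> t <= 2 * a -> N t <= - K) -> K * a ^+ 2 <= 2 ^+ (k + 5) * m.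
Proof.
move=> a_gt0 m_ge0 K_gt0 dM M_ge0 M_le N_le.
pose Y t := t ^+ k.+1 * M1 t.
have dM1 x t : 0 < x -> t <= 2 * a -> forall y, x <= y <= t -> is_derive y 1 M (M1 y).
  by move=> x_gt0 ta y /andP[xy yt]; have [||//] := dM y; lra.
have le1 : a <= 5 / 4 * a by lra.
have le2 : 7 / 4 * a <= 2 * a by lra.
have [x1 /andP[ax1 x1a] M1x1] := mvt_is_derive le1 (dM1 a (5 / 4 * a) a_gt0 ltac:(lra)).
have [x2 /andP[ax2 x2a] M1x2] := mvt_is_derive le2 (dM1 (7 / 4 * a) (2 * a) ltac:(lra) (lexx _)).
have x1_gt0 : 0 < x1 by lra.
have x2_gt0 : 0 < x2 by lra.
have M5 : M (5 / 4 * a) <= m by apply: M_le; lra.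
have M7 : M (7 / 4 * a) <= m by apply: M_le; lra.
have Ma : 0 <= M a by apply: M_ge0; lra.
have M2 : 0 <= M (2 * a) by apply: M_ge0; lra.
have M1x1_le : M1 x1 <= 4 * m / a.
  rewrite ler_pdivlMr //; move: M1x1.
  have -> : M1 x1 * (5 / 4 * a - a) = M1 x1 * a / 4 by field.
  by move: (M1 x1 * a) => y; lra.
have M1x2_ge : - M1 x2 <= 4 * m / a.
  rewrite ler_pdivlMr //; move: M1x2.
  have -> : M1 x2 * (2 * a - 7 / 4 * a) = - (- M1 x2 * a) / 4 by field.
  by move: (- M1 x2 * a) => y; lra.
have q_ge0 : 0 <= 4 * m / a by rewrite divr_ge0 ?mulr_ge0 // ltW.
have pow_le x : 0 < x -> x <= 2 * a -> x ^+ k.+1 <= (2 * a) ^+ k.+1.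
  by move=> x_gt0 xa; apply: lerXn2r => //; rewrite nnegrE ?mulr_ge0 // ltW.
have Yx1 : Y x1 <= (2 * a) ^+ k.+1 * (4 * m / a).
  apply: le_trans (_ : x1 ^+ k.+1 * (4 * m / a) <= _).
    by rewrite ler_wpM2l // exprn_ge0 // ltW.
  by rewrite ler_wpM2r // pow_le // (le_trans x1a) //; clear -a_gt0; lra.
have Yx2 : - Y x2 <= (2 * a) ^+ k.+1 * (4 * m / a).
  rewrite /Y -mulrN; apply: le_trans (_ : x2 ^+ k.+1 * (4 * m / a) <= _).
    by rewrite ler_wpM2l // exprn_ge0 // ltW.
  by rewrite ler_wpM2r // pow_le.
have x12 : x1 <= x2 by clear -x1a ax2 a_gt0; lra.
have ak_gt0 : 0 < a ^+ k.+1 by rewrite exprn_gt0.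
have Y12 := @increment_le _ Y (fun t => t ^+ k.+1 * N t) (- (a ^+ k.+1 * K)) x1 x2 x12.
feed Y12.
  move=> t /andP[xt tx]; have t_gt0 := lt_le_trans x1_gt0 xt.
  by apply: (@radial_flux R j M M1 N) => //; exact: dM (le_trans tx x2a).
feed Y12.
  move=> t /andP[xt tx].
  have t_gt0 := lt_le_trans x1_gt0 xt.
  have Nt : N t <= - K by apply: N_le; [exact: le_trans ax1 xt|exact: le_trans tx x2a].
  rewrite -mulrN; apply: le_trans (_ : t ^+ k.+1 * - K <= _).
    by rewrite ler_wpM2l // exprn_ge0 // ltW.
  rewrite ler_wnM2r ?oppr_le0 ?(ltW K_gt0) // lerXn2r ?nnegrE ?(ltW a_gt0) ?(ltW t_gt0) //.
  exact: le_trans ax1 xt.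
have : a ^+ k.+1 * K * (a / 2) <= a ^+ k.+1 * K * (x2 - x1).
  have h : a / 2 <= x2 - x1 by clear -x1a ax2; lra.
  by apply: ler_wpM2l h; apply: mulr_ge0 => //; exact: ltW.
rewrite mulNr in Y12; move=> Y12'.
have {Y12' Y12 Yx1 Yx2} : a ^+ k.+1 * K * (a / 2) <= 2 * ((2 * a) ^+ k.+1 * (4 * m / a)).
  move: (Y x1) (Y x2) (a ^+ k.+1 * K * (a / 2)) (a ^+ k.+1 * K * (x2 - x1))
    ((2 * a) ^+ k.+1 * (4 * m / a)) Y12' Y12 Yx1 Yx2 => y1 y2 z1 z2 z3 h1 h2 h3 h4.
  by lra.
have -> : a ^+ k.+1 * K * (a / 2) = a ^+ k.+1 / (2 * a) * (K * a ^+ 2).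
  by field; rewrite gt_eqF.
have -> : 2 * ((2 * a) ^+ k.+1 * (4 * m / a)) = a ^+ k.+1 / (2 * a) * (2 ^+ (k + 5) * m).
  rewrite exprMn -(addSnnS k 4) exprD.
  by move: (2 ^+ k.+1) => z; field; rewrite gt_eqF.
by rewrite ler_pM2l // divr_gt0 // mulr_gt0.
Qed.

(* The bounds on [t * M1 t] and [t * N1 t] replace smoothness at the centre: they
   make the fluxes [t^(n-1) * M1 t] and [t^(n-1) * N1 t] vanish at [0]. *)
Lemma center_le (M M1 N N1 G : R -> R) (a B m s : R) : 0 < a ->
  (forall t, 0 < t -> t <= 2 * a -> radial_laplacian_at j M M1 N t) ->
  (forall t, 0 < t -> t <= 2 * a -> radial_laplacian_at j N N1 G t) ->
  (forall t, 0 < t -> t <= 2 * a -> G t <= 0) ->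
  (forall t, 0 < t -> t <= 2 * a -> 0 <= M t) ->
  (forall t, 0 < t -> t <= 2 * a -> `|t * M1 t| <= B) ->
  (forall t, 0 < t -> t <= 2 * a -> `|t * N1 t| <= B) ->
  (forall t, a <= t -> t <= 2 * a -> M t <= m) ->
  0 < s -> s <= a -> M s <= (1 + 2 ^+ (k + 5)) * m.
Proof.
move=> a_gt0 dM dN G_le0 M_ge0 M1_le N1_le M_le s_gt0 sa.
have m_ge0 : 0 <= m by apply: le_trans (M_ge0 a _ _) (M_le a _ _); lra.
pose X t := t ^+ k.+1 * N1 t; pose Y t := t ^+ k.+1 * M1 t.
have X_nincr x t : 0 < x -> x <= t -> t <= 2 * a -> X t <= X x.
  move=> x_gt0 xt ta.
  apply: (@derive_le0_le _ X (fun y => y ^+ k.+1 * G y) x t xt) => y /andP[xy yt].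
    by apply: (@radial_flux R j N N1 G); [lra|apply: dN; lra].
  have Gy : G y <= 0 by apply: G_le0; lra.
  by rewrite mulr_ge0_le0 // exprn_ge0; lra.
have N1_le0 t : 0 < t -> t <= 2 * a -> N1 t <= 0.
  move=> t_gt0 ta; rewrite -(@pmulr_rle0 _ (t ^+ k.+1)) ?exprn_gt0 //.
  apply: (@flux_limit_le0 N1 B t (X t) t_gt0) => x x_gt0 xt.
    by apply: N1_le; lra.
  exact: X_nincr.
have N_nincr x t : 0 < x -> x <= t -> t <= 2 * a -> N t <= N x.
  move=> x_gt0 xt ta.
  apply: (@derive_le0_le _ N N1 x t xt) => y /andP[xy yt].
    by have [||//] := dN y; lra.
  by apply: N1_le0; lra.
(* [K] is the negative part of [N a]. As N is nonincreasing, [N <= -K] on the annulus when K > 0,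
   which bounds [K * a^2] by m, while [N >= -K] inside, which bounds how fast M can decrease towards
   the annulus. *)
have [K [K_ge0 N_ge KE]] : exists K : R, [/\ 0 <= K, - K <= N a & 0 < K -> N a = - K].
  have [Na|Na] := leP 0 (N a); first by exists 0; split; lra.
  by exists (- N a); split; lra.
have K_le : K * a ^+ 2 <= 2 ^+ (k + 5) * m.
  have [K_le0|K_gt0] := leP K 0.
    have -> : K = 0 by lra.
    by rewrite mul0r mulr_ge0 // exprn_ge0.
  have {}KE := KE K_gt0.
  apply: (@mean_negative_laplacian_le M M1 N) => // t at_ ta; first by apply: M_ge0; lra.
  by rewrite -KE; apply: N_nincr.
clear M_ge0 G_le0 dN.
(* The flux of M starts from 0 at the centre and, up to radius t, its derivative is at least -K
   t^(k+1); hence [M1 t >= -K t]. *)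
have M1_ge t : 0 < t -> t <= a -> - (K * a) <= M1 t.
  move=> t_gt0 ta.
  have tk_gt0 : 0 < t ^+ k.+1 by rewrite exprn_gt0.
  have : - (Y t + K * t ^+ k.+1 * t) <= 0.
    apply: (@flux_limit_le0 (fun x => - M1 x) B t _ t_gt0) => x x_gt0 xt.
      by rewrite mulrN normrN M1_le //; lra.
    have Yxt := @increment_ge _ Y (fun t => t ^+ k.+1 * N t) (- (t ^+ k.+1 * K)) x t xt.
    feed Yxt.
      by move=> y /andP[xy yt]; apply: (@radial_flux R j M M1 N); [lra|apply: dM; lra].
    feed Yxt.
      move=> y /andP[xy yt]; have Ny : - K <= N y by apply: (le_trans N_ge); apply: N_nincr; lra.
      rewrite -mulrN; apply: le_trans (_ : y ^+ k.+1 * - K <= _).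
        rewrite ler_wnM2r ?oppr_le0 // lerXn2r ?nnegrE; lra.
      by rewrite ler_wpM2l // exprn_ge0 //; lra.
    have : t ^+ k.+1 * K * (t - x) <= t ^+ k.+1 * K * t.
      apply: ler_wpM2l; last by rewrite gerBl ltW.
      by apply: mulr_ge0 => //; exact: ltW.
    rewrite mulrN -/(Y x); move: Yxt; rewrite mulNr [K * _]mulrC.
    move: (Y x) (Y t) (t ^+ k.+1 * K * (t - x)) (t ^+ k.+1 * K * t) => y1 y2 z1 z2 h1 h2.
    by lra.
  rewrite /Y.
  have -> : - (t ^+ k.+1 * M1 t + K * t ^+ k.+1 * t) = t ^+ k.+1 * - (M1 t + K * t) by ring.
  rewrite pmulr_rle0 // oppr_le0 => h.
  have : K * t <= K * a by rewrite ler_wpM2l.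
  by move: (K * t) (K * a) h => x y h1 h2; lra.
have Ms := @increment_ge _ M M1 (- (K * a)) s a sa.
feed Ms; first by move=> t /andP[st ta]; have [||//] := dM t; lra.
feed Ms; first by move=> t /andP[st ta]; apply: M1_ge; lra.
have Ma : M a <= m by apply: M_le; lra.
have : 0 <= K * a * s by rewrite !mulr_ge0 // ltW.
rewrite mulrDl mul1r; move: Ms; rewrite mulNr mulrBr -[K * a * a]mulrA -expr2.
move: (K * a ^+ 2) (K * a * s) (2 ^+ (k + 5) * m) K_le => x y z h1 h2 h3.
by lra.
Qed.

End CenterEstimate.

(** * Averages of solutions *)

Section Green.
Variables (R : realType) (n : nat) (I : ('rV[R]_n -> R) -> R).
Hypothesis I_int : integral_functional I.
Implicit Types (x y z : 'rV[R]_n) (s t : R) (u w F : 'rV[R]_n -> R) (g : nat -> R -> R)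
  (U : set 'rV[R]_n).

Record C2_derivatives U u (u1 u2 : 'I_n -> 'rV[R]_n -> R) : Prop := C2Derivatives {
  C2_continuous : forall z, U z -> {for z, continuous u};
  C2_derive1 : forall i z, U z -> is_derive z (delta_mx 0 i) u (u1 i z);
  C2_derive2 : forall i z, U z -> is_derive z (delta_mx 0 i) (u1 i) (u2 i z);
  C2_continuous1 : forall i z, U z -> {for z, continuous (u1 i)};
  C2_continuous2 : forall i z, U z -> {for z, continuous (u2 i)}
}.

Lemma is_derive1_cst (c t : R) : is_derive t 1 (fun=> c) 0.
Proof. exact: is_derive_cst. Qed.

Lemma is_derive_of_line F z v l : is_derive (0 : R) 1 (fun s => F (z + s *: v)) l ->
  is_derive z v F l.
Proof.
have E : (fun h : R => h^-1 *: ((F \o shift z) (h *: v) - F z)) =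
    (fun h : R => h^-1 *: (((fun s => F (z + s *: v)) \o shift 0) (h *: (1 : R)) - F (z + 0 *: v))).
  apply/funext => h /=; rewrite scale0r !addr0; congr (_ *: (F _ - _)).
  by rewrite [h *: 1]mulr1 addrC.
move=> [dF lE]; split; last by rewrite -lE /derive E.
by move: dF; rewrite /derivable E.
Qed.

Lemma sqdist_line x z i t : sqdist x (z + t *: delta_mx 0 i) =
  sqdist x z + 2 * (z 0 i - x 0 i) * t + t ^+ 2.
Proof.
rewrite /sqdist (bigD1 i) // [in RHS](bigD1 i) //= !mxE !eqxx /= mulr1.
rewrite (eq_bigr (fun l => (z 0 l - x 0 l) ^+ 2)); first by ring.
by move=> l li; rewrite !mxE (negbTE li) andbF mulr0 addr0.
Qed.

Lemma is_derive_coord x z i : is_derive z (delta_mx 0 i) (fun y => y 0 i - x 0 i) 1.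
Proof.
apply: is_derive_of_line.
rewrite (_ : (fun s => _) = fun s => s + (z 0 i - x 0 i)).
  by apply: is_derive_eq (is_derive1D (is_derive1_id 0) (is_derive1_cst _ _)) _; rewrite addr0.
by apply/funext => s; rewrite !mxE !eqxx /= mulr1; ring.
Qed.

Lemma is_derive_radial x z i (h h1 : R -> R) c : (forall t, is_derive t 1 h (h1 t)) ->
  is_derive z (delta_mx 0 i) (fun y => h (sqdist x y * c))
    (h1 (sqdist x z * c) * (2 * (z 0 i - x 0 i) * c)).
Proof.
move=> dh; apply: is_derive_of_line.
rewrite (_ : (fun s => _) = fun s => h ((sqdist x z + 2 * (z 0 i - x 0 i) * s + s ^+ 2) * c)).
  have dq : is_derive (0 : R) 1 (fun s => (sqdist x z + 2 * (z 0 i - x 0 i) * s + s ^+ 2) * c)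
      (2 * (z 0 i - x 0 i) * c).
    have := is_derive1Z c (is_derive1D (is_derive1D (is_derive1_cst (sqdist x z) 0)
       (is_derive1Z (2 * (z 0 i - x 0 i)) (is_derive1_id 0))) (is_derive1_exprn 0 2)).
    rewrite (_ : (fun t => c * _) = (fun s => (sqdist x z + 2 * (z 0 i - x 0 i) * s + s ^+ 2) * c)).
      by move=> d; apply: is_derive_eq d _; rewrite /=; ring.
    by apply/funext => s; rewrite mulrC.
  apply: (is_derive1_chain (f := h)) dq.
  by rewrite mulr0 addr0 expr0n addr0; exact: dh.
by apply/funext => s; rewrite sqdist_line.
Qed.

Lemma is_derive_mul F F' z v (l l' : R) : is_derive z v F l -> is_derive z v F' l' ->
  is_derive z v (fun y => F y * F' y) (l * F' z + F z * l').
Proof.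
move=> dF dF'; apply: is_derive_eq (is_deriveM dF dF') _.
by rewrite addrC -![_ *: _]/(_ * _) [F' z * _]mulrC.
Qed.

Lemma is_derive_lin F F' z v (c l l' : R) : is_derive z v F l -> is_derive z v F' l' ->
  is_derive z v (fun y => c * F y + F' y) (c * l + l').
Proof. by move=> dF dF'; exact: (is_deriveD (is_deriveZ c dF) dF'). Qed.

Lemma continuous_forD F F' z : {for z, continuous F} -> {for z, continuous F'} ->
  {for z, continuous (fun y => F y + F' y)}.
Proof. by move=> cF cF'; exact: (continuousD cF cF'). Qed.

Lemma continuous_forM F F' z : {for z, continuous F} -> {for z, continuous F'} ->
  {for z, continuous (fun y => F y * F' y)}.
Proof. by move=> cF cF'; exact: (continuousM cF cF'). Qed.

Lemma continuous_for_cst (c : R) z : {for z, continuous (fun _ : 'rV[R]_n => c)}.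
Proof. exact: cst_continuous. Qed.

Lemma continuous_for_coord x i z : {for z, continuous (fun y : 'rV[R]_n => y 0 i - x 0 i)}.
Proof.
apply: continuous_forD; last exact: continuous_for_cst.
exact: coord_continuous.
Qed.

Lemma continuous_for_sum (J : Type) (r : seq J) (F : J -> 'rV[R]_n -> R) z :
  (forall i, {for z, continuous (F i)}) -> {for z, continuous (fun y => \sum_(i <- r) F i y)}.
Proof.
move=> cF; elim: r => [|i r IH].
  rewrite (_ : (fun y => _) = fun=> 0); first exact: continuous_for_cst.
  by apply/funext => y; rewrite big_nil.
rewrite (_ : (fun y => _) = fun y => F i y + \sum_(i <- r) F i y).
  exact: continuous_forD.
by apply/funext => y; rewrite big_cons.
Qed.

Lemma sqdist_continuous x : continuous (sqdist x).
Proof.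
have -> : sqdist x = fun y => \sum_(i <- index_enum 'I_n) (y 0 i - x 0 i) * (y 0 i - x 0 i).
  by apply/funext.
move=> z; apply: (@continuous_for_sum _ _ (fun i y => (y 0 i - x 0 i) * (y 0 i - x 0 i))) => i.
have c := @continuous_for_coord x i z.
exact: (continuous_forM c c).
Qed.

Lemma is_derive1_continuous (h : R -> R) t l : is_derive t 1 h l -> {for t, continuous h}.
Proof. by move=> [dh _]; apply: differentiable_continuous; exact/derivable1_diffP. Qed.

Definition shell_in U x (s1 s2 : R) :=
  forall z, s1 ^+ 2 <= sqdist x z -> sqdist x z <= (2 * s2) ^+ 2 -> U z.

Lemma bounded_on_shell_exists U u x s1 s2 : 0 <= s2 -> shell_in U x s1 s2 ->
  (forall z, U z -> {for z, continuous u}) -> exists2 B, 0 <= B & bounded_on_shell u x s1 s2 B.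
Proof.
move=> s2_ge0 sU cu.
pose K := [set z | s1 ^+ 2 <= sqdist x z <= (2 * s2) ^+ 2].
have cK : compact K.
  apply: bounded_closed_compact.
    exists (`|x| + 2 * s2); split; first exact: num_real.
    move=> M xM z /andP[_ z2]; apply: ltW; apply: le_lt_trans xM.
    have : `|z - x| <= 2 * s2 by rewrite norm_le_sqdist // mulr_ge0.
    by have := ler_normD (z - x) x; rewrite subrK; lra.
  apply: (@closed_comp _ _ (sqdist x) `[s1 ^+ 2, (2 * s2) ^+ 2]%classic).
    by move=> z _; exact: sqdist_continuous.
  exact: interval_closed.
have cuK : {within K, continuous u}.
  apply: continuous_in_subspaceT => z; rewrite inE => /andP[z1 z2].
  by apply: cu; exact: sU.
have [M [_ uM]] := compact_bounded (continuous_compact cuK cK).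
exists `|M + 1| => // z z1 z2.
apply: le_trans (ler_norm _); apply: (uM (M + 1)); first by rewrite ltrDl.
by exists z => //; rewrite /K /= z1.
Qed.

(** Outside [U] the functions take arbitrary values. [U] contains the closed shell, so near such a
    point the weight vanishes identically and the products are smooth on the whole space. *)
Lemma near_outside_shell U x s z : 0 < s -> shell_in U x s s -> ~ U z ->
  \forall y \near z, sqdist x y * s^-1 ^+ 2 <= 1 \/ 4 <= sqdist x y * s^-1 ^+ 2.
Proof.
move=> s_gt0 sU Uz; have s2_gt0 : 0 < s ^+ 2 by rewrite exprn_gt0.
have [z1|z1] := ltP (sqdist x z) (s ^+ 2).
  have near1 : \forall y \near z, sqdist x y < s ^+ 2.
    exact: (@cvgr_lt _ _ _ (@nbhs_filter _ z) _ _ (@sqdist_continuous x z) _ z1).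
  apply: (@filterS _ _ (@nbhs_filter _ z) _ _ _ near1) => y y1; left.
  by rewrite exprVn ler_pdivrMr // mul1r ltW.
have [z2|z2] := ltP ((2 * s) ^+ 2) (sqdist x z); last by case: Uz; exact: sU.
have near2 : \forall y \near z, (2 * s) ^+ 2 < sqdist x y.
  exact: (@cvgr_gt _ _ _ (@nbhs_filter _ z) _ _ (@sqdist_continuous x z) _ z2).
apply: (@filterS _ _ (@nbhs_filter _ z) _ _ _ near2) => y y1; right.
rewrite exprVn ler_pdivlMr //; apply: ltW; apply: le_lt_trans y1.
by rewrite exprMn (_ : 2 ^+ 2 = 4) //; ring.
Qed.

Lemma shell_product_continuous U x s w (h : R -> R) : 0 < s -> shell_in U x s s ->
  (forall z, U z -> {for z, continuous w}) -> continuous h ->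
  (forall t, t <= 1 -> h t = 0) -> (forall t, 4 <= t -> h t = 0) ->
  continuous (fun z => w z * h (sqdist x z * s^-1 ^+ 2)).
Proof.
move=> s_gt0 sU cw ch lo hi z.
have [Uz|Uz] := pselect (U z).
  apply: (@continuous_forM w (fun z => h (sqdist x z * s^-1 ^+ 2))); first exact: cw.
  apply: (@continuous_comp _ _ _ (fun z => sqdist x z * s^-1 ^+ 2) h); last exact: ch.
  exact: continuous_forM (@sqdist_continuous x z) (@continuous_for_cst _ _).
have out := near_outside_shell s_gt0 sU Uz.
have zero y : sqdist x y * s^-1 ^+ 2 <= 1 \/ 4 <= sqdist x y * s^-1 ^+ 2 ->
    w y * h (sqdist x y * s^-1 ^+ 2) = 0.
  by case=> ?; [rewrite lo // mulr0|rewrite hi // mulr0].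
have z0 := zero z (nbhs_singleton out).
apply/(@cvgrPdist_lt _ _ _ _ (@nbhs_filter _ z)) => e e_gt0.
apply: (@filterS _ _ (@nbhs_filter _ z) _ _ _ out) => y /zero yE.
by rewrite z0 yE subrr normr0.
Qed.

Lemma shell_zero_near U x s z : 0 < s -> shell_in U x s s -> ~ U z -> forall F,
  (forall y, sqdist x y * s^-1 ^+ 2 <= 1 \/ 4 <= sqdist x y * s^-1 ^+ 2 -> F y = 0) ->
  forall v, is_derive z v F 0.
Proof.
move=> s_gt0 sU Uz F F0 v; have out := near_outside_shell s_gt0 sU Uz.
have d0 : is_derive z v (fun _ : 'rV[R]_n => 0 : R) 0 by exact: is_derive_cst.
apply: near_eq_is_derive d0.
by apply: (@filterS _ _ (@nbhs_filter _ z) _ _ _ out) => y /F0.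
Qed.

(** Both integrations by parts at once: [G] is u1 times the weight minus u times the derivative of
    the weight. In its derivative [H] the terms containing u1 cancel, and [I H = 0]. *)
Lemma green_coord U u (u1 u2 : 'I_n -> 'rV[R]_n -> R) g x s i : C2_derivatives U u u1 u2 -> profile 3 g ->
  0 < s -> shell_in U x s s ->
  I (fun z => u2 i z * g 0%N (sqdist x z * s^-1 ^+ 2)) =
    2 * s^-1 ^+ 2 * I (fun z => u z * g 1%N (sqdist x z * s^-1 ^+ 2)) +
    4 * s^-1 ^+ 4 * I (fun z => (u z * (z 0 i - x 0 i) ^+ 2) * g 2%N (sqdist x z * s^-1 ^+ 2)).
Proof.
move=> [cu du du1 cu1 cu2] pg s_gt0 sU; have [dg lo hi [C C_ge0 gC]] := pg.
have s_ge0 := ltW s_gt0.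
pose d z : R := z 0 i - x 0 i.
have cd z : U z -> {for z, continuous d} by move=> _; exact: continuous_for_coord.
have cud z : U z -> {for z, continuous (fun z => u z * d z)}.
  by move=> Uz; apply: continuous_forM; [exact: cu|exact: cd].
have cudd z : U z -> {for z, continuous (fun z => u z * d z ^+ 2)}.
  move=> Uz; rewrite (_ : (fun z => u z * d z ^+ 2) = fun z => u z * d z * d z).
    by apply: continuous_forM; [exact: cud|exact: cd].
  by apply/funext => y; ring.
have bs (w : 'rV[R]_n -> R) l : (l <= 3)%N -> (forall z, U z -> {for z, continuous w}) ->
    bounded_support (fun z => w z * g l (sqdist x z * s^-1 ^+ 2)).
  move=> l3 cw; have [B B_ge0 wB] := bounded_on_shell_exists s_ge0 sU cw.
  apply: (@shell_integrand_bounded_support _ _ w x s s B (g l) C s) => // t.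
  - by move=> t1; exact: lo.
  - by move=> t1; exact: hi.
  - exact: gC.
have ct (w : 'rV[R]_n -> R) l : (l < 3)%N -> (forall z, U z -> {for z, continuous w}) ->
    continuous (fun z => w z * g l (sqdist x z * s^-1 ^+ 2)).
  move=> l3 cw; apply: (shell_product_continuous s_gt0 sU cw) => t.
  - exact: is_derive1_continuous (dg l t l3).
  - by move=> t1; rewrite lo // ltnW.
  - by move=> t1; rewrite hi // ltnW.
pose c : R := 2 * s^-1 ^+ 2; pose c' : R := 4 * s^-1 ^+ 4.
pose G z := - c * ((u z * d z) * g 1%N (sqdist x z * s^-1 ^+ 2)) +
  u1 i z * g 0%N (sqdist x z * s^-1 ^+ 2).
pose H z := - c' * ((u z * d z ^+ 2) * g 2%N (sqdist x z * s^-1 ^+ 2)) +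
  (- c * (u z * g 1%N (sqdist x z * s^-1 ^+ 2)) + u2 i z * g 0%N (sqdist x z * s^-1 ^+ 2)).
have dG z : is_derive z (delta_mx 0 i) G (H z).
  have [Uz|Uz] := pselect (U z).
    have dr l : (l < 3)%N -> is_derive z (delta_mx 0 i) (fun y => g l (sqdist x y * s^-1 ^+ 2))
       (g l.+1 (sqdist x z * s^-1 ^+ 2) * (2 * (z 0 i - x 0 i) * s^-1 ^+ 2)).
      by move=> l3; apply: is_derive_radial => t; exact: dg.
    have dud := is_derive_mul (du i z Uz) (is_derive_coord x z i).
    have := is_derive_lin (- c) (is_derive_mul dud (dr 1%N isT)) (is_derive_mul (du1 i z Uz) (dr 0%N isT)).
    move=> h; apply: is_derive_eq h _; rewrite /H /c /c' /d /=.
    by ring.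
  have -> : H z = 0.
    have := near_outside_shell s_gt0 sU Uz; move/nbhs_singleton.
    by rewrite /H; case=> t1; [rewrite !lo //|rewrite !hi //]; rewrite !mulr0 !addr0.
  apply: (shell_zero_near s_gt0 sU Uz) => y.
  by rewrite /G; case=> t1; [rewrite !lo //|rewrite !hi //]; rewrite !mulr0 !addr0.
have b0 := bs (u2 i) 0%N isT (cu2 i); have b1 := bs u 1%N isT cu.
have b2 := bs _ 2%N isT cudd.
have b01 := bounded_support_lin (- c) b1 b0.
have IH0 : I H = 0.
  apply: (integral_derivative I_int dG).
  - move=> z; apply: (@continuous_forD (fun z => - c' * ((u z * d z ^+ 2) * g 2%N (sqdist x z * s^-1 ^+ 2)))).
      by apply: continuous_forM; [exact: continuous_for_cst|exact: (ct _ 2%N isT cudd)].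
    apply: continuous_forD; last exact: (ct _ 0%N isT (cu2 i)).
    by apply: continuous_forM; [exact: continuous_for_cst|exact: (ct _ 1%N isT cu)].
  - apply: bounded_support_lin; first exact: (bs _ 1%N isT cud).
    exact: (bs _ 0%N isT (cu1 i)).
  - exact: bounded_support_lin.
move: IH0; rewrite /H (integral_linear I_int _ b2 b01) (integral_linear I_int _ b1 b0).
rewrite -/c -/c' /d.
move: (I _) (I _) (I _) => A B D ABD.
by move/eqP: ABD; rewrite !mulNr addrA -opprD addrC subr_eq0 => /eqP ->; rewrite addrC.
Qed.

(** The right-hand weight, with its factor s^(-2), is the Laplacian in z of g(|z - x|^2 / s^2). *)
Lemma green_radial U u (u1 u2 : 'I_n -> 'rV[R]_n -> R) g x s : C2_derivatives U u u1 u2 -> profile 3 g ->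
  0 < s -> shell_in U x s s ->
  I (fun z => (\sum_(i < n) u2 i z) * g 0%N (sqdist x z * s^-1 ^+ 2)) =
    s^-1 ^+ 2 * I (fun z => u z * (2 * n%:R * g 1%N (sqdist x z * s^-1 ^+ 2) +
      4 * (sqdist x z * s^-1 ^+ 2) * g 2%N (sqdist x z * s^-1 ^+ 2))).
Proof.
move=> C2u pg s_gt0 sU; have [dg lo hi [C C_ge0 gC]] := pg; have [cu _ _ _ cu2] := C2u.
have s_ge0 := ltW s_gt0.
have bs (w : 'rV[R]_n -> R) l : (l <= 3)%N -> (forall z, U z -> {for z, continuous w}) ->
    bounded_support (fun z => w z * g l (sqdist x z * s^-1 ^+ 2)).
  move=> l3 cw; have [B B_ge0 wB] := bounded_on_shell_exists s_ge0 sU cw.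
  apply: (@shell_integrand_bounded_support _ _ w x s s B (g l) C s) => // t.
  - by move=> t1; exact: lo.
  - by move=> t1; exact: hi.
  - exact: gC.
have cuc i z : U z -> {for z, continuous (fun z => u z * (z 0 i - x 0 i) ^+ 2)}.
  move=> Uz; rewrite (_ : (fun z => _) = fun z => u z * (z 0 i - x 0 i) * (z 0 i - x 0 i)).
    apply: continuous_forM; last exact: continuous_for_coord.
    by apply: continuous_forM; [exact: cu|exact: continuous_for_coord].
  by apply/funext => y; ring.
have b0 i := bs (u2 i) 0%N isT (cu2 i); have b1 := bs u 1%N isT cu.
have b2 i := bs _ 2%N isT (cuc i).
transitivity (\sum_(i < n) I (fun z => u2 i z * g 0%N (sqdist x z * s^-1 ^+ 2))).
  rewrite -(integral_sum I_int) //; congr I; apply/funext => z; by rewrite mulr_suml.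
rewrite (eq_bigr _ (fun i _ => green_coord i C2u pg s_gt0 sU)).
rewrite big_split /= sumr_const card_ord -mulr_sumr -(integral_sum I_int) //.
have -> : (fun z => u z * (2 * n%:R * g 1%N (sqdist x z * s^-1 ^+ 2) +
      4 * (sqdist x z * s^-1 ^+ 2) * g 2%N (sqdist x z * s^-1 ^+ 2))) =
   (fun z => (2 * n%:R) * (u z * g 1%N (sqdist x z * s^-1 ^+ 2)) +
     (4 * s^-1 ^+ 2) * \sum_(i < n) (u z * (z 0 i - x 0 i) ^+ 2) * g 2%N (sqdist x z * s^-1 ^+ 2)).
  by apply/funext => z; rewrite -mulr_suml -mulr_sumr -/(sqdist x z); ring.
have b2s := @bounded_support_sum _ _ _ (index_enum 'I_n) _ b2.
rewrite (integral_linear I_int _ b1 (bounded_supportZ _ b2s)) (integralZ I_int) //.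
by rewrite -mulr_natr; ring.
Qed.

End Green.

(** * The radial equations of the averages *)

Section RadialAverages.
Variables (R : realType) (j : nat).
Local Notation n := (j.+3).
Variable I : ('rV[R]_n -> R) -> R.
Hypothesis I_int : integral_functional I.
Implicit Types (x y z : 'rV[R]_n) (s t : R) (u w F : 'rV[R]_n -> R) (g : nat -> R -> R)
  (U : set 'rV[R]_n).
Local Notation avg := (shell_average I).

Lemma profile_integrand_bounded_support N g i u x (s1 s2 B s : R) : profile N g -> (i <= N)%N ->
  0 < s1 -> s1 <= s -> s <= s2 -> bounded_on_shell u x s1 s2 B -> 0 <= B ->
  bounded_support (fun z => u z * g i (sqdist x z * s^-1 ^+ 2)).
Proof.
move=> [_ lo hi [C C_ge0 gC]] iN s1_gt0 s1s ss2 uB B_ge0.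
apply: (@shell_integrand_bounded_support _ _ u x s1 s2 B (g i) C s) => // t.
- by move=> t1; exact: lo.
- by move=> t1; exact: hi.
- exact: gC.
Qed.

Lemma continuous_integrand_bounded_support N g U u x s : profile N g -> 0 < s ->
  shell_in U x s s -> (forall z, U z -> {for z, continuous u}) ->
  bounded_support (fun z => u z * g 0%N (sqdist x z * s^-1 ^+ 2)).
Proof.
move=> pg s_gt0 sU cu; have [B B_ge0 uB] := bounded_on_shell_exists (ltW s_gt0) sU cu.
exact: (profile_integrand_bounded_support pg (leq0n N) s_gt0 (lexx s) (lexx s) uB B_ge0).
Qed.

Lemma shell_average_ge0 N g U u x s a : profile N g -> 0 < s -> shell_in U x s s ->
  (forall z, U z -> {for z, continuous u}) -> (forall t, 1 <= t -> 0 <= g 0%N t) ->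
  (forall z, U z -> 0 <= u z) -> 0 <= avg a g u x s.
Proof.
move=> pg s_gt0 sU cu g_ge0 u_ge0; have [_ lo hi _] := pg.
apply: mulr_ge0; first by rewrite exprn_ge0 // invr_ge0 ltW.
rewrite -[leLHS](integral0 I_int); apply: (integral_le I_int) => [||z].
- exact: bounded_support_zero.
- exact: continuous_integrand_bounded_support pg s_gt0 sU cu.
have [t1|t1] := leP (sqdist x z * s^-1 ^+ 2) 1; first by rewrite lo // mulr0.
have [t4|t4] := leP 4 (sqdist x z * s^-1 ^+ 2); first by rewrite hi // mulr0.
apply: mulr_ge0; last by apply: g_ge0; exact: ltW.
have s2_gt0 : 0 < s ^+ 2 by rewrite exprn_gt0.
move: t1 t4; rewrite exprVn ltr_pdivlMr // ltr_pdivrMr // mul1r => t1 t4.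
apply: u_ge0; apply: sU; first exact: ltW.
by rewrite exprMn (_ : 2 ^+ 2 = 4); [exact: ltW|ring].
Qed.

Lemma shell_average_le0 N g U u x s a : profile N g -> 0 < s -> shell_in U x s s ->
  (forall z, U z -> {for z, continuous u}) -> (forall t, 1 <= t -> 0 <= g 0%N t) ->
  (forall z, U z -> u z <= 0) -> avg a g u x s <= 0.
Proof.
move=> pg s_gt0 sU cu g_ge0 u_le0; rewrite -oppr_ge0.
have bu := continuous_integrand_bounded_support pg s_gt0 sU cu.
have -> : - avg a g u x s = avg a g (fun z => -1 * u z) x s.
  rewrite /shell_average -mulrN -mulN1r -(integralZ I_int (-1) bu).
  by congr (_ * I _); apply/funext => z; rewrite mulrA.
apply: shell_average_ge0 pg s_gt0 sU _ g_ge0 _ => z Uz.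
  by apply: continuous_forM; [exact: continuous_for_cst|exact: cu].
by rewrite mulN1r oppr_ge0 u_le0.
Qed.

(** No change of variables is among the properties of [I]. After integration by parts both sides
    carry u itself, and the equation becomes an identity between weights in t = q / s^2. *)
Lemma shell_average_radial U u (u1 u2 : 'I_n -> 'rV[R]_n -> R) g x s1 s2 s :
  C2_derivatives U u u1 u2 -> profile 3 g ->
  0 < s1 -> s1 < s -> s < s2 -> shell_in U x s1 s2 ->
  radial_laplacian_at j (avg n g u x) (avg n.+1 (dilation_profile n%:R g) u x)
    (avg n (mul_id_profile g) (fun z => \sum_(i < n) u2 i z) x) s.
Proof.
move=> C2u pg s1_gt0 s1s ss2 sU; have [cu _ _ _ _] := C2u.
have s_gt0 : 0 < s by lra.
have s2_ge0 : 0 <= s2 by lra.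
have [B B_ge0 uB] := bounded_on_shell_exists s2_ge0 sU cu.
have pd := profile_dilation n%:R pg.
split.
  exact: (shell_average_derive I_int n (profile_widen (isT : (2 <= 3)%N) pg) s1_gt0 s1s ss2 uB B_ge0).
have := shell_average_derive I_int n.+1 pd s1_gt0 s1s ss2 uB B_ge0.
move=> h; apply: is_derive_eq h _.
have sUs : shell_in U x s s.
  move=> z z1 z2; apply: sU; first by apply: le_trans z1; rewrite lerXn2r ?nnegrE; lra.
  by apply: le_trans z2 _; rewrite lerXn2r ?nnegrE; lra.
rewrite /shell_average (green_radial I_int C2u (profile_mul_id pg) s_gt0 sUs).
have pdd := profile_dilation n.+1%:R pd.
have bs N g' : profile N g' -> bounded_support (fun z => u z * g' 0%N (sqdist x z * s^-1 ^+ 2)).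
  by move=> pg'; apply: (profile_integrand_bounded_support pg' _ s1_gt0 _ _ uB) => //; exact: ltW.
have b1 := bs _ _ pd; have b2 := bs _ _ pdd.
have -> : (fun z => u z * (2 * n%:R * mul_id_profile g 1 (sqdist x z * s^-1 ^+ 2) +
     4 * (sqdist x z * s^-1 ^+ 2) * mul_id_profile g 2 (sqdist x z * s^-1 ^+ 2))) =
   (fun z => j.+2%:R * (u z * dilation_profile n%:R g 0 (sqdist x z * s^-1 ^+ 2)) +
     u z * dilation_profile n.+1%:R (dilation_profile n%:R g) 0 (sqdist x z * s^-1 ^+ 2)).
  apply/funext => z; move: (sqdist x z * _) => t.
  by rewrite /mul_id_profile /dilation_profile /= -[n.+1%:R]natr1 -[n%:R]natr1; ring.
rewrite (integral_linear I_int _ b1 b2).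
move: (I _) (I _) => A A'.
by rewrite !exprS; ring.
Qed.

End RadialAverages.

(** * Pointwise upper bound by averages *)

Section SupEstimate.
Variables (R : realType) (j : nat).
Local Notation n := (j.+3).
Variable I : ('rV[R]_n -> R) -> R.
Hypothesis I_int : integral_functional I.
Implicit Types (x y z : 'rV[R]_n) (s t r : R) (u v w F : 'rV[R]_n -> R) (g : nat -> R -> R)
  (U : set 'rV[R]_n).
Local Notation avg := (shell_average I).
Local Notation bump := (@bump R).

(** Young's inequality with parameter 1/4, coordinate by coordinate; a triangle inequality for
    squared distances that avoids square roots. *)
Lemma sqdist_le_perturb x y z : sqdist x z <= 5 / 4 * sqdist x y + 5 * sqdist y z.
Proof.
rewrite /sqdist !mulr_sumr -big_split /=; apply: ler_sum => i _.
move: (z 0 i) (x 0 i) (y 0 i) => a b c; rewrite -subr_ge0.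
have -> : 5 / 4 * (c - b) ^+ 2 + 5 * (a - c) ^+ 2 - (a - b) ^+ 2 =
  ((c - b) / 2 - 2 * (a - c)) ^+ 2 by field.
exact: sqr_ge0.
Qed.

Lemma sqdist_ge_perturb x y z : 3 / 4 * sqdist x y - 3 * sqdist y z <= sqdist x z.
Proof.
rewrite /sqdist !mulr_sumr -sumrB; apply: ler_sum => i _.
move: (z 0 i) (x 0 i) (y 0 i) => a b c; rewrite -subr_ge0.
have -> : (a - b) ^+ 2 - (3 / 4 * (c - b) ^+ 2 - 3 * (a - c) ^+ 2) =
  ((c - b) / 2 + 2 * (a - c)) ^+ 2 by field.
exact: sqr_ge0.
Qed.

Lemma sqdist_le_norm x z r : 0 <= r -> `|z - x| <= r -> sqdist x z <= n%:R * r ^+ 2.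
Proof.
move=> r_ge0; rewrite le_rV_norm // => /forallP zr.
have -> : n%:R * r ^+ 2 = \sum_(i < n) r ^+ 2 by rewrite sumr_const card_ord mulr_natl.
apply: ler_sum => i _; have := zr i; rewrite !mxE => zi.
by rewrite -real_normK ?num_real // lerXn2r ?nnegrE.
Qed.

Lemma bounded_on_shell_subset u x r s B : bounded_on_shell u x 0 r B -> 0 < s -> s <= r ->
  bounded_on_shell u x s s B.
Proof.
move=> uB s_gt0 sr z z1 z2; apply: uB; first by rewrite expr0n sqdist_ge0.
by apply: le_trans z2 _; rewrite lerXn2r ?nnegrE; lra.
Qed.

Lemma bounded_on_shell_one x (s1 s2 : R) : bounded_on_shell (fun=> 1) x s1 s2 1.
Proof. by move=> z _ _; rewrite normr1. Qed.

Lemma bump_integrand_bounded_support u x s B : 0 < s -> bounded_on_shell u x s s B -> 0 <= B ->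
  bounded_support (fun z => u z * bump 0 (sqdist x z * s^-1 ^+ 2)).
Proof.
move=> s_gt0 uB B_ge0.
exact: (profile_integrand_bounded_support (@profile_bump R) (isT : (0 <= 3)%N) s_gt0 (lexx s) (lexx s) uB B_ge0).
Qed.

Lemma bump_mass_le x s : 0 < s -> avg n bump (fun=> 1) x s <= 3 ^+ 4 * 6 ^+ n.
Proof.
move=> s_gt0; rewrite /shell_average exprVn ler_pdivrMl ?exprn_gt0 //.
have -> : s ^+ n * (3 ^+ 4 * 6 ^+ n) = 1 * 3 ^+ 4 * (3 * (2 * s)) ^+ n.
  by rewrite (_ : 3 * (2 * s) = 6 * s) ?exprMn; [ring|ring].
apply: le_trans (ler_norm _) _.
have p3 : 0 <= 3 ^+ 4 :> R by exact: exprn_ge0.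
apply: (@integral_abs_le _ _ I I_int _ x) => [||z]; first by rewrite mul1r.
  by lra.
have [_ lo hi _] := @profile_bump R.
apply: (@shell_integrand_le _ _ _ x s s 1 (bump 0) (3 ^+ 4) s z) => // [|t t1|t t1|t].
- exact: bounded_on_shell_one.
- exact: lo.
- exact: hi.
- by rewrite ger0_norm ?bump_ge0 // bump_le.
Qed.

(** A cube of half-side s / (4 n) centred at distance 3 s / 2 from x lies where t is between 3/2 and
    25/8, inside the window on which the bump is at least 1/16. *)
Lemma bump_mass_ge x s : 0 < s -> (4 * n%:R)^-1 ^+ n / 16 <= avg n bump (fun=> 1) x s.
Proof.
move=> s_gt0; pose a : R := s / (4 * n%:R); pose y := x + (3 / 2 * s) *: delta_mx 0 0.
have n_gt0 : 0 < n%:R :> R by rewrite ltr0n.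
have a_gt0 : 0 < a by rewrite divr_gt0 // mulr_gt0.
have xy : sqdist x y = 9 / 4 * s ^+ 2.
  by rewrite sqdist_line /sqdist big1 => [|i _]; rewrite ?subrr ?expr0n //; field.
have na : n%:R * a ^+ 2 <= s ^+ 2 / 16.
  have -> : n%:R * a ^+ 2 = s ^+ 2 / 16 / n%:R by rewrite /a; field; rewrite gt_eqF.
  by rewrite ler_pdivrMr // ler_peMr ?divr_ge0 ?exprn_ge0 ?(ltW s_gt0) // ler1n.
have s2_gt0 : 0 < s ^+ 2 by rewrite exprn_gt0.
have b1 : bounded_support (fun z => 1 * bump 0 (sqdist x z * s^-1 ^+ 2)).
  by apply: (@bump_integrand_bounded_support (fun=> 1) x s 1) => //; exact: bounded_on_shell_one.
rewrite /shell_average [s^-1 ^+ n]exprVn ler_pdivlMl ?exprn_gt0 //.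
have -> : s ^+ n * ((4 * n%:R)^-1 ^+ n / 16) = 1 / 16 * a ^+ n.
  by rewrite /a exprMn; ring.
apply: le_trans (_ : 1 / 16 * I (cube_indicator y a) <= _).
  by rewrite ler_wpM2l ?divr_ge0 // (integral_cube_ge I_int).
have bc := bounded_support_cube y a.
rewrite -(integralZ I_int) //; apply: (integral_le I_int) => // [|z]; first exact: bounded_supportZ.
rewrite [leRHS]mul1r /cube_indicator; have [za|_] := leP `|z - y| a; last by rewrite mulr0 bump_ge0.
rewrite mulr1 exprVn; have yz := sqdist_le_norm (ltW a_gt0) za.
have := sqdist_le_perturb x y z; have := sqdist_ge_perturb x y z; rewrite xy => h1 h2.
have {na yz} := le_trans yz na; move: (sqdist y z) (sqdist x z) (s ^+ 2) s2_gt0 h1 h2 => p q c c_gt0 h1 h2 h3.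
apply: bump_ge.
  by rewrite ler_pdivlMr //; lra.
by rewrite ler_pdivrMr //; lra.
Qed.

(** 128/3 is the largest ratio of the radii 2 r / 3 and s >= r / 64; 3^4 bounds the bump above and
    16 is the inverse of its lower bound on the window. *)
Definition comparison_constant : R := (128 / 3) ^+ n * (3 ^+ 4 * 16).

(** The support of the bump around x is in the ball of radius 2 s <= r / 4. Seen from the origin,
    its points have squared distance between 9/16 r^2 and 25/16 r^2, which is in the window of the
    bump of radius 2 r / 3. So one weight dominates the other pointwise. *)
Lemma average_comparison U v x r s Bx B0 : 0 < r -> sqdist 0 x = r ^+ 2 ->
  r / 64 <= s -> s <= r / 8 ->
  bounded_on_shell v x s s Bx -> 0 <= Bx -> bounded_on_shell v 0 (2 / 3 * r) (2 / 3 * r) B0 -> 0 <= B0 ->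
  shell_in U 0 (2 / 3 * r) (2 / 3 * r) -> (forall z, U z -> 0 <= v z) ->
  avg n bump v x s <= comparison_constant * avg n bump v 0 (2 / 3 * r).
Proof.
move=> r_gt0 xr rs sr vBx Bx_ge0 vB0 B0_ge0 U0 v_ge0.
have s_gt0 : 0 < s by lra.
set r' := 2 / 3 * r in vB0 U0 *; have r'_gt0 : 0 < r' by rewrite /r'; lra.
have bx := bump_integrand_bounded_support s_gt0 vBx Bx_ge0.
have b0 := bump_integrand_bounded_support r'_gt0 vB0 B0_ge0.
have i_ge0 : 0 <= r'^-1 ^+ n by rewrite exprn_ge0 // invr_ge0 ltW.
have k_ge0 : 0 <= comparison_constant by rewrite mulr_ge0 ?exprn_ge0 // mulr_ge0 ?exprn_ge0.
rewrite /shell_average mulrA -!(integralZ I_int) //.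
apply: (integral_le I_int) => [||z]; [exact: bounded_supportZ|exact: bounded_supportZ|].
have r2_gt0 : 0 < r ^+ 2 by rewrite exprn_gt0.
have r'2 : r' ^+ 2 = 4 / 9 * r ^+ 2 by rewrite /r'; field.
have r'2_gt0 : 0 < r' ^+ 2 by rewrite exprn_gt0.
have [_ lo hi _] := @profile_bump R.
have v0_ge0 : 0 <= v z * bump 0 (sqdist 0 z * r'^-1 ^+ 2).
  have [t1|t1] := leP (sqdist 0 z * r'^-1 ^+ 2) 1; first by rewrite lo // mulr0.
  have [t4|t4] := leP 4 (sqdist 0 z * r'^-1 ^+ 2); first by rewrite hi // mulr0.
  apply: mulr_ge0; last exact: bump_ge0.
  move: t1 t4; rewrite exprVn ltr_pdivlMr // ltr_pdivrMr // mul1r => t1 t4.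
  apply: v_ge0; apply: U0; first exact: ltW.
  by rewrite exprMn (_ : 2 ^+ 2 = 4); [exact: ltW|ring].
have rhs_ge0 : 0 <= comparison_constant * r'^-1 ^+ n * (v z * bump 0 (sqdist 0 z * r'^-1 ^+ 2)).
  by apply: mulr_ge0; first exact: mulr_ge0.
have [t4|t4] := leP 4 (sqdist x z * s^-1 ^+ 2); first by rewrite hi // !mulr0.
have s2_gt0 : 0 < s ^+ 2 by rewrite exprn_gt0.
have {}t4 : sqdist x z < 4 * s ^+ 2 by rewrite -ltr_pdivrMr // -exprVn.
have s2_le : s ^+ 2 <= r ^+ 2 / 64.
  have -> : r ^+ 2 / 64 = (r / 8) ^+ 2 by field.
  by rewrite lerXn2r ?nnegrE //; lra.
have h1 := sqdist_le_perturb 0 x z; have h2 := sqdist_ge_perturb 0 x z.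
have t_lo : 5 / 4 * r' ^+ 2 <= sqdist 0 z by rewrite r'2; move: h2; rewrite xr; lra.
have t_hi : sqdist 0 z <= 18 / 5 * r' ^+ 2 by rewrite r'2; move: h1; rewrite xr; lra.
have Uz : U z by apply: U0; rewrite ?exprMn; lra.
have b_ge : 1 / 16 <= bump 0 (sqdist 0 z * r'^-1 ^+ 2).
  by apply: bump_ge; rewrite exprVn; [rewrite ler_pdivlMr|rewrite ler_pdivrMr].
have vz := v_ge0 z Uz.
have s_le : s^-1 ^+ n <= (128 / 3) ^+ n * r'^-1 ^+ n.
  have -> : (128 / 3) ^+ n * r'^-1 ^+ n = (64 / r) ^+ n.
    by rewrite -exprMn; congr (_ ^+ _); rewrite /r'; field; rewrite gt_eqF.
  rewrite lerXn2r ?nnegrE ?invr_ge0 ?divr_ge0 ?(ltW s_gt0) ?(ltW r_gt0) //.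
  rewrite ler_pdivlMr // ler_pdivrMl //; lra.
have b_le : bump 0 (sqdist x z * s^-1 ^+ 2) <= 3 ^+ 4 * 16 * bump 0 (sqdist 0 z * r'^-1 ^+ 2).
  apply: le_trans (bump_le _) _; rewrite -mulrA ler_peMr ?exprn_ge0 //.
  by move: (bump 0 _) b_ge => b; lra.
have -> : comparison_constant * r'^-1 ^+ n * (v z * bump 0 (sqdist 0 z * r'^-1 ^+ 2)) =
  ((128 / 3) ^+ n * r'^-1 ^+ n) * (v z * (3 ^+ 4 * 16 * bump 0 (sqdist 0 z * r'^-1 ^+ 2))).
  by rewrite /comparison_constant; ring.
apply: ler_pM => //.
- by rewrite exprn_ge0 // invr_ge0 ltW.
- by rewrite mulr_ge0 ?bump_ge0.
- by apply: ler_wpM2l.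
Qed.

Record superbiharmonic_on U v (v1 v2 : 'I_n -> 'rV[R]_n -> R) w (w1 w2 : 'I_n -> 'rV[R]_n -> R) : Prop :=
  SuperbiharmonicOn {
  sb_C2 : C2_derivatives U v v1 v2;
  sb_laplacian : forall z, w z = \sum_(i < n) v2 i z;
  sb_C2_laplacian : C2_derivatives U w w1 w2;
  sb_sign : forall z, U z -> \sum_(i < n) w2 i z <= 0;
  sb_ge0 : forall z, U z -> 0 <= v z
}.

(** Provides the boundedness of t M1(t) and t N1(t) near the centre that [center_le] requires. *)
Lemma shell_average_flux_le N g u x r s B C : profile N g -> (forall t, `|g 0%N t| <= C) ->
  0 <= C -> bounded_on_shell u x 0 r B -> 0 <= B -> 0 < s -> s <= r ->
  `|s * avg n.+1 g u x s| <= B * C * 6 ^+ n.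
Proof.
move=> [_ lo hi _] gC C_ge0 uB B_ge0 s_gt0 sr.
have -> : s * avg n.+1 g u x s = s^-1 ^+ n * I (fun z => u z * g 0%N (sqdist x z * s^-1 ^+ 2)).
  by rewrite /shell_average exprS; move: (s^-1 ^+ n) (I _) => p q; field; rewrite gt_eqF.
rewrite normrM ger0_norm ?exprn_ge0 ?invr_ge0 ?(ltW s_gt0) //.
rewrite exprVn ler_pdivrMl ?exprn_gt0 //.
have -> : s ^+ n * (B * C * 6 ^+ n) = B * C * (3 * (2 * s)) ^+ n.
  by rewrite (_ : 3 * (2 * s) = 6 * s) ?exprMn; [ring|ring].
apply: (@integral_abs_le _ _ I I_int _ x) => [||z]; first exact: mulr_ge0.
  by lra.
have uBs : bounded_on_shell u x s s B by exact: bounded_on_shell_subset uB s_gt0 sr.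
apply: (@shell_integrand_le _ _ u x s s B (g 0%N) C s z) => // t.
  exact: lo.
exact: hi.
Qed.

(** 32 (4 n)^n is 2 divided by the lower bound (4 n)^(-n) / 16 of the mass of the bump; the 2 is
    spent on [v >= v x / 2] near x. *)
Definition sup_constant : R :=
  32 * (4 * n%:R) ^+ n * ((1 + 2 ^+ (j.+1 + 5)) * comparison_constant).

Lemma superbiharmonic_average_le U v (v1 v2 : 'I_n -> 'rV[R]_n -> R) w
    (w1 w2 : 'I_n -> 'rV[R]_n -> R) x r B0 s :
  superbiharmonic_on U v v1 v2 w w1 w2 ->
  0 < r -> sqdist 0 x = r ^+ 2 -> (forall z, sqdist x z <= (r / 4) ^+ 2 -> U z) ->
  shell_in U 0 (2 / 3 * r) (2 / 3 * r) -> bounded_on_shell v 0 (2 / 3 * r) (2 / 3 * r) B0 -> 0 <= B0 ->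
  0 < s -> s <= r / 32 -> avg n bump v x s <=
    (1 + 2 ^+ (j.+1 + 5)) * (comparison_constant * avg n bump v 0 (2 / 3 * r)).
Proof.
move=> [C2v wE C2w Lw_le0 v_ge0] r_gt0 xr Ux U0 vB0 B0_ge0 s_gt0 sa.
have [cv _ _ _ _] := C2v; have [cw _ _ _ cw2] := C2w.
(* With this choice the annulus [a, 2 a] of radii lies in the range [r / 64, r / 8] of
   [average_comparison], and the weights involved live in the ball of radius r / 4. *)
have [a [aE a_gt0]] : exists a, r = 32 * a /\ 0 < a.
  by exists (r / 32); split; [field|rewrite divr_gt0].
have r8E : r / 8 = 4 * a by rewrite aE; field.
have {}sa : s <= a by move: sa; rewrite aE mulrC mulKf // pnatr_eq0.
have shellU (s1 s2 : R) : 0 <= s2 -> s2 <= r / 8 -> shell_in U x s1 s2.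
  move=> s2_ge0 s2r z _ z2; apply: Ux; apply: le_trans z2 _.
  by clear -s2_ge0 s2r; rewrite lerXn2r ?nnegrE; lra.
rewrite r8E in shellU; have r8 : 0 <= 4 * a by lra.
have [Bv Bv_ge0 vB] := bounded_on_shell_exists r8 (shellU 0 (4 * a) r8 (lexx _)) cv.
have [Bw Bw_ge0 wB] := bounded_on_shell_exists r8 (shellU 0 (4 * a) r8 (lexx _)) cw.
have cLw z : U z -> {for z, continuous (fun z => \sum_(i < n) w2 i z)}.
  by move=> Uz; apply: (@continuous_for_sum _ _ _ _ w2) => i; exact: cw2.
have pb := @profile_bump R; have pm := profile_mul_id pb; have pmm := profile_mul_id pm.
have pdb := profile_dilation n%:R pb; have pdm := profile_dilation n%:R pm.
have [_ _ _ [C1 C1_ge0 g1C]] := pdb; have [_ _ _ [C2 C2_ge0 g2C]] := pdm.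
have shellt t : 0 < t -> t <= 2 * a -> shell_in U x t t.
  by move=> t_gt0 ta; apply: shellU; [exact: ltW|clear -t_gt0 ta; lra].
have radial u (u1 u2 : 'I_n -> 'rV[R]_n -> R) g t : C2_derivatives U u u1 u2 -> profile 3 g ->
    0 < t -> t <= 2 * a -> radial_laplacian_at j (avg n g u x) (avg n.+1 (dilation_profile n%:R g) u x)
    (avg n (mul_id_profile g) (fun z => \sum_(i < n) u2 i z) x) t.
  move=> C2u pg t_gt0 ta.
  apply: (@shell_average_radial R j I I_int U u u1 u2 g x (t / 2) (4 * a)) => //; clear -t_gt0 ta r8 shellU; try lra.
  exact: shellU.
set m := comparison_constant * _.
apply: (@center_le R j (avg n bump v x) (avg n.+1 (dilation_profile n%:R bump) v x)
  (avg n (mul_id_profile bump) w x) (avg n.+1 (dilation_profile n%:R (mul_id_profile bump)) w x)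
  (avg n (mul_id_profile (mul_id_profile bump)) (fun z => \sum_(i < n) w2 i z) x) a
  (Bv * C1 * 6 ^+ n + Bw * C2 * 6 ^+ n) m s) => // t t_gt0 ta.
- by rewrite (funext wE); exact: radial C2v pb t_gt0 ta.
- exact: radial C2w pm t_gt0 ta.
- apply: (shell_average_le0 I_int n pmm t_gt0 (shellt t t_gt0 ta) cLw) => // t' t'_ge1.
  have t'_ge0 : 0 <= t' by exact: le_trans t'_ge1.
  rewrite /mul_id_profile !mul0r !addr0; apply: mulr_ge0 => //.
  by apply: mulr_ge0 => //; exact: bump_ge0.
- apply: (shell_average_ge0 I_int n pb t_gt0 (shellt t t_gt0 ta) cv) => // t' _.
  exact: bump_ge0.
- have ta' : t <= 4 * a by clear -t_gt0 ta; lra.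
  have /le_trans := shell_average_flux_le pdb (fun t => g1C 0%N t isT) C1_ge0 vB Bv_ge0 t_gt0 ta'.
  by apply; rewrite lerDl; apply: mulr_ge0; [exact: mulr_ge0|exact: exprn_ge0].
- have ta' : t <= 4 * a by clear -t_gt0 ta; lra.
  have /le_trans := shell_average_flux_le pdm (fun t => g2C 0%N t isT) C2_ge0 wB Bw_ge0 t_gt0 ta'.
  by apply; rewrite lerDr; apply: mulr_ge0; [exact: mulr_ge0|exact: exprn_ge0].
- have t_gt0' : 0 < t by exact: lt_le_trans t_gt0.
  have ta' : t <= 4 * a by clear -t_gt0' ta; lra.
  apply: (@average_comparison U v x r t Bv B0) => //; last exact: bounded_on_shell_subset vB t_gt0' ta'.
    by clear -t_gt0 aE a_gt0; lra.
  by rewrite r8E.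
Qed.

(** The bound on averages around x is uniform in small radii. By continuity v exceeds v(x) / 2 on a
    small ball, so the average there is at least v(x) / 2 times the mass of the bump. *)
Lemma superbiharmonic_sup_le U v (v1 v2 : 'I_n -> 'rV[R]_n -> R) w (w1 w2 : 'I_n -> 'rV[R]_n -> R) x r B0 :
  superbiharmonic_on U v v1 v2 w w1 w2 ->
  0 < r -> sqdist 0 x = r ^+ 2 -> (forall z, sqdist x z <= (r / 4) ^+ 2 -> U z) ->
  shell_in U 0 (2 / 3 * r) (2 / 3 * r) -> bounded_on_shell v 0 (2 / 3 * r) (2 / 3 * r) B0 -> 0 <= B0 ->
  v x <= sup_constant * avg n bump v 0 (2 / 3 * r).
Proof.
move=> sb r_gt0 xr Ux U0 vB0 B0_ge0.
have [[cv _ _ _ _] _ _ _ v_ge0] := sb.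
pose a : R := r / 32; have a_gt0 : 0 < a by rewrite divr_gt0.
have r8 : 0 <= r / 8 by lra.
have ar : a <= r / 8 by rewrite /a; lra.
have shellU (s1 s2 : R) : 0 <= s2 -> s2 <= r / 8 -> shell_in U x s1 s2.
  move=> s2_ge0 s2r z _ z2; apply: Ux; apply: le_trans z2 _.
  by clear -s2_ge0 s2r; rewrite lerXn2r ?nnegrE; lra.
have [Bv Bv_ge0 vB] := bounded_on_shell_exists r8 (shellU 0 (r / 8) r8 (lexx _)) cv.
have pb := @profile_bump R.
have M_le s : 0 < s -> s <= a -> avg n bump v x s <= (1 + 2 ^+ (j.+1 + 5)) * (comparison_constant * avg n bump v 0 (2 / 3 * r)).
  by move=> s_gt0 sa; exact: (superbiharmonic_average_le sb r_gt0 xr Ux U0 vB0 B0_ge0 s_gt0 sa).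
set m := comparison_constant * _ in M_le.
clearbody a; clear sb.
have Uxx : U x by apply: Ux; rewrite /sqdist big1 ?sqr_ge0 // => i _; rewrite subrr expr0n.
have M_ge s : 0 < s -> s <= a -> (forall z, `|z - x| <= 2 * s -> v x / 2 <= v z) ->
    v x / 2 * avg n bump (fun=> 1) x s <= avg n bump v x s.
  move=> s_gt0 sa vz.
  have vBs := bounded_on_shell_subset vB s_gt0 (le_trans sa ar).
  have bs := bump_integrand_bounded_support s_gt0 vBs Bv_ge0.
  have b1 := bump_integrand_bounded_support s_gt0 (@bounded_on_shell_one x s s) ler01.
  rewrite /shell_average mulrCA ler_wpM2l ?exprn_ge0 ?invr_ge0 ?(ltW s_gt0) //.
  rewrite -(integralZ I_int) //; apply: (integral_le I_int) => // [|z]; first exact: bounded_supportZ.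
  have [_ lo hi _] := pb.
  have [t4|t4] := leP 4 (sqdist x z * s^-1 ^+ 2); first by rewrite hi // !mulr0.
  rewrite [1 * _]mul1r; apply: ler_wpM2r; first exact: bump_ge0.
  apply: vz; apply: norm_le_sqdist; first by lra.
  move: t4; rewrite exprVn ltr_pdivrMr ?exprn_gt0 // exprMn (_ : 2 ^+ 2 = 4); last by ring.
  exact: ltW.
have m_ge0 : 0 <= (1 + 2 ^+ (j.+1 + 5)) * m.
  apply: le_trans (M_le a a_gt0 (lexx a)).
  apply: (shell_average_ge0 I_int n pb a_gt0 (shellU a a (ltW a_gt0) ar) cv) => // t _.
  exact: bump_ge0.
have n4_gt0 : 0 < 4 * n%:R :> R by rewrite mulr_gt0 // ltr0n.
have -> : sup_constant * avg n bump v 0 (2 / 3 * r) =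
  32 * (4 * n%:R) ^+ n * ((1 + 2 ^+ (j.+1 + 5)) * m) by rewrite /sup_constant /m; ring.
have c_ge0 : 0 <= 32 * (4 * n%:R) ^+ n :> R.
  by apply: mulr_ge0 => //; apply: exprn_ge0; exact: ltW.
have [vx0|vx_gt0] := leP (v x) 0.
  by apply: le_trans vx0 _; exact: mulr_ge0.
have vx2 : v x / 2 < v x by rewrite ltr_pdivrMr // ltr_pMr // ltr1n.
have near_x : \forall z \near x, v x / 2 < v z.
  exact: (@cvgr_gt _ _ _ (@nbhs_filter _ x) _ _ (cv x Uxx) _ vx2).
have [d /= d_gt0 dv] := (proj1 (@nbhs_normP _ _ _ _)) near_x.
pose s := Num.min a (d / 4).
have s_gt0 : 0 < s by rewrite lt_min a_gt0 divr_gt0.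
have sa : s <= a by rewrite ge_min lexx.
have sd : s <= d / 4 by rewrite ge_min lexx orbT.
have := M_ge s s_gt0 sa; have := M_le s s_gt0 sa; have := bump_mass_ge x s_gt0.
move: (avg n bump v x s) (avg n bump (fun=> 1) x s) ((1 + _) * m) m_ge0 => A T m' m'_ge0 T_ge A_le A_ge.
have {}A_ge : v x / 2 * T <= m'.
  apply: le_trans A_le; apply: A_ge => z zx; apply: ltW; apply: dv => /=.
  by rewrite distrC; lra.
have e : 32 * (4 * n%:R) ^+ n * ((4 * n%:R)^-1 ^+ n / 16) = 2 :> R.
  have : (4 * n%:R) ^+ n != 0 :> R by rewrite expf_neq0 // gt_eqF.
  by rewrite [_^-1 ^+ n]exprVn; move: (_ ^+ n) => w' w'0; field.
apply: le_trans (_ : 32 * (4 * n%:R) ^+ n * (v x / 2 * T) <= _); last exact: ler_wpM2l.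
have vT : v x / 2 * ((4 * n%:R)^-1 ^+ n / 16) <= v x / 2 * T by rewrite ler_wpM2l // divr_ge0 // ltW.
apply: le_trans (ler_wpM2l c_ge0 vT).
by rewrite mulrCA e divfK.
Qed.

End SupEstimate.

(** * A convex minorant of the nonlinearity *)

Section Nonlinearity.
Variable R : realType.
Implicit Types (s t : R) (f : R -> R).

Lemma powR_tangent_le p x y : 1 < p -> 0 < x -> 0 < y ->
  (1 - p) * x `^ p + p * x `^ (p - 1) * y <= y `^ p :> R.
Proof.
move=> p_gt1 x_gt0 y_gt0.
have -> : (1 - p) * x `^ p + p * x `^ (p - 1) * y = x `^ p + p * x `^ (p - 1) * (y - x).
  have -> : x `^ p = x `^ (p - 1) * x.
    by rewrite -{3}(powRr1 (ltW x_gt0)) -powRD ?subrK // [x == 0]gt_eqF ?implybT.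
  by ring.
have mono s t : 0 < s -> s <= t -> p * s `^ (p - 1) <= p * t `^ (p - 1).
  move=> s_gt0 st; rewrite ler_pM2l; last by lra.
  by apply: ge0_ler_powR; rewrite ?nnegrE; lra.
have [xy|yx] := leP x y.
  have := @increment_ge _ (fun s => s `^ p) (fun s => p * s `^ (p - 1)) (p * x `^ (p - 1)) x y xy.
  move=> H; feed H; first by move=> s /andP[xs _]; apply: is_derive1_powR; lra.
  feed H; first by move=> s /andP[xs _]; exact: mono.
  by move: H; rewrite lerBrDl.
have := @increment_le _ (fun s => s `^ p) (fun s => p * s `^ (p - 1)) (p * x `^ (p - 1)) y x (ltW yx).
move=> H; feed H; first by move=> s /andP[xs _]; apply: is_derive1_powR; lra.
feed H; first by move=> s /andP[ys sx]; apply: mono => //; lra.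
move: H; rewrite -[y - x]opprB mulrN; move: (_ * (x - y)) (x `^ p) (y `^ p) => A B C.
by lra.
Qed.

Lemma powR_weight_le p s m : 0 < p -> 0 < s -> s <= m -> s `^ p * m `^ (- 1 - p) <= s^-1 :> R.
Proof.
move=> p_gt0 s_gt0 sm; have m_gt0 : 0 < m by lra.
have -> : s^-1 = s `^ p * s `^ (- 1 - p).
  rewrite -powRD; last by rewrite [s == 0]gt_eqF ?implybT.
  by rewrite (_ : p + (- 1 - p) = - 1) ?powR_inv1 // ?ltW //; ring.
rewrite ler_wpM2l ?powR_ge0 //.
have -> : - 1 - p = - (1 + p) by ring.
rewrite !powRN lef_pV2 ?posrE ?powR_gt0 //.
by apply: ge0_ler_powR; rewrite ?nnegrE; lra.
Qed.

(** Three ranges of s. Near 0 the liminf applies, with m^(-1-p) <= 1. Elsewhere the weight is at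
    most 1 / s: on a compact interval f has a positive minimum, and beyond it f(s) >= 1 / s. *)
Lemma nonlinearity_lower_bound f p : 0 < p ->
  {within `]0, +oo[%classic, continuous f} ->
  (forall s, 0 < s -> 0 < f s) ->
  (0 < limf_einf (fun s => (f s / s `^ p)%:E) 0^'+)%E ->
  f s / s^-1 @[s --> +oo] --> +oo ->
  exists2 c, 0 < c & forall s m, 0 < s -> s <= m -> 1 <= m ->
    c * (s `^ p * m `^ (- 1 - p)) <= f s.
Proof.
move=> p_gt0 f_cont f_pos f_0 f_oo.
have [d [e [d_gt0 e_gt0 f_small]]] : exists d, exists e, [/\ 0 < d, 0 < e &
    forall s, 0 < s -> s < d -> e * s `^ p <= f s].
  move: f_0; rewrite /limf_einf oppe_gt0 => /ereal_inf_lt[_ [A A0 <-]] supA.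
  (* [limf_einf] is defined through suprema of the negated function; a neighbourhood with negative
     supremum bounds f(s) / s^p below. If the supremum is -oo, any positive [e] will do. *)
  have [e e_gt0 supe] : exists2 e : R, 0 < e & (ereal_sup [set (\- (fun s => (f s / s `^ p)%:E))%E x | x in A] <= (- e)%:E)%E.
    move: supA; case: (ereal_sup _) => [r| |] //.
      by rewrite lte_fin => r_lt0; exists (- r); rewrite ?oppr_gt0 // opprK.
    by move=> _; exists 1 => //; rewrite leNye.
  have [d /= d_gt0 dA] := A0.
  exists d, e; split=> // s s_gt0 sd.
  have As : A s by apply: dA => //=; rewrite sub0r normrN gtr0_norm.
  have := le_trans (@ereal_sup_ubound _ _ _ (ex_intro2 _ _ s As erefl)) supe.
  rewrite /= lee_fin lerN2 ler_pdivlMr // powR_gt0 //.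
have [S f_large] : exists S, forall s, S < s -> 1 <= f s / s^-1.
  move/cvgryPge/(_ 1): f_oo => [S [_ HS]]; by exists S.
pose b := Num.max (S + 1) (d + 1).
have bS : S < b by rewrite lt_max ltrDl ltr01.
have db : d <= b by rewrite le_max lerDl ler01 orbT.
have cab : {within `[d, b], continuous f}.
  apply: continuous_subspaceW f_cont => s /=; rewrite !in_itv /= andbT => /andP[ds _].
  by lra.
have [s0 s0_in f_min] := EVT_min db cab.
have s0_gt0 : 0 < s0 by move: s0_in; rewrite in_itv /= => /andP[h _]; lra.
have mu_gt0 := f_pos s0 s0_gt0; set mu := f s0 in mu_gt0 f_min.
exists (Num.min e (Num.min 1 (mu * d))); first by rewrite !lt_min e_gt0 ltr01 mulr_gt0.
move=> s m s_gt0 sm m_ge1; set c := Num.min _ _.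
have c_e : c <= e by rewrite ge_min lexx.
have c_1 : c <= 1 by rewrite !ge_min lexx !orbT.
have c_mu : c <= mu * d by rewrite !ge_min lexx !orbT.
have w_le := powR_weight_le p_gt0 s_gt0 sm.
have w_ge0 : 0 <= s `^ p * m `^ (- 1 - p) by rewrite mulr_ge0 ?powR_ge0.
have [sd|ds] := ltP s d.
  apply: le_trans (f_small s s_gt0 sd); apply: ler_pM => //.
    by rewrite /c !le_min (ltW e_gt0) ler01 mulr_ge0 // ltW.
  rewrite ler_piMr ?powR_ge0 //.
  have -> : - 1 - p = - (1 + p) by ring.
  rewrite powRN invf_le1 ?powR_gt0 //; last by lra.
  have p1_ge0 : 0 <= 1 + p by lra.
  by have := ler_powR m_ge1 p1_ge0; rewrite powRr0.
have [sb|bs] := leP s b.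
  have fs : mu <= f s by apply: f_min; rewrite in_itv /= ds.
  apply: le_trans fs; apply: le_trans (_ : mu * d * s^-1 <= _).
    by apply: ler_pM => //; rewrite /c !le_min (ltW e_gt0) ler01 mulr_ge0 // ltW.
  by rewrite ler_pdivrMr // ler_pM2l.
have := f_large s (lt_trans bS bs); rewrite invrK => fs.
apply: le_trans (_ : 1 * s^-1 <= _); last by rewrite mul1r -(@ler_pM2r _ s) // mulVf ?gt_eqF.
by apply: ler_pM => //; rewrite /c !le_min (ltW e_gt0) ler01 mulr_ge0 // ltW.
Qed.

End Nonlinearity.

(** * From the exterior domain to the radial system *)

Section Exterior.
Variables (R : realType) (j : nat).
Local Notation n := (j.+3).
Variable I : ('rV[R]_n -> R) -> R.
Hypothesis I_int : integral_functional I.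
Implicit Types (x y z : 'rV[R]_n) (s t r : R) (u v w F : 'rV[R]_n -> R) (g : nat -> R -> R)
  (U : set 'rV[R]_n).
Local Notation avg := (shell_average I).
Local Notation bump := (@bump R).

Lemma exterior_shell_in U R1 (s1 s2 : R) : 0 <= R1 ->
  (forall z, R1 ^+ 2 <= sqdist 0 z -> U z) -> R1 <= s1 -> shell_in U 0 s1 s2.
Proof.
move=> R1_ge0 UR R1s z z1 _; apply: UR; apply: le_trans z1.
by rewrite lerXn2r ?nnegrE // (le_trans R1_ge0).
Qed.

Lemma superbiharmonic_shell_le U v (v1 v2 : 'I_n -> 'rV[R]_n -> R) w
    (w1 w2 : 'I_n -> 'rV[R]_n -> R) (R1 s m : R) z :
  superbiharmonic_on U v v1 v2 w w1 w2 -> 0 < R1 ->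
  (forall z, R1 ^+ 2 <= sqdist 0 z -> U z) -> 4 * R1 <= s ->
  (forall t, s / 2 <= t -> t <= 2 * s -> avg n bump v 0 t <= m) ->
  s ^+ 2 <= sqdist 0 z -> sqdist 0 z <= 4 * s ^+ 2 ->
  v z <= (1 + `|sup_constant R j|) * m.
Proof.
move=> sb R1_gt0 UR Rs V_le z1 z2; have s_gt0 : 0 < s by lra.
have [[cv _ _ _ _] _ _ _ v_ge0] := sb.
have pb := @profile_bump R; pose V := avg n bump v 0.
set C0 : R := 1 + _; have C0_gt0 : 0 < C0 by exact: ltr_wpDr.
(* The Euclidean length of z, between s and 2 s. From s >= 4 R1, the ball of radius r / 4 around z
   and the shell at radius 2 r / 3 are in [U], and 2 r / 3 is in the window [s / 2, 2 s]. *)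
pose r := Num.sqrt (sqdist 0 z).
have rE : r ^+ 2 = sqdist 0 z by rewrite sqr_sqrtr // sqdist_ge0.
have r_ge0 : 0 <= r by exact: sqrtr_ge0.
have sr : s <= r by rewrite -(@ler_pXn2r _ 2) ?nnegrE ?rE // ltW.
have r2s : r <= 2 * s.
  rewrite -(@ler_pXn2r _ 2) ?nnegrE ?rE ?mulr_ge0 ?(ltW s_gt0) //.
  by rewrite exprMn (_ : 2 ^+ 2 = 4) //; ring.
have rR : 4 * R1 <= r by exact: le_trans sr.
have r_gt0 : 0 < r by lra.
have rR' : R1 <= 2 / 3 * r by lra.
have r'_ge0 : 0 <= 2 / 3 * r by lra.
have U0 := @exterior_shell_in U R1 (2 / 3 * r) (2 / 3 * r) (ltW R1_gt0) UR rR'.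
have [B B_ge0 vB] := bounded_on_shell_exists r'_ge0 U0 cv.
have Uball y : sqdist z y <= (r / 4) ^+ 2 -> U y.
  move=> zy; apply: UR; have := sqdist_ge_perturb 0 z y; rewrite -rE.
  have : R1 ^+ 2 <= (r / 4) ^+ 2 by rewrite lerXn2r ?nnegrE //; clear -R1_gt0 rR; lra.
  rewrite [(r / 4) ^+ 2]exprMn in zy *.
  have -> : 4^-1 ^+ 2 = 1 / 16 :> R by field.
  move: zy; have -> : 4^-1 ^+ 2 = 1 / 16 :> R by field.
  move: (r ^+ 2) (exprn_ge0 2 r_ge0) (R1 ^+ 2) (sqdist z y) (sqdist 0 y) => A A_ge0 B' C D h1 h2 h3.
  by lra.
have := superbiharmonic_sup_le I_int sb r_gt0 (esym rE) Uball U0 vB B_ge0.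
move=> /le_trans; apply.
have V'_le : V (2 / 3 * r) <= m by apply: V_le; clear -sr r2s s_gt0; lra.
have V'_ge0 : 0 <= V (2 / 3 * r).
  have r'_gt0 : 0 < 2 / 3 * r by exact: lt_le_trans rR'.
  by apply: (shell_average_ge0 I_int n pb r'_gt0 U0 cv) => // t _; exact: bump_ge0.
apply: le_trans (_ : C0 * V (2 / 3 * r) <= _); last by rewrite ler_wpM2l // ltW.
by rewrite ler_wpM2r // (le_trans (ler_norm _)) // lerDr.
Qed.

Lemma exterior_superbiharmonic_false U v (v1 v2 : 'I_n -> 'rV[R]_n -> R) w
    (w1 w2 : 'I_n -> 'rV[R]_n -> R) (R1 c0 p : R) :
  superbiharmonic_on U v v1 v2 w w1 w2 -> 0 < R1 ->
  (forall z, R1 ^+ 2 <= sqdist 0 z -> U z) ->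
  (forall z, U z -> 0 < v z) -> 0 < c0 -> 1 < p -> p * j.+1%:R = j.+1%:R + 4 ->
  (forall z m, U z -> v z <= m -> 1 <= m ->
    c0 * (v z `^ p * m `^ (- 1 - p)) <= - \sum_(i < n) w2 i z) -> False.
Proof.
move=> sb R1_gt0 UR v_gt0 c0_gt0 p_gt1 pk Lw_le.
have [C2v wE C2w Lw_le0 v_ge0] := sb.
have [cv _ _ _ _] := C2v; have [cw _ _ _ cw2] := C2w.
pose Lw z := \sum_(i < n) w2 i z.
have cLw z : U z -> {for z, continuous Lw}.
  by move=> Uz; apply: (@continuous_for_sum _ _ _ _ w2) => i; exact: cw2.
have shellU (s1 s2 : R) : R1 <= s1 -> shell_in U 0 s1 s2.
  exact: exterior_shell_in (ltW R1_gt0) UR.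
have pb := @profile_bump R; have pm := profile_mul_id pb; have pmm := profile_mul_id pm.
have [_ blo bhi _] := pb; have [_ lo hi _] := pmm.
pose V := avg n bump v 0; pose V1 := avg n.+1 (dilation_profile n%:R bump) v 0.
pose W := avg n (mul_id_profile bump) w 0.
pose W1 := avg n.+1 (dilation_profile n%:R (mul_id_profile bump)) w 0.
pose F s := - avg n (mul_id_profile (mul_id_profile bump)) Lw 0 s.
(* The 1 gives [1 <= a] as the radial system asks; 4 R1 is the radius from which the pointwise bound
   holds. *)
pose a : R := 1 + 4 * R1; have a_gt0 : 0 < a by rewrite /a; lra.
have in_shell s z : a <= s -> (sqdist 0 z * s^-1 ^+ 2 <= 1) \/ (4 <= sqdist 0 z * s^-1 ^+ 2) \/
    [/\ U z, s ^+ 2 <= sqdist 0 z & sqdist 0 z <= 4 * s ^+ 2].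
  move=> as_; have s_gt0 : 0 < s by lra.
  have [t1|t1] := leP (sqdist 0 z * s^-1 ^+ 2) 1; first by left.
  have [t4|t4] := leP 4 (sqdist 0 z * s^-1 ^+ 2); first by right; left.
  right; right; move: t1 t4; rewrite exprVn ltr_pdivlMr ?exprn_gt0 // ltr_pdivrMr ?exprn_gt0 // mul1r => t1 t4.
  split; try exact: ltW.
  apply: UR; apply: le_trans (ltW t1); rewrite lerXn2r ?nnegrE ?(ltW R1_gt0) ?(ltW s_gt0) //.
  by move: as_; rewrite /a; lra.
have bs N g u s : profile N g -> (forall z, U z -> {for z, continuous u}) -> a <= s ->
    bounded_support (fun z => u z * g 0%N (sqdist 0 z * s^-1 ^+ 2)).
  move=> pg cu as_; have s_gt0 : 0 < s by lra.
  have R1s : R1 <= s by move: as_; rewrite /a; lra.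
  exact: continuous_integrand_bounded_support pg s_gt0 (shellU s s R1s) cu.
have c1 z : U z -> {for z, continuous (fun _ : 'rV[R]_n => (1 : R))}.
  by move=> _; exact: continuous_for_cst.
have T_gt0 s : 0 < s -> 0 < avg n bump (fun=> 1) 0 s.
  move=> s_gt0; apply: lt_le_trans (bump_mass_ge I_int 0 s_gt0).
  by rewrite divr_gt0 // exprn_gt0 // invr_gt0 mulr_gt0 // ltr0n.
have V_gt0 s : a <= s -> 0 < V s.
  move=> as_; have s_gt0 : 0 < s by lra.
  have R1s : R1 <= s by move: as_; rewrite /a; lra.
  (* A positive lower bound for v on the shell is obtained from an upper bound for 1 / v, which
     compactness provides. *)
  have cVv z : U z -> {for z, continuous (fun z => (v z)^-1)}.
    by move=> Uz; apply: continuousV; [rewrite gt_eqF // v_gt0|exact: cv].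
  have [B B_ge0 vB] := bounded_on_shell_exists (ltW s_gt0) (shellU s s R1s) cVv.
  have B1_gt0 : 0 < 1 + B by lra.
  apply: lt_le_trans (_ : (1 + B)^-1 * avg n bump (fun=> 1) 0 s <= _).
    by rewrite mulr_gt0 ?invr_gt0 // T_gt0.
  rewrite /V /shell_average mulrCA ler_wpM2l ?exprn_ge0 ?invr_ge0 ?(ltW s_gt0) //.
  have b1 := bs _ _ _ s pb c1 as_; have bv := bs _ _ _ s pb cv as_.
  rewrite -(integralZ I_int) //; apply: (integral_le I_int) => // [|z]; first exact: bounded_supportZ.
  have [t1|[t4|[Uz z1 z2]]] := in_shell s z as_.
  - by rewrite blo // !mulr0.
  - by rewrite bhi // !mulr0.
  rewrite [1 * _]mul1r ler_wpM2r ?bump_ge0 // invf_ple ?posrE ?v_gt0 //.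
  have z2' : sqdist 0 z <= (2 * s) ^+ 2 by rewrite exprMn (_ : 2 ^+ 2 = 4) //; ring.
  by have := vB z z1 z2'; have := ler_norm (v z)^-1; lra.
have F_ge0 s : a <= s -> 0 <= F s.
  move=> as_; have s_gt0 : 0 < s by lra.
  have R1s : R1 <= s by move: as_; rewrite /a; lra.
  rewrite oppr_ge0; apply: (shell_average_le0 I_int n pmm s_gt0 (shellU s s R1s) cLw _ Lw_le0) => t t_ge1.
  have t_ge0 : 0 <= t by exact: le_trans t_ge1.
  rewrite /mul_id_profile !mul0r !addr0; apply: mulr_ge0 => //.
  by apply: mulr_ge0 => //; exact: bump_ge0.
pose Tm : R := 3 ^+ 4 * 6 ^+ n.
have Tm_gt0 : 0 < Tm by apply: mulr_gt0; exact: exprn_gt0.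
pose C0 : R := 1 + `|sup_constant R j|; have C0_ge1 : 1 <= C0 by rewrite lerDl.
have C0_gt0 : 0 < C0 by lra.
have v_le s m z : a <= s -> (forall t, s / 2 <= t -> t <= 2 * s -> V t <= m) ->
    s ^+ 2 <= sqdist 0 z -> sqdist 0 z <= 4 * s ^+ 2 -> v z <= C0 * m.
  move=> as_; apply: (superbiharmonic_shell_le sb R1_gt0 UR).
  by move: as_; rewrite /a; lra.
have p_gt0 : 0 < p by lra.
(* Collects the constants of (C0 m)^(-1-p) and of Tm (V(s) / Tm)^p. *)
pose c : R := c0 * C0 `^ (- 1 - p) * (Tm^-1 `^ p * Tm).
have iTm_gt0 : 0 < Tm^-1 by rewrite invr_gt0.
have c_gt0 : 0 < c.
  by apply: mulr_gt0; [apply: mulr_gt0|apply: mulr_gt0] => //; exact: powR_gt0.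
apply: (@radial_system_no_solution R j V V1 W W1 F a c p) => //.
- by rewrite /a; lra.
- move=> s as_; have s_gt0 : 0 < s by lra.
  rewrite /W (funext wE).
  apply: (@shell_average_radial R j I I_int U v v1 v2 bump 0 R1 (2 * s)) => //; try (move: as_; rewrite /a; lra).
  exact: shellU.
- move=> s as_; have s_gt0 : 0 < s by lra.
  have := @shell_average_radial R j I I_int U w w1 w2 (mul_id_profile bump) 0 R1 (2 * s) s C2w pm R1_gt0.
  move=> H; feed H; first by move: as_; rewrite /a; lra.
  feed H; first by lra.
  feed H; first exact: shellU.
  by case: H => h1 h2; split=> //; rewrite /F opprK.
move=> s m as_ m_ge1 V_le; have s_gt0 : 0 < s by lra.
have Cm_ge1 : 1 <= C0 * m by rewrite -[1]mulr1; apply: ler_pM.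
have vV := V_gt0 s as_.
(* Jensen's inequality is replaced by the tangent of [x^p] at [x0]; dividing [V s]
   by the upper bound [Tm] of the mass of the bump instead of by the mass itself
   loses only a constant. *)
pose x0 : R := V s * Tm^-1; have x0_gt0 : 0 < x0 by apply: mulr_gt0.
pose K : R := c0 * (C0 * m) `^ (- 1 - p).
have K_gt0 : 0 < K by apply: mulr_gt0 => //; rewrite powR_gt0 // (lt_le_trans ltr01).
have b1 := bs _ _ _ s pb c1 as_; have bv := bs _ _ _ s pb cv as_.
have bL := bs _ _ _ s pmm cLw as_.
have bl := bounded_support_lin (K * ((1 - p) * x0 `^ p)) b1 (bounded_supportZ (K * (p * x0 `^ (p - 1))) bv).
have IL : K * ((1 - p) * x0 `^ p) * I (fun z => 1 * bump 0 (sqdist 0 z * s^-1 ^+ 2)) +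
    K * (p * x0 `^ (p - 1)) * I (fun z => v z * bump 0 (sqdist 0 z * s^-1 ^+ 2)) <=
    - I (fun z => Lw z * mul_id_profile (mul_id_profile bump) 0 (sqdist 0 z * s^-1 ^+ 2)).
  rewrite -[leRHS]mulN1r -(integralZ I_int (-1) bL) -(integralZ I_int (K * (p * x0 `^ (p - 1))) bv).
  rewrite -(integral_linear I_int _ b1 (bounded_supportZ _ bv)).
  apply: (integral_le I_int) => // [|z]; first exact: bounded_supportZ.
  have [t1|[t4|[Uz z1 z2]]] := in_shell s z as_.
  - by rewrite lo // blo // !mulr0 addr0.
  - by rewrite hi // bhi // !mulr0 addr0.
  have vz := v_gt0 z Uz.
  have tan := powR_tangent_le p_gt1 x0_gt0 vz.
  have vle := v_le s m z as_ V_le z1 z2.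
  have := Lw_le z (C0 * m) Uz vle Cm_ge1; rewrite -/(Lw z) => Lz.
  have t_ge1 : 1 <= sqdist 0 z * s^-1 ^+ 2 by rewrite exprVn ler_pdivlMr ?exprn_gt0 // mul1r.
  have b_ge0 := bump_ge0 (sqdist 0 z * s^-1 ^+ 2).
  have -> : mul_id_profile (mul_id_profile bump) 0 (sqdist 0 z * s^-1 ^+ 2) =
     (sqdist 0 z * s^-1 ^+ 2) ^+ 2 * bump 0 (sqdist 0 z * s^-1 ^+ 2).
    by rewrite /mul_id_profile; ring.
  move: (sqdist 0 z * s^-1 ^+ 2) t_ge1 b_ge0 => t t_ge1 b_ge0.
  apply: le_trans (_ : K * v z `^ p * bump 0 t <= _).
    have -> : K * ((1 - p) * x0 `^ p) * (1 * bump 0 t) + K * (p * x0 `^ (p - 1)) * (v z * bump 0 t) =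
       K * ((1 - p) * x0 `^ p + p * x0 `^ (p - 1) * v z) * bump 0 t by ring.
    by rewrite ler_wpM2r // ler_wpM2l // ltW.
  have -> : -1 * (Lw z * (t ^+ 2 * bump 0 t)) = - Lw z * (t ^+ 2 * bump 0 t) by ring.
  have {}Lz : K * v z `^ p <= - Lw z by move: Lz; congr (_ <= _); rewrite /K; ring.
  (* On the support t >= 1, so the weight t^2 b of F dominates b. *)
  apply: ler_pM => //; first by rewrite mulr_ge0 ?powR_ge0 // ltW.
  by rewrite ler_peMl // exprn_ege1.
have i_ge0 : 0 <= s^-1 ^+ n by rewrite exprn_ge0 // invr_ge0 ltW.
have FE : F s = s^-1 ^+ n * - I (fun z => Lw z * mul_id_profile (mul_id_profile bump) 0 (sqdist 0 z * s^-1 ^+ 2)).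
  by rewrite /F /shell_average mulrN.
rewrite FE; apply: le_trans (ler_wpM2l i_ge0 IL).
set T := avg n bump (fun=> 1) 0 s.
have T_le : T <= Tm by exact: bump_mass_le.
have -> : s^-1 ^+ n * (K * ((1 - p) * x0 `^ p) * I (fun z => 1 * bump 0 (sqdist 0 z * s^-1 ^+ 2)) +
    K * (p * x0 `^ (p - 1)) * I (fun z => v z * bump 0 (sqdist 0 z * s^-1 ^+ 2))) =
    K * ((1 - p) * x0 `^ p * T + p * x0 `^ (p - 1) * V s).
  by rewrite /T /V /shell_average; ring.
have VE : V s = x0 * Tm by rewrite /x0 mulfVK // gt_eqF.
have x0p : x0 `^ (p - 1) * x0 = x0 `^ p.
  by rewrite -{2}(powRr1 (ltW x0_gt0)) -powRD ?subrK // [x0 == 0]gt_eqF ?implybT.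
have -> : p * x0 `^ (p - 1) * V s = p * x0 `^ p * Tm by rewrite VE -x0p; ring.
apply: le_trans (_ : K * (x0 `^ p * Tm) <= _).
  have -> : c * (V s `^ p * m `^ (- 1 - p)) = K * (x0 `^ p * Tm); last by [].
  have m_ge0 : 0 <= m by apply: le_trans m_ge1.
  rewrite /c /K /x0 (powRM p (ltW vV) (ltW iTm_gt0)) (powRM _ (ltW C0_gt0) m_ge0).
  by ring.
rewrite ler_wpM2l ?(ltW K_gt0) //.
have xp_ge0 : 0 <= x0 `^ p by exact: powR_ge0.
(* The constant term of the tangent has the negative factor 1 - p, so replacing the mass T by the
   larger Tm goes in the right direction. *)
have : 0 <= (p - 1) * (x0 `^ p * (Tm - T)).
  by apply: mulr_ge0; [lra|apply: mulr_ge0 => //; rewrite subr_ge0].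
have -> : (1 - p) * x0 `^ p * T + p * x0 `^ p * Tm =
  x0 `^ p * Tm + (p - 1) * (x0 `^ p * (Tm - T)) by ring.
by move: (_ * (_ * _)) => q; rewrite lerDl.
Qed.

End Exterior.

(** * Functions of class C^k *)

Section ClassCk.
Variables (R : realType) (n : nat).
Implicit Types (z : 'rV[R]_n) (U : set 'rV[R]_n) (u g : 'rV[R]_n -> R) (k : nat).

Lemma near_open_eq U u g z : open U -> U z -> (forall y, U y -> u y = g y) ->
  \forall y \near z, u y = g y.
Proof.
move=> U_open Uz ug.
by apply: (@filterS _ _ (@nbhs_filter _ z) _ _ ug); exact: open_nbhs_nbhs.
Qed.

Lemma within_continuousP U u : open U ->
  {within U, continuous u} <-> forall z, U z -> {for z, continuous u}.
Proof.
move=> U_open; rewrite continuous_open_subspace //; split=> cu z.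
  by move=> Uz; apply: cu; rewrite inE.
by rewrite inE; exact: cu.
Qed.

(** The equality is assumed on [U] only, because that is all the induction can offer: the partial
    derivatives of [g] are known there alone. Openness makes it hold near each point, so continuity
    and derivatives transfer. *)
Lemma Ck_sum U k (m : nat) (u : 'I_m -> 'rV[R]_n -> R) g : open U ->
  (forall l, Ck U k (u l)) -> (forall z, U z -> g z = \sum_(l < m) u l z) -> Ck U k g.
Proof.
move=> U_open.
have sumE (w : 'I_m -> 'rV[R]_n -> R) : (fun z => \sum_(l < m) w l z) = \sum_(l < m) w l.
  by apply/funext => z; rewrite fct_sumE.
have sum_cont (w : 'I_m -> 'rV[R]_n -> R) h : (forall l, {within U, continuous (w l)}) ->
    (forall z, U z -> h z = \sum_(l < m) w l z) -> {within U, continuous h}.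
  move=> cw hE; apply/within_continuousP => // z Uz.
  have hE' := near_open_eq U_open Uz (fun y Uy => esym (hE y Uy)).
  have cS : {for z, continuous (fun y => \sum_(l < m) w l y)}.
    apply: continuous_for_sum => l.
    by have /(within_continuousP _ U_open) := cw l; exact.
  move: cS; rewrite /prop_for /continuous_at -hE // => cS.
  by apply: cvg_trans cS; apply: (near_eq_cvg hE').
elim: k u g => [|k IH] u g Cu gE; have cg : {within U, continuous g} by
  apply: sum_cont gE => l; have [] := Cu l.
  by [].
have dg i z : U z -> is_derive z (delta_mx 0 i) g (\sum_(l < m) partial i (u l) z).
  move=> Uz; apply: (near_eq_is_derive (near_open_eq U_open Uz (fun y Uy => esym (gE y Uy)))).
  rewrite sumE; apply: is_derive_sum => l.
  by have [_ /(_ i)[dl _]] := Cu l; apply/derivableP/dl.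
split=> // i; split=> [z Uz|]; first by have [] := dg i z Uz.
apply: (IH (fun l => partial i (u l))) => [l|z Uz].
  by have [_ /(_ i)[]] := Cu l.
by have [_ H] := dg i z Uz; exact: H.
Qed.

Lemma Ck_C2_derivatives U k u : open U -> Ck U k.+2 u ->
  C2_derivatives U u (fun i => partial i u) (fun i => partial i (partial i u)).
Proof.
move=> U_open [/(within_continuousP _ U_open) cu Cu]; split=> // i z Uz.
- by apply/derivableP; have [du _] := Cu i; exact: du.
- by have [_ [_ /(_ i)[du _]]] := Cu i; apply/derivableP/du.
- by have [_ [/(within_continuousP _ U_open) c1 _]] := Cu i; exact: c1.
have [_ [_ /(_ i)[_ C2]]] := Cu i.
by case: k C2 {Cu} => [|k] [/(within_continuousP _ U_open) c2 _]; exact: c2.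
Qed.

Lemma Ck_laplacian U k u : open U -> Ck U k.+2 u -> Ck U k (laplacian u).
Proof.
move=> U_open Cu.
apply: (@Ck_sum U k n (fun i => partial i (partial i u))) => // i.
by have [_ /(_ i)[_ [_ /(_ i)[]]]] := Cu.
Qed.

End ClassCk.

Theorem theorem1p3 (R : realType) (n : nat) (f : R -> R)
  (n_ge3 : (3 <= n)%N)
  (f_cont : {within `]0, +oo[%classic, continuous f})
  (f_pos : forall s : R, 0 < s -> 0 < f s)
  (f_liminf0 :
     (0 < limf_einf (fun s : R => (f s / s `^ (1 + 4 / (n%:R - 2)))%:E)
            0^'+)%E)
  (f_lim_pinfty : f s / s^-1 @[s --> +oo] --> +oo) :
  ~ exists U : set 'rV[R]_n,
      exterior_domain U /\ exists v : 'rV[R]_n -> R, C4_positive_solution f U v.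
Proof.
case: n n_ge3 f_liminf0 => [|[|[|j]]] // _ f_liminf0 [U [[K cptK UE] [v [Cv v_gt0 v_sol]]]].
have U_open : open U.
  by rewrite UE; apply: closed_openC; apply: compact_closed cptK; exact: norm_hausdorff.
pose p : R := 1 + 4 / j.+1%:R.
have j_gt0 : 0 < j.+1%:R :> R by rewrite ltr0n.
have p_gt1 : 1 < p by rewrite ltrDl divr_gt0.
have pE : p * j.+1%:R = j.+1%:R + 4 by rewrite mulrDl mul1r divfK // gt_eqF.
have [c0 c0_gt0 f_ge] : exists2 c0, 0 < c0 & forall s m, 0 < s -> s <= m -> 1 <= m ->
    c0 * (s `^ p * m `^ (- 1 - p)) <= f s.
  have -> : p = 1 + 4 / (j.+3%:R - 2) by rewrite /p -(natrB _ (_ : 2 <= j.+3)%N).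
  refine (nonlinearity_lower_bound _ f_cont f_pos f_liminf0 f_lim_pinfty).
  by rewrite -(natrB _ (_ : 2 <= j.+3)%N) // addr_gt0 // divr_gt0.
have [B [_ KB]] := compact_bounded cptK.
pose B1 := `|B| + 1.
have B1_gt0 : 0 < B1 by rewrite ltr_wpDl.
have KB1 z : K z -> `|z| <= B1.
  by apply: KB; rewrite /B1; have := ler_norm B; lra.
have n_gt0 : 0 < j.+3%:R :> R by rewrite ltr0n.
have n_ge1 : 1 <= j.+3%:R :> R by rewrite ler1n.
(* [B1] bounds K in the sup norm, so squared Euclidean lengths in K are at most n B1^2, which is at
   most (n B1)^2 and less than R1^2. *)
pose R1 : R := j.+3%:R * B1 + 1.
have R1_gt0 : 0 < R1 by rewrite ltr_wpDl // mulr_ge0 // ltW.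
have UR z : R1 ^+ 2 <= sqdist 0 z -> U z.
  move=> R1z; rewrite UE => Kz.
  have := @sqdist_le_norm _ _ 0 z B1 (ltW B1_gt0); rewrite subr0 => /(_ (KB1 z Kz)).
  move: R1z; rewrite /R1; clear -B1_gt0 n_ge1 n_gt0; move: (j.+3%:R : R) n_ge1 n_gt0 (sqdist 0 z) B1 B1_gt0 => N N1 N0 q b b0 h1 h2.
  have : 0 <= (N - 1) * (N * b ^+ 2).
    by apply: mulr_ge0; [lra|apply: mulr_ge0; [exact: ltW|exact: sqr_ge0]].
  have : 0 < N * b by exact: mulr_gt0.
  by nra.
have [I I_int] := @integral_functional_exists R j.+3.
have C2v := Ck_C2_derivatives U_open Cv.
have C2w := Ck_C2_derivatives U_open (Ck_laplacian U_open Cv).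
apply: (@exterior_superbiharmonic_false R j I I_int U v _ _ (laplacian v) _ _ R1 c0 p) => //.
  split=> //; [exact: C2v|exact: C2w| |].
    by move=> z Uz; rewrite -oppr_ge0; apply: le_trans (v_sol z Uz); exact/ltW/f_pos/v_gt0.
  by move=> z Uz; apply/ltW/v_gt0.
by move=> z m Uz vm m1; apply: le_trans (v_sol z Uz); apply: f_ge => //; exact: v_gt0.
Qed.
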